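(* Every twin-free planar graph $G$ (with at least one edge) satisfies $\operatorname{psr}(G)>1/16$.
   Context: All graphs are finite and simple; $e(G)$ is the number of edges of $G$. A plane graph is a planar graph together with a fixed planar embedding (drawing in the plane without crossings). ''Subgraph'' is meant up to isomorphism: a plane graph $H$ is a subgraph of $G$ if its underlying abstract graph is isomorphic to a subgraph of $G$. A plane graph $H$ which is a subgraph of a planar graph $G$ is a plane-saturated subgraph of $G$ if adding any edge (potentially introducing new vertices) to the drawing $H$ either introduces a crossing or causes the resulting graph to no longer be a subgraph of $G$. The plane-saturation ratio $\operatorname{psr}(G)$ of a planar graph $G$ with at least one edge is the minimum of $e(H)/e(G)$ over all plane-saturated subgraphs $H$ of $G$. (It suffices to consider $H$ having as many vertices as $G$, since isolated vertices may be added to $H$.) Two distinct vertices are twins if they have the same neighborhood; a graph is twin-free if it has no pair of twins. *)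

(* Defs.v *)
From HB Require Import structures.
From mathcomp Require Import all_boot all_order all_algebra.
From mathcomp Require Import all_classical all_reals all_analysis.

Set Implicit Arguments.
Unset Strict Implicit.
Unset Printing Implicit Defensive.

Import Order.TTheory GRing.Theory Num.Theory.
Import numFieldNormedType.Exports.

Local Open Scope classical_set_scope.
Local Open Scope ring_scope.

Record sgraph := SGraph {
  vertex :> finType;
  adj : rel vertex;
  adj_sym : symmetric adj;
  adj_irr : irreflexive adj }.

Definition edges (G : sgraph) : {set {set G}} :=
  [set [set p.1; p.2] | p in [pred p : G * G | adj p.1 p.2]]%SET.

Definition nbhd (G : sgraph) (x : G) : {set G} := [set y | adj x y]%SET.

Definition twins (G : sgraph) (x y : G) : Prop := x <> y /\ nbhd x = nbhd y.

Definition twin_free (G : sgraph) : Prop := forall x y : G, ~ twins x y.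

(* [H] is isomorphic to a (not necessarily induced) subgraph of [G]. *)
Definition is_subgraph (H G : sgraph) : Prop :=
  exists2 f : H -> G, injective f & forall x y, adj x y -> adj (f x) (f y).

Definition is_arc (R : realType) (A : set (R * R)) (p q : R * R) : Prop :=
  exists g : R -> R * R,
    [/\ {within `[0, 1], continuous g},
        {in `[0, 1] &, injective g},
        g 0 = p, g 1 = q & A = g @` `[0, 1]].

(* [curve] is only meaningful on the edges of [G]. *)
Record embedding (R : realType) (G : sgraph) := Embedding {
  pos : G -> R * R;
  curve : {set G} -> set (R * R);
  pos_inj : injective pos;
  curve_arc : forall x y, adj x y -> is_arc (curve [set x; y]%SET) (pos x) (pos y);
  curve_vertex : forall e z, e \in edges G -> curve e (pos z) -> z \in e;
  curve_cross : forall e f p, e \in edges G -> f \in edges G -> e <> f ->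
    curve e p -> curve f p -> exists2 z, z \in e :&: f & p = pos z }.

Definition planar (R : realType) (G : sgraph) : Prop := inhabited (embedding R G).

Record plane_graph (R : realType) := PlaneGraph {
  graph_of :> sgraph;
  drawing : embedding R graph_of }.

(* [H'] is the plane graph [H] together with one new edge [uv]; either endpoint
   may be an old vertex of [H] (in the image of [j]) or a new one. *)
Definition adds_edge (R : realType) (H H' : plane_graph R) : Prop :=
  exists (j : H -> H') (u v : H'),
    [/\ injective j,
        forall z, [\/ (exists x, z = j x), z = u | z = v],
        (u != v) && ([set u; v]%SET \notin [set j @: e | e : {set H} in edges H]%SET),
        edges H' = ([set u; v] |: [set j @: e | e : {set H} in edges H])%SET &
        (forall x, pos (drawing H') (j x) = pos (drawing H) x) /\
        (forall e, e \in edges H ->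
           curve (drawing H') (j @: e) = curve (drawing H) e)].

Definition plane_saturated (R : realType) (H : plane_graph R) (G : sgraph) : Prop :=
  is_subgraph H G /\
  forall H' : plane_graph R, adds_edge H H' -> ~ is_subgraph H' G.

(* For [G] planar with an edge the ratios form a finite nonempty set, so that
   the infimum is a minimum. *)
Definition psr (R : realType) (G : sgraph) : R :=
  inf [set r : R | exists2 H : plane_graph R, plane_saturated H G &
                     r = #|edges H|%:R / #|edges G|%:R].

(* Main.v *)
(* Let [H] be plane-saturated in [G] with [m] edges. If two isolated vertices of [H]
   lie in the same face, every embedding of the edges of [H] into [G] leaves an
   independent set uncovered, since otherwise the edge joining those two vertices
   could be added. As [H] has at most [m + 1] faces, the only other case is
   [|G| <= 3 m + 1], where [e(G) < 3 |G|] suffices.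

   In the independent case, leaves of [H] are exchanged with uncovered vertices until
   no exchange enlarges the set [J] of vertices that can be freed; [J] is independent.
   Let [A] be the remaining vertices with at least two neighbours in [J] and [L] those
   with fewer, except for the vertices with no neighbour in [J] and at least three in
   [A], which cost nothing. Since [G] is twin-free, the bounds [3 n], [2 n] and
   [3 n / 2] on the number of edges of planar graphs (of girth 3, bipartite, bipartite
   of girth 6) give [e(G) < 16 |A| + 6 |L|], and discharging gives
   [8 |A| + 3 |L| <= 8 m].

   Edges of drawings are arbitrary arcs, so faces are handled by duality: points off a
   compact set [K] are classified by the homotopy class of [z |-> (z - a) / |z - a|] in
   the group of maps from [K] to the circle. For a graph this group is generated by the
   classes of points, nonzero distinct classes are independent, and its rank is at least
   [e - n] and at most [e]. *)
Require Import Defs.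
From HB Require Import structures.
From mathcomp Require Import all_boot all_order all_algebra.
From mathcomp Require Import all_classical all_reals all_analysis.
From mathcomp Require Import complex.
From mathcomp Require Import lra ring zify.

Set Implicit Arguments.
Unset Strict Implicit.
Unset Printing Implicit Defensive.

Import Order.TTheory GRing.Theory Num.Theory.
Import numFieldNormedType.Exports.
Local Open Scope classical_set_scope.
Local Open Scope ring_scope.
Local Open Scope complex_scope.

(** * Continuity on a set *)

(** All the topology rests on two facts about a compact plane set. By [rational_log], a function
    that has continuous arguments locally acquires one globally after multiplication by finitely
    many powers of factors [phi a]. By [index_zero], a product of such powers has no global argument
    when a bounded class contains exactly one of the points, with nonzero exponent. The first fact
    makes the winding vectors of points span the rational edge space modulo vertex coboundaries,
    which bounds the number of classes from below. The second makes them independent; it also shows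
    that the edges around a face contain a cycle and that an edge has at most two sides. On the
    combinatorial side the drawing is fixed but the map into [G] is not: isolated vertices may go
    anywhere and leaves may be moved, and after every such change the uncovered vertices must again
    be independent. The constant 16 arises because [16 |A| + 6 |L|] is twice the quantity
    [8 |A| + 3 |L|] bounded by discharging. *)

Section Continuity.
Variable R : realType.
Implicit Types (T U V : topologicalType).

Definition con T U (A : set T) (f : T -> U) :=
  forall x, A x -> f y @[y --> within A (nbhs x)] --> f x.

Lemma conP T U (A : set T) (f : T -> U) :
  con A f <-> {within A, continuous f}.
Proof. by split=> /subspace_continuousP. Qed.

Lemma con_sub T U (A B : set T) (f : T -> U) : A `<=` B -> con B f -> con A f.
Proof.
move=> AB cf x Ax; apply: cvg_trans (cf x (AB _ Ax)).
by move=> P; exact: within_subset.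
Qed.

Lemma con_eq T U (A : set T) (f g : T -> U) :
  (forall x, A x -> f x = g x) -> con A f -> con A g.
Proof.
move=> fg cf x Ax; rewrite -(fg _ Ax); apply: cvg_trans (cf x Ax).
move=> P; rewrite /= !nbhs_simpl /= => H; rewrite /fmap /= /within /= in H *.
by apply: filterS H => y H Ay; rewrite /= -(fg _ Ay); exact: H.
Qed.

Lemma con_comp T U V (A : set T) (B : set U) (f : T -> U) (g : U -> V) :
  con A f -> con B g -> (forall x, A x -> B (f x)) -> con A (g \o f).
Proof.
move=> cf cg AB x Ax.
apply: (@cvg_comp _ _ _ f g _ (within B (nbhs (f x)))); last exact/cg/AB.
move=> P; rewrite /= !nbhs_simpl /= /within /= => H.
have := cf x Ax _ H; rewrite /= /fmap /within /= !nbhs_simpl /=.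
by apply: filterS => y H1 Ay; apply: H1 => //; exact: AB.
Qed.

Lemma con_continuous T U (A : set T) (f : T -> U) : continuous f -> con A f.
Proof. by move=> cf x Ax; apply: cvg_within_filter; exact: cf. Qed.

Lemma con_compT T U V (A : set T) (f : T -> U) (g : U -> V) :
  con A f -> continuous g -> con A (fun x => g (f x)).
Proof. by move=> cf cg; apply: (con_comp (B := setT) cf) => //; exact: con_continuous. Qed.

Lemma con_cst T U (A : set T) (c : U) : con A (fun=> c).
Proof. by move=> x _; exact: cvg_cst. Qed.

Lemma con_id T (A : set T) : con A id.
Proof. by apply: con_continuous => x; exact: cvg_id. Qed.

Lemma conU T U (A B : set T) (f : T -> U) : closed A -> closed B ->
  con A f -> con B f -> con (A `|` B) f.
Proof. by move=> cA cB /conP fA /conP fB; apply/conP; exact: withinU_continuous. Qed.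

Lemma conD T (A : set T) (f g : T -> R) : con A f -> con A g ->
  con A (fun x => f x + g x).
Proof. by move=> cf cg x Ax; apply: cvgD; [exact: cf|exact: cg]. Qed.

Lemma conN T (A : set T) (f : T -> R) : con A f -> con A (fun x => - f x).
Proof. by move=> cf x Ax; apply: cvgN; exact: cf. Qed.

Lemma conB T (A : set T) (f g : T -> R) : con A f -> con A g ->
  con A (fun x => f x - g x).
Proof. by move=> cf cg x Ax; apply: cvgB; [exact: cf|exact: cg]. Qed.

Lemma conM T (A : set T) (f g : T -> R) : con A f -> con A g ->
  con A (fun x => f x * g x).
Proof. by move=> cf cg x Ax; apply: cvgM; [exact: cf|exact: cg]. Qed.

Lemma conV T (A : set T) (f : T -> R) : con A f ->
  (forall x, A x -> f x != 0) -> con A (fun x => (f x)^-1).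
Proof. by move=> cf f0 x Ax; apply: cvgV; [exact: f0|exact: cf]. Qed.

Lemma con_pair T U V (A : set T) (f : T -> U) (g : T -> V) :
  con A f -> con A g -> con A (fun x => (f x, g x)).
Proof. by move=> cf cg x Ax; apply: cvg_pair; [exact: cf|exact: cg]. Qed.

Lemma con_fst T U V (A : set T) (f : T -> U * V) :
  con A f -> con A (fun x => (f x).1).
Proof. by move=> cf; apply: (con_compT cf) => x; exact: cvg_fst. Qed.

Lemma con_snd T U V (A : set T) (f : T -> U * V) :
  con A f -> con A (fun x => (f x).2).
Proof. by move=> cf; apply: (con_compT cf) => x; exact: cvg_snd. Qed.

Lemma con_ball (T U : pseudoMetricType R) (A : set T) (f : T -> U) x e : con A f -> A x ->
  0 < e -> exists2 d, 0 < d & forall y, A y -> ball x d y -> ball (f x) e (f y).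
Proof.
move=> cf Ax e0.
have /nbhs_ballP[d /= d0 H] : within A (nbhs x) (fun y => ball (f x) e (f y)).
  by apply: (cf x Ax); exact: nbhsx_ballx.
by exists d => // y Ay xy; exact: H.
Qed.

Lemma ball_con (T U : pseudoMetricType R) (A : set T) (f : T -> U) :
  (forall x e, A x -> 0 < e -> exists2 d, 0 < d &
     forall y, A y -> ball x d y -> ball (f x) e (f y)) -> con A f.
Proof.
move=> H x Ax P /nbhs_ballP[e /= e0 He].
have [d d0 Hd] := H x e Ax e0.
apply/nbhs_ballP; exists d => //= y xy Ay; apply: He; exact: Hd.
Qed.

Lemma con_sqrt T (A : set T) (f : T -> R) : con A f ->
  con A (fun x => Num.sqrt (f x)).
Proof. by move=> cf; apply: (con_compT cf) => x; exact: sqrt_continuous. Qed.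

Lemma con_atan T (A : set T) (f : T -> R) : con A f ->
  con A (fun x => atan (f x)).
Proof. by move=> cf; apply: (con_compT cf) => x; exact: continuous_atan. Qed.

Lemma con_cos T (A : set T) (f : T -> R) : con A f -> con A (fun x => cos (f x)).
Proof. by move=> cf; apply: (con_compT cf) => x; exact: continuous_cos. Qed.

Lemma con_sin T (A : set T) (f : T -> R) : con A f -> con A (fun x => sin (f x)).
Proof. by move=> cf; apply: (con_compT cf) => x; exact: continuous_sin. Qed.

End Continuity.

(** The supremum of the [x] with [P a x] can be passed by gluing unless it is [b]. This real
    induction replaces every subdivision of an interval into short pieces: path lifting, gluing of
    strips, constancy along an arc. *)
Lemma cousin (R : realType) (P : R -> R -> Prop) (a b : R) : a <= b ->
  (forall x y z, a <= x -> x <= y -> y <= z -> z <= b ->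
     P x y -> P y z -> P x z) ->
  (forall x, a <= x <= b -> exists2 e, 0 < e & forall y z,
     x - e < y -> y <= z -> z < x + e -> a <= y -> z <= b -> P y z) ->
  P a b.
Proof.
move=> ab glue loc.
pose S := [set x | a <= x <= b /\ P a x].
have Sa : S a.
  split; first by rewrite lexx.
  by have [|e e0 He] := loc a; rewrite ?lexx ?ab //; apply: He => //; lra.
have ubS : ubound S b by move=> x [/andP[]].
have hS : has_sup S by split; [exists a|exists b].
set s := sup S.
have as_ : a <= s by apply: ub_le_sup => //; exists b.
have sb : s <= b by apply: ge_sup => //; exists a.
have [|e e0 He] := loc s; first by rewrite as_.
have [x [/andP[ax xb] Pax] sx] := sup_adherent e0 hS.
have xs : x <= s by apply: ub_le_sup; [exists b|split=> //; rewrite ax].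
pose t := Num.min b (s + e / 2).
have st : s <= t by rewrite le_min sb /=; lra.
have tb : t <= b by rewrite ge_min lexx.
have te : t < s + e by rewrite gt_min; apply/orP; right; lra.
have Pat : P a t.
  apply: (glue a x t) => //; first by lra.
  by apply: He => //; lra.
have ts : t <= s by apply: ub_le_sup; [exists b|split=> //; rewrite tb andbT; lra].
have bs : b <= s + e / 2 -> P a b.
  by move=> bs; move: Pat; rewrite /t (_ : Num.min _ _ = b) //; apply/min_idPl.
case: (leP b (s + e/2)) => // h; move: ts; rewrite /t.
have -> : Num.min b (s + e / 2) = s + e / 2 by apply/min_idPr; lra.
by lra.
Qed.

(** * Continuous logarithms *)
Section Logarithms.
Variable R : realType.
Implicit Types (T : topologicalType) (t : R) (w : R[i]).

Definition uexp t : R[i] := cos t +i* sin t.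

Lemma uexp0 : uexp 0 = 1.
Proof. by rewrite /uexp cos0 sin0. Qed.

Lemma uexpD s t : uexp (s + t) = uexp s * uexp t.
Proof. by rewrite /uexp cosD sinD; simpc; congr (_ +i* _); ring. Qed.

Lemma uexp_neq0 t : uexp t != 0.
Proof.
apply/eqP => /eqP; rewrite eq_complex /= => /andP[/eqP c0 /eqP s0].
by have := cos2Dsin2 t; rewrite c0 s0 expr0n /= addr0 => /eqP; rewrite eq_sym oner_eq0.
Qed.

Lemma uexpN t : uexp (- t) = (uexp t)^-1.
Proof.
apply: (mulfI (uexp_neq0 t)); rewrite -uexpD addrN uexp0 divff //.
exact: uexp_neq0.
Qed.

Lemma uexpMz t (k : int) : uexp (k%:~R * t) = uexp t ^ k.
Proof.
have nat_case (n : nat) : uexp (n%:R * t) = uexp t ^+ n.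
  by elim: n => [|n IH]; rewrite ?mul0r ?uexp0 ?expr0 // exprS -IH -uexpD -natr1 mulrDl mul1r addrC.
case: k => n; first exact: nat_case.
by rewrite NegzE mulrNz mulNr uexpN -invr_expz; congr (_^-1); exact: nat_case.
Qed.

Lemma uexp2pi (k : int) : uexp (k%:~R * (pi *+ 2)) = 1.
Proof. by rewrite uexpMz {1}/uexp cos2pi sin2pi exp1rz. Qed.

Lemma uexp_gt0 t : 0 < uexp t -> exists k : int, t = k%:~R * (pi *+ 2).
Proof.
rewrite ltcE /= => /andP[/eqP s0 c0].
have pi0 := pi_gt0 R.
have twopi0 : (0 : R) < pi *+ 2 by rewrite pmulrn_lgt0.
pose k := Num.floor (t / (pi *+ 2)); exists k.
pose s := t - k%:~R * (pi *+ 2).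
have : uexp s = uexp t.
  by rewrite /s uexpD uexpN uexp2pi invr1 mulr1.
rewrite /uexp s0 => -[cs ss].
have s_ge0 : 0 <= s.
  by rewrite subr_ge0 -ler_pdivlMr // /k; exact: floor_le_tmp.
have s_lt : s < pi *+ 2.
  rewrite ltrBlDl -[X in _ + X]mul1r -mulrDl -ltr_pdivrMr //.
  by have := floorD1_gt (t / (pi *+ 2)); rewrite intrD1.
rewrite -cs in c0.
suff s00 : s = 0 by move/eqP: s00; rewrite subr_eq0 => /eqP.
apply/eqP; rewrite eq_le s_ge0 andbT leNgt; apply/negP => s_gt0.
case: (ltgtP s pi) => hs.
- by have := @sin_gt0_pi _ s; rewrite s_gt0 hs ss ltxx => /(_ isT).
- have h1 : 0 < s - pi < pi by rewrite subr_gt0 hs ltrBlDl /=; rewrite mulr2n in s_lt.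
  have := sin_gt0_pi h1; rewrite sinB ss cospi sinpi; lra.
- by move: c0; rewrite hs cospi; lra.
Qed.

Lemma angle_uniq w s t : 0 < w * uexp (- s) -> 0 < w * uexp (- t) ->
  exists k : int, s - t = k%:~R * (pi *+ 2).
Proof.
move=> ws wt; apply: uexp_gt0.
have : 0 < (w * uexp (- t)) * (w * uexp (- s))^-1 by rewrite mulr_gt0 ?invr_gt0.
have w0 : w != 0 by apply: contraTN ws => /eqP ->; rewrite mul0r ltxx.
by rewrite invfM -uexpN opprK mulrACA divff // mul1r -uexpD addrC.
Qed.

Lemma angle_shift w t (k : int) : 0 < w * uexp (- t) ->
  0 < w * uexp (- (t + k%:~R * (pi *+ 2))).
Proof. by rewrite opprD uexpD -mulNr -mulrNz uexp2pi mulr1. Qed.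

(* In [R[i]], [0 < w] says that [w] is a positive real: [th] is a continuous
   argument of [f] on [A], and [f] has no zero on [A]. *)
Definition haslog T (A : set T) (f : T -> R[i]) :=
  exists2 th : T -> R, con A th & forall z, A z -> 0 < f z * uexp (- th z).

Lemma haslog_sub T (A B : set T) f : A `<=` B -> haslog B f -> haslog A f.
Proof. by move=> AB [th cth H]; exists th; [exact: con_sub cth|move=> z /AB/H]. Qed.

Lemma haslog_eq T (A : set T) f g : (forall z, A z -> f z = g z) ->
  haslog A f -> haslog A g.
Proof. by move=> fg [th cth H]; exists th => // z Az; rewrite -fg //; exact: H. Qed.

Lemma haslogM T (A : set T) f g : haslog A f -> haslog A g ->
  haslog A (fun z => f z * g z).
Proof.
move=> [s cs Hs] [t ct Ht]; exists (fun z => s z + t z); first exact: conD.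
by move=> z Az; rewrite opprD uexpD mulrACA mulr_gt0 ?Hs ?Ht.
Qed.

Lemma haslogV T (A : set T) f : haslog A f -> haslog A (fun z => (f z)^-1).
Proof.
move=> [s cs Hs]; exists (fun z => - s z); first exact: conN.
by move=> z Az; rewrite uexpN -invfM invr_gt0 Hs.
Qed.

Lemma haslog1 T (A : set T) : haslog A (fun=> 1).
Proof. by exists (fun=> 0); [exact: con_cst|move=> z _; rewrite oppr0 uexp0 mulr1]. Qed.

Lemma haslogX T (A : set T) f (k : int) : haslog A f -> haslog A (fun z => f z ^ k).
Proof.
have nat_case (n : nat) : haslog A f -> haslog A (fun z => f z ^+ n).
  move=> Hf; elim: n => [|n IH]; first exact: haslog1.
  by apply: haslog_eq (haslogM Hf IH) => z _; rewrite exprS.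
case: k => n Hf; first exact: nat_case.
by rewrite NegzE; apply: haslog_eq (haslogV (nat_case n.+1 Hf)) => z _; rewrite -invr_expz.
Qed.

Lemma haslog_neq0 T (A : set T) f z : haslog A f -> A z -> f z != 0.
Proof. by move=> [s _ H] /H; apply: contraTN => /eqP ->; rewrite mul0r ltxx. Qed.

Lemma haslog_comp T T' (A : set T) (B : set T') f (g : T -> T') :
  con A g -> (forall z, A z -> B (g z)) -> haslog B f -> haslog A (f \o g).
Proof.
move=> cg AB [th cth H]; exists (th \o g); first exact: (con_comp cg cth).
by move=> z /AB/H.
Qed.

Definition ccon T (A : set T) (f : T -> R[i]) :=
  con A (fun x => complex.Re (f x)) /\ con A (fun x => complex.Im (f x)).

Lemma ccon_cst T (A : set T) w : ccon A (fun=> w).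
Proof. by split; exact: con_cst. Qed.

Lemma cconM T (A : set T) f g : ccon A f -> ccon A g -> ccon A (fun x => f x * g x).
Proof.
move=> [f1 f2] [g1 g2]; split.
  apply: (con_eq _ (conB (conM f1 g1) (conM f2 g2))) => x _.
  by case: (f x) => a b; case: (g x).
apply: (con_eq _ (conD (conM f1 g2) (conM f2 g1))) => x _.
by case: (f x) => a b; case: (g x) => c d.
Qed.

Lemma ccon_sub T (A B : set T) f : A `<=` B -> ccon B f -> ccon A f.
Proof. by move=> AB [? ?]; split; exact: (con_sub AB). Qed.

(* The principal argument is computed as [2 atan (y / (|w| + x))], which is
   continuous off the closed negative real axis. *)
Definition parg w : R :=
  2 * atan (complex.Im w / (Num.sqrt (complex.Re w ^+ 2 + complex.Im w ^+ 2) + complex.Re w)).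

Lemma parg_den (x y : R) : ~ (x +i* y <= 0) -> 0 < Num.sqrt (x ^+ 2 + y ^+ 2) + x.
Proof.
rewrite lecE /= => xy.
have xr : `|x| <= Num.sqrt (x ^+ 2 + y ^+ 2).
  by rewrite -sqrtr_sqr ler_wsqrtr // lerDl sqr_ge0.
case: (ltP 0 x) => x0; first by rewrite (gtr0_norm x0) in xr; lra.
have y0 : y != 0 by apply/negP => /eqP y0; apply: xy; rewrite y0 eqxx.
suff : `|x| < Num.sqrt (x ^+ 2 + y ^+ 2) by rewrite ler0_norm //; lra.
rewrite -sqrtr_sqr ltr_sqrt; first by rewrite ltrDl exprn_even_gt0.
by rewrite ltr_wpDl ?sqr_ge0 // exprn_even_gt0.
Qed.

Lemma atan_gt0 (x y : R) : 0 < x -> 0 < (x +i* y)%C * uexp (- atan (y / x)).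
Proof.
move=> x0; set t := atan _.
have ct : 0 < cos t by apply: cos_gt0_pihalf; rewrite /t atan_gtNpi2 atan_ltpi2.
have yE : y = x * (sin t / cos t).
  have := atanK (y / x); rewrite -/t /tan => ->.
  by rewrite mulrCA divff ?mulr1 // gt_eqF.
rewrite /uexp cosN sinN; simpc; rewrite yE.
have cn : cos t != 0 by rewrite gt_eqF.
apply/andP; split; first by apply/eqP; field.
have -> : x * cos t + x * (sin t / cos t) * sin t = x / cos t * (cos t ^+ 2 + sin t ^+ 2).
  by field.
by rewrite cos2Dsin2 mulr1 divr_gt0.
Qed.

(** Half-angle formula: with [r = |w|] and [w = x + i y], the square of [(r + x) + i y] is
    [2 (r + x) w], and [(r + x) + i y] lies in the right half-plane, where [atan] of the slope is an
    argument. *)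
Lemma pargP w : ~ (w <= 0) -> 0 < w * uexp (- parg w).
Proof.
case: w => x y h; have d0 := parg_den h; rewrite /parg /=.
set r := Num.sqrt _ in d0 *; set t := atan _.
have rr : r ^+ 2 = x ^+ 2 + y ^+ 2 by rewrite sqr_sqrtr // addr_ge0 ?sqr_ge0.
have := atan_gt0 y d0; rewrite -/t => H.
have : 0 < (((r + x) +i* y)%C * uexp (- t)) ^+ 2 by rewrite exprn_gt0.
have -> : (((r + x) +i* y)%C * uexp (- t)) ^+ 2 =
    ((2 * (r + x)) +i* 0)%C * ((x +i* y)%C * uexp (- (2 * t))).
  have -> : 2 * t = t + t by ring.
  rewrite opprD uexpD; set u := uexp _.
  have -> : ((2 * (r + x)) +i* 0)%C * ((x +i* y)%C * (u * u)) = (((2 * (r + x)) +i* 0)%C * (x +i* y)%C) * u ^+ 2.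
    by rewrite expr2 !mulrA.
  rewrite exprMn; congr (_ * _); rewrite expr2; simpc; congr (_ +i* _).
    have -> : (r + x) * (r + x) - y * y = r ^+ 2 + 2 * r * x + x ^+ 2 - y ^+ 2 by ring.
    by rewrite rr; ring.
  by ring.
have h2 : 0 < (2 * (r + x)) +i* 0 :> R[i] by rewrite ltcE /= eqxx /=; lra.
by rewrite (pmulr_rgt0 _ h2).
Qed.

Lemma angle_ex w : w != 0 -> exists t, 0 < w * uexp (- t).
Proof.
move=> w0; case: (pselect (w <= 0)) => [wle|]; last by move=> /pargP; exists (parg w).
exists pi; rewrite /uexp cosN sinN cospi sinpi oppr0.
have -> : (-1) +i* 0 = -1 :> R[i] by rewrite -[RHS]/(-1 +i* -0) oppr0.
by rewrite mulrN1 oppr_gt0 lt_neqAle w0.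
Qed.

Lemma con_parg T (A : set T) f : ccon A f -> (forall z, A z -> ~ (f z <= 0)) ->
  con A (fun z => parg (f z)).
Proof.
move=> [cx cy] H; rewrite /parg; apply: conM; first exact: con_cst.
apply: con_atan; apply: conM => //; apply: conV.
  apply: conD => //; apply: con_sqrt; apply: conD.
    by apply: con_eq (conM cx cx) => x _; rewrite expr2.
  by apply: con_eq (conM cy cy) => x _; rewrite expr2.
by move=> z /H; case: (f z) => x y /parg_den h; rewrite gt_eqF.
Qed.

Lemma haslog_slit T (A : set T) f : ccon A f -> (forall z, A z -> ~ (f z <= 0)) ->
  haslog A f.
Proof.
by move=> cf H; exists (fun z => parg (f z)); [exact: con_parg|move=> z /H/pargP].
Qed.

Lemma haslog_cst T (A : set T) w : w != 0 -> haslog A (fun=> w).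
Proof. by move=> /angle_ex[t Ht]; exists (fun=> t) => //; exact: con_cst. Qed.

Lemma haslog_rot T (A : set T) f w : w != 0 -> ccon A f ->
  (forall z, A z -> ~ (w * f z <= 0)) -> haslog A f.
Proof.
move=> w0 cf H.
have H1 : haslog A (fun z => w * f z).
  by apply: haslog_slit H; apply: cconM => //; exact: ccon_cst.
apply: haslog_eq (haslogM (haslog_cst A (invr_neq0 w0)) H1) => z _.
by rewrite mulrA mulVf // mul1r.
Qed.

(* For functions that need not be continuous: only an argument of [f] is required
   to be continuous near each point of [A]. *)
Definition lhl (T : pseudoMetricType R) (A : set T) (f : T -> R[i]) :=
  forall z, A z -> exists2 r, 0 < r & haslog (A `&` ball z r) f.

Lemma lhlM (T : pseudoMetricType R) (A : set T) f g : lhl A f -> lhl A g ->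
  lhl A (fun z => f z * g z).
Proof.
move=> Hf Hg z Az; have [r r0 Hr] := Hf z Az; have [s s0 Hs] := Hg z Az.
exists (Num.min r s); first by rewrite lt_min r0.
by apply: haslogM; [apply: haslog_sub Hr|apply: haslog_sub Hs] => y [Ay yb];
  split => //; apply: le_ball yb; rewrite ge_min lexx ?orbT.
Qed.

Lemma haslog_lhl (T : pseudoMetricType R) (A : set T) f : haslog A f -> lhl A f.
Proof. by move=> H z Az; exists 1 => //; apply: haslog_sub H => y []. Qed.

Lemma lhlX (T : pseudoMetricType R) (A : set T) f (k : int) : lhl A f -> lhl A (fun z => f z ^ k).
Proof. by move=> H z /H[r r0 Hr]; exists r => //; exact: haslogX. Qed.

Lemma lhl_eq (T : pseudoMetricType R) (A : set T) f g : (forall z, A z -> f z = g z) ->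
  lhl A f -> lhl A g.
Proof.
move=> fg H z /H[r r0 Hr]; exists r => //; apply: haslog_eq Hr => y [Ay _]; exact: fg.
Qed.

Lemma lhl_prod (T : pseudoMetricType R) (A : set T) (I : eqType) (r : seq I) (f : I -> T -> R[i]) :
  (forall i, i \in r -> lhl A (f i)) -> lhl A (fun z => \prod_(i <- r) f i z).
Proof.
elim: r => [|i r IH] H.
  by apply: lhl_eq (haslog_lhl (haslog1 A)) => z _; rewrite big_nil.
apply: lhl_eq (lhlM (H i (mem_head _ _)) (IH _)) => [z _|j jr].
  by rewrite big_cons.
by apply: H; rewrite in_cons jr orbT.
Qed.

(** Division by [f z] brings the values near [z] into the right half-plane, away from the slit of
    [parg]. *)
Lemma ccon_lhl (T : pseudoMetricType R) (A : set T) f : ccon A f ->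
  (forall z, A z -> f z != 0) -> lhl A f.
Proof.
move=> [cx cy] f0 z Az.
have cg : ccon A (fun y => (f z)^-1 * f y) by apply: cconM => //; exact: ccon_cst.
have [d d0 Hd] := con_ball cg.1 Az (ltr01 : 0 < (1 : R)).
exists d => //; apply: (@haslog_rot _ _ _ (f z)^-1); first by rewrite invr_neq0 // f0.
  by apply: ccon_sub (conj cx cy) => y [].
move=> y [Ay zy]; have := Hd y Ay zy.
rewrite mulVf ?f0 //= lecE /=.
rewrite /ball /= => h /andP[_ h']; move: h; rewrite ltr_norml; lra.
Qed.

Lemma int_lt1 (k : int) : `|k%:~R : R| < 1 -> k = 0.
Proof. by rewrite -intr_norm -[1]/(1%:~R) ltr_int; lia. Qed.

(** Two arguments of the same function differ by integer multiples of [2 pi], and a continuous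
    function with such values is locally constant. *)
Lemma log_diff_loc (T : pseudoMetricType R) (A : set T) f (s t : T -> R) z :
  con A s -> con A t -> (forall y, A y -> 0 < f y * uexp (- s y)) ->
  (forall y, A y -> 0 < f y * uexp (- t y)) -> A z ->
  exists2 r, 0 < r & forall y, A y -> ball z r y -> s y - t y = s z - t z.
Proof.
move=> cs ct Hs Ht Az.
have pi0 : (0 : R) < pi *+ 2 by rewrite pmulrn_lgt0 // pi_gt0.
have [r r0 Hr] := con_ball (conB cs ct) Az pi0; exists r => // y Ay zy.
have [k hk] := angle_uniq (Hs y Ay) (Ht y Ay).
have [l hl] := angle_uniq (Hs z Az) (Ht z Az).
have := Hr y Ay zy; rewrite /ball /= hk hl -mulrBl normrM (gtr0_norm pi0).
rewrite gtr_pMl // -intrB => /int_lt1/eqP; rewrite subr_eq0 => /eqP ->.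
by [].
Qed.

Lemma haslogU T (A B : set T) f (s t : T -> R) : closed A -> closed B ->
  con A s -> con B t -> (forall y, A y -> 0 < f y * uexp (- s y)) ->
  (forall y, B y -> 0 < f y * uexp (- t y)) ->
  (forall y, A y -> B y -> s y = t y) -> haslog (A `|` B) f.
Proof.
move=> cA cB cs ct Hs Ht st.
pose u y := if pselect (A y) then s y else t y.
have uA y : A y -> s y = u y by rewrite /u; case: pselect.
have uB y : B y -> t y = u y by rewrite /u; case: pselect => // Ay By; rewrite st.
exists u; first by apply: conU => //; [apply: con_eq cs|apply: con_eq ct].
by move=> y [Ay|By]; [rewrite -uA //; exact: Hs|rewrite -uB //; exact: Ht].
Qed.

End Logarithms.

(** * Existence of logarithms up to rational functions *)
Section Plane.
Variable R : realType.
Notation plane := (R * R)%type.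
Implicit Types (a : plane) (l : seq (plane * int)).

Lemma ball_planeE (z : plane) r (y : plane) :
  ball z r y <-> `|z.1 - y.1| < r /\ `|z.2 - y.2| < r.
Proof. by []. Qed.

Lemma closed_far (T : pseudoMetricType R) (K : set T) (z : T) : closed K -> ~ K z ->
  exists2 r : R, 0 < r & forall y, ball z r y -> ~ K y.
Proof.
move=> cK nK; have /nbhs_ballP[r /= r0 H] : nbhs z (~` K).
  by apply: open_nbhs_nbhs; split => //; exact: closed_openC.
by exists r => // y /H.
Qed.

Lemma far_closed (T : pseudoMetricType R) (K : set T) :
  (forall z, ~ K z -> exists2 r : R, 0 < r & forall y, ball z r y -> ~ K y) -> closed K.
Proof.
move=> H; rewrite -[K]setCK; apply: open_closedC; rewrite openE => z nK.
by have [r r0 Hr] := H z nK; apply/nbhs_ballP; exists r => // y /Hr.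
Qed.

Lemma closed_segment (u v : R) : closed [set x | u <= x <= v].
Proof.
have -> : [set x | u <= x <= v] = `[u, v]%classic.
  by apply/seteqP; split => x /=; rewrite in_itv.
exact: itv_closed.
Qed.

Lemma closed_ge1 (x : R) : closed [set z : plane | x <= z.1].
Proof. by apply: (@preimage_closed _ _ fst [set y | x <= y]); [move=> ? _; exact: cvg_fst|exact: closed_ge]. Qed.

Lemma closed_le1 (x : R) : closed [set z : plane | z.1 <= x].
Proof. by apply: (@preimage_closed _ _ fst [set y | y <= x]); [move=> ? _; exact: cvg_fst|exact: closed_le]. Qed.

Lemma closed_ge2 (x : R) : closed [set z : plane | x <= z.2].
Proof. by apply: (@preimage_closed _ _ snd [set y | x <= y]); [move=> ? _; exact: cvg_snd|exact: closed_ge]. Qed.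

Lemma closed_le2 (x : R) : closed [set z : plane | z.2 <= x].
Proof. by apply: (@preimage_closed _ _ snd [set y | y <= x]); [move=> ? _; exact: cvg_snd|exact: closed_le]. Qed.

Definition box (x y c d : R) : set plane :=
  [set z | [/\ x <= z.1, z.1 <= y, c <= z.2 & z.2 <= d]].

Lemma closed_box x y c d : closed (box x y c d).
Proof.
have -> : box x y c d = [set z | x <= z.1] `&` [set z | z.1 <= y] `&`
    ([set z | c <= z.2] `&` [set z | z.2 <= d]).
  by apply/seteqP; split => z /=; [case|case=> -[? ?] []].
apply: closedI; apply: closedI; [exact: closed_ge1|exact: closed_le1|exact: closed_ge2|exact: closed_le2].
Qed.

Definition phi a (z : plane) : R[i] := (z.1 - a.1) +i* (z.2 - a.2).

Lemma phi_neq0 a z : z <> a -> phi a z != 0.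
Proof.
move=> za; apply/eqP => /eqP; rewrite eq_complex /= !subr_eq0 => /andP[/eqP h1 /eqP h2].
by apply: za; rewrite (surjective_pairing z) (surjective_pairing a) h1 h2.
Qed.

Lemma ccon_phi A a : ccon A (phi a).
Proof.
by split=> /=; apply: conB; try exact: con_cst; [apply: con_fst|apply: con_snd]; exact: con_id.
Qed.

Lemma lhl_phi A a : ~ A a -> lhl A (phi a).
Proof.
move=> nA; apply: ccon_lhl; first exact: ccon_phi.
by move=> z Az; apply: phi_neq0 => za; apply: nA; rewrite -za.
Qed.

Definition ratfun l (z : plane) : R[i] := \prod_(p <- l) phi p.1 z ^ p.2.

Lemma ratfun_cat l1 l2 z : ratfun (l1 ++ l2) z = ratfun l1 z * ratfun l2 z.
Proof. by rewrite /ratfun big_cat. Qed.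

Lemma lhl_ratfun A l : (forall p, p \in l -> ~ A p.1) -> lhl A (ratfun l).
Proof. by move=> H; apply: lhl_prod => p /H nA; apply: lhlX; exact: lhl_phi. Qed.

Lemma ratfun_log A l (th : plane -> plane -> R) :
  (forall p, p \in l -> con A (th p.1) /\
     forall z, A z -> 0 < phi p.1 z * uexp (- th p.1 z)) ->
  con A (fun z => \sum_(p <- l) p.2%:~R * th p.1 z) /\
  forall z, A z -> 0 < ratfun l z * uexp (- \sum_(p <- l) p.2%:~R * th p.1 z).
Proof.
elim: l => [|p l IH] H.
  split.
    apply: (@con_eq _ _ A (fun=> 0 : R)); last exact: con_cst.
    by move=> z _; rewrite big_nil.
  by move=> z _; rewrite /ratfun !big_nil oppr0 uexp0 mulr1 ltr01.
have [] := IH; first by move=> q ql; apply: H; rewrite in_cons ql orbT.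
have [cp Hp] := H p (mem_head _ _).
move=> cl Hl; split.
  have c1 : con A (fun z => p.2%:~R * th p.1 z + \sum_(q <- l) q.2%:~R * th q.1 z).
    by apply: conD => //; apply: conM => //; exact: con_cst.
  apply: con_eq c1 => z _.
  by rewrite big_cons.
move=> z Az; rewrite /ratfun !big_cons opprD uexpD mulrACA mulr_gt0 //; last exact: Hl.
have := Hp z Az; move=> /(exprz_gt0 p.2).
by rewrite exprzMl ?unitfE ?uexp_neq0 ?(haslog_neq0 (ex_intro2 _ _ _ cp Hp)) // -uexpMz mulrN.
Qed.

Lemma lhl_all (K : set plane) f z : closed K -> lhl K f ->
  exists2 r, 0 < r & haslog (K `&` ball z r) f.
Proof.
move=> cK H; case: (pselect (K z)) => [/H//|nK].
have [r r0 Hr] := closed_far cK nK; exists r => //.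
by exists (fun=> 0) => [y [Ky /Hr]|y [Ky /Hr]].
Qed.

(** The segment of height [c] to [d] above [x] is swept upwards: where two boxes meet, the upper
    argument is shifted by a multiple of [2 pi], and the strip is narrowed until the two arguments
    agree on the whole overlap. *)
Lemma strip_log (K : set plane) f x c d : c <= d -> closed K -> lhl K f ->
  exists2 e, 0 < e & haslog (K `&` box (x - e) (x + e) c d) f.
Proof.
move=> cd cK lK.
apply: (@cousin _ (fun u v => exists2 e, 0 < e &
  haslog (K `&` box (x - e) (x + e) u v) f)) cd _ _.
- move=> u y v _ uy yv _ [e1 e10 [s cs Hs]] [e2 e20 [t ct Ht]].
  (* Agreement near [(x, y)] is enough: in a narrow strip the two boxes meet only in a short segment
     around this point. *)
  suff [r [t' [r0 ct' Ht' st']]] : exists r t', [/\ 0 < r,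
      con (K `&` box (x - e2) (x + e2) y v) t',
      forall z, (K `&` box (x - e2) (x + e2) y v) z -> 0 < f z * uexp (- t' z) &
      forall z, (K `&` box (x - e1) (x + e1) u y) z ->
        (K `&` box (x - e2) (x + e2) y v) z -> ball (x, y) r z -> s z = t' z].
    pose e := Num.min (Num.min e1 e2) (r / 2).
    have [e_1 e_2 e_r] : [/\ e <= e1, e <= e2 & e <= r / 2].
      by rewrite /e !ge_min !lexx !orbT.
    have e0 : 0 < e by rewrite /e !lt_min e10 e20 divr_gt0.
    exists e => //.
    have sub1 : K `&` box (x - e) (x + e) u y `<=` K `&` box (x - e1) (x + e1) u y.
      by move=> z [Kz [? ? ? ?]]; split => //; split => //; lra.
    have sub2 : K `&` box (x - e) (x + e) y v `<=` K `&` box (x - e2) (x + e2) y v.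
      by move=> z [Kz [? ? ? ?]]; split => //; split => //; lra.
    apply: (@haslog_sub _ _ _ (K `&` box (x - e) (x + e) u y `|` K `&` box (x - e) (x + e) y v)).
      move=> z [Kz [h1 h2 h3 h4]]; case: (leP z.2 y) => h.
        by left; split => //; split.
      by right; split => //; split => //; exact: ltW.
    apply: (haslogU (s := s) (t := t')).
    + by apply: closedI => //; exact: closed_box.
    + by apply: closedI => //; exact: closed_box.
    + exact: con_sub cs.
    + exact: con_sub ct'.
    + by move=> z /sub1; exact: Hs.
    + by move=> z /sub2; exact: Ht'.
    + move=> z z1 z2; apply: st'; [exact: sub1|exact: sub2|].
      apply/ball_planeE => /=; move: z1 z2 => [_ [? ? ? ?]] [_ [? ? ? ?]].
      by rewrite !ltr_norml; split; apply/andP; split; lra.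
  case: (pselect (K (x, y))) => [Kxy|nK].
    have in1 : (K `&` box (x - e1) (x + e1) u y) (x, y) by split => //; split => //=; lra.
    have in2 : (K `&` box (x - e2) (x + e2) y v) (x, y) by split => //; split => //=; lra.
    have [k hk] := angle_uniq (Hs _ in1) (Ht _ in2).
    pose t' z := t z + k%:~R * (pi *+ 2).
    have ct' : con (K `&` box (x - e2) (x + e2) y v) t' by apply: conD => //; exact: con_cst.
    have Ht' z : (K `&` box (x - e2) (x + e2) y v) z -> 0 < f z * uexp (- t' z).
      by move=> /Ht; exact: angle_shift.
    pose I := (K `&` box (x - e1) (x + e1) u y) `&` (K `&` box (x - e2) (x + e2) y v).
    have [r r0 Hr] := @log_diff_loc _ _ I f s t' (x, y)
      (con_sub (@subIsetl _ _ _) cs) (con_sub (@subIsetr _ _ _) ct')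
      (fun y h => Hs y h.1) (fun y h => Ht' y h.2) (conj in1 in2).
    exists r, t'; split => // z z1 z2 zb.
    have := Hr z (conj z1 z2) zb; rewrite /t' -hk; lra.
  have [r r0 Hr] := closed_far cK nK.
  by exists r, t; split => // z [Kz _] _ /Hr.
- move=> y _; have [r r0 Hr] := @lhl_all K f (x, y) cK lK.
  exists r => // u v yu uv vy _ _; exists (r / 2); first by rewrite divr_gt0.
  apply: haslog_sub Hr => z [Kz [? ? ? ?]]; split => //; apply/ball_planeE => /=.
  by rewrite !ltr_norml; split; apply/andP; split; lra.
Qed.

End Plane.

(** * Gluing logarithms across vertical lines *)

Section Rational.
Variable R : realType.
Notation plane := (R * R)%type.
Implicit Types (a : plane) (l : seq (plane * int)).

(* Arguments of [phi a] cut along the left and along the right horizontal ray. *)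
Definition argR a (z : plane) : R := parg (phi a z).
Definition argL a (z : plane) : R := pi + parg (- phi a z).

Lemma phi_le0 a z : z <> a -> a.1 <= z.1 -> ~ (phi a z <= 0).
Proof.
move=> za h; rewrite lecE /= => /andP[/eqP h2 h3]; apply: za.
rewrite (surjective_pairing z) (surjective_pairing a).
by congr pair; lra.
Qed.

Lemma phi_ge0 a z : z <> a -> z.1 <= a.1 -> ~ (- phi a z <= 0).
Proof.
move=> za h; rewrite oppr_le0 lecE /= => /andP[/eqP h2 h3]; apply: za.
rewrite (surjective_pairing z) (surjective_pairing a).
by congr pair; lra.
Qed.

Lemma argRP (A : set plane) a : ~ A a -> (forall z, A z -> a.1 <= z.1) ->
  con A (argR a) /\ forall z, A z -> 0 < phi a z * uexp (- argR a z).
Proof.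
move=> nA H.
have n z : A z -> ~ (phi a z <= 0).
  by move=> Az; apply: phi_le0; [move=> za; apply: nA; rewrite -za|exact: H].
split; last by move=> z /n/pargP.
by apply: con_parg n; exact: ccon_phi.
Qed.

Lemma argLP (A : set plane) a : ~ A a -> (forall z, A z -> z.1 <= a.1) ->
  con A (argL a) /\ forall z, A z -> 0 < phi a z * uexp (- argL a z).
Proof.
move=> nA H.
have n z : A z -> ~ (- phi a z <= 0).
  by move=> Az; apply: phi_ge0; [move=> za; apply: nA; rewrite -za|exact: H].
split.
  apply: conD; first exact: con_cst.
  apply: con_parg n; have [c1 c2] := ccon_phi A a.
  by split; [apply: con_eq (conN c1)|apply: con_eq (conN c2)] => z _; case: (phi a z).
move=> z /n/pargP; rewrite /argL opprD uexpD {2}/uexp cosN sinN cospi sinpi oppr0.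
have -> : ((-1) +i* 0)%C = -1 :> R[i] by rewrite -[RHS]/((-1) +i* -0)%C oppr0.
by rewrite mulN1r mulrN mulNr.
Qed.

(** Straight above [a] both arguments are [pi / 2]; straight below, [argL] is [3 pi / 2] and [argR]
    is [- pi / 2]. *)
Lemma arg_jump a t : a.2 <> t ->
  argL a (a.1, t) - argR a (a.1, t) = (t < a.2)%R%:R * (pi *+ 2).
Proof.
case: a => s y /= yt; rewrite /argL /argR /phi /= /parg /= subrr oppr0 !expr0n /= !add0r !addr0.
rewrite sqrrN sqrtr_sqr mulNr atanN.
case: (ltgtP t y) yt => [h _|h _|->//].
  have -> : (t - y) / `|t - y| = -1.
    by rewrite ltr0_norm ?subr_lt0 // invrN mulrN divff // subr_eq0 lt_eqF.
  by rewrite atanN atan1 mulr1n mul1r mulr2n; lra.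
by rewrite gtr0_norm ?subr_gt0 // divff ?subr_eq0 ?gt_eqF // atan1 mulr0n mul0r; lra.
Qed.

(** In units of [2 pi] the difference of the two arguments is a locally constant integer on the part
    of [K] on the line, so it changes only across gaps of [K]. The list records a height in each gap
    used, with the amount by which the value below exceeds the value above. *)
Lemma jumps (K : set plane) f x c d (s t : plane -> R) : c <= d -> closed K ->
  let A := K `&` box x x c d in
  con A s -> con A t -> (forall y, A y -> 0 < f y * uexp (- s y)) ->
  (forall y, A y -> 0 < f y * uexp (- t y)) ->
  exists (l : seq (R * int)) (n : int),
    (forall p, p \in l -> c <= p.1 <= d /\ ~ K (x, p.1)) /\
    forall y, c <= y <= d -> K (x, y) ->
      s (x, y) - t (x, y) = (n + \sum_(p <- l | y < p.1) p.2)%:~R * (pi *+ 2).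
Proof.
move=> cd cK A cs ct Hs Ht.
apply: (@cousin _ (fun u v => exists (l : seq (R * int)) (n : int),
    (forall p, p \in l -> u <= p.1 <= v /\ ~ K (x, p.1)) /\
    forall y, u <= y <= v -> K (x, y) ->
      s (x, y) - t (x, y) = (n + \sum_(p <- l | y < p.1) p.2)%:~R * (pi *+ 2))) cd _ _.
- move=> u m v cu um mv vd [l1 [n1 [H1 E1]]] [l2 [n2 [H2 E2]]].
  pose k := \sum_(p <- l2) p.2; pose j := n1 - n2 - k.
  (* If [(x, m)] is in [K], the formulas for the two halves agree there and [j] is 0; if not, [m]
     lies in a gap and may carry the step. *)
  pose l3 := if pselect (K (x, m)) then [::] else [:: (m, j)].
  have sum2 y : y <= m -> K (x, y) -> \sum_(p <- l2 | y < p.1) p.2 = k.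
    move=> ym Kxy; rewrite big_seq_cond /k [RHS]big_seq; apply: eq_bigl => p.
    case pl: (p \in l2) => //=; have [/andP[h1 h2] nK] := H2 _ pl.
    rewrite lt_neqAle (le_trans ym h1) andbT; apply/eqP => yp.
    by apply: nK; rewrite -yp.
  have sum1 y : m <= y -> \sum_(p <- l1 | y < p.1) p.2 = 0.
    move=> my; rewrite big_seq_cond big1 // => p /andP[pl].
    have [/andP[h1 h2] nK] := H1 _ pl; move=> h; exfalso; move: h; rewrite ltNge => /negP; apply; lra.
  have pi0 : (pi *+ 2 : R) != 0 by rewrite gt_eqF // pmulrn_lgt0 // pi_gt0.
  exists (l1 ++ l2 ++ l3), n2; split.
    move=> p; rewrite !mem_cat => /or3P[/H1[]|/H2[]|].
    + by move=> ? ?; split => //; lra.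
    + by move=> ? ?; split => //; lra.
    + by rewrite /l3; case: pselect => // nK; rewrite inE => /eqP -> /=; split => //; lra.
  move=> y /andP[uy yv] Kxy; rewrite !big_cat /=.
  case: (leP y m) => ym.
    rewrite (sum2 y ym Kxy) E1 ?uy ?ym //; congr (_%:~R * _).
    rewrite /l3; case: pselect => [Kxm|nK].
      rewrite big_nil.
      have e1 : s (x, m) - t (x, m) = n1%:~R * (pi *+ 2).
        by rewrite E1 ?um ?lexx // sum1 // addr0.
      have e2 : s (x, m) - t (x, m) = (n2 + k)%:~R * (pi *+ 2).
        by rewrite E2 ?mv ?lexx // sum2.
      have : (n1%:~R : R) = (n2 + k)%:~R by apply: (mulIf pi0); rewrite -e1 e2.
      move/eqP; rewrite eqr_int => /eqP ->; rewrite addr0.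
      by rewrite addrA addrAC.
    have ym' : y < m.
      by rewrite lt_neqAle ym andbT; apply/eqP => e; apply: nK; rewrite -e.
    by rewrite big_cons big_nil /= ym' addr0 /j; ring.
  rewrite (sum1 y (ltW ym)) add0r E2 ?yv ?(ltW ym) //; congr (_%:~R * _).
  rewrite /l3; case: pselect => ?; rewrite ?big_nil ?big_cons ?addr0 //=.
  by rewrite (ltNge y m) (ltW ym) /= big_nil addr0.
- move=> m /andP[cm md]; case: (pselect (K (x, m))) => [Kxm|nK]; last first.
    have [r r0 Hr] := closed_far cK nK; exists r => // u v um uv vm _ _.
    exists [::], 0; split => // y /andP[uy yv] Kxy; exfalso; apply: Hr Kxy.
    apply/ball_planeE => /=; rewrite subrr normr0 ltr_norml; split => //.
    by apply/andP; split; lra.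
  have Am : A (x, m) by split => //; split => /=.
  have [r r0 Hr] := log_diff_loc cs ct Hs Ht Am.
  have [k hk] := angle_uniq (Hs _ Am) (Ht _ Am).
  exists r => // u v um uv vm cu vd; exists [::], k; split => // y /andP[uy yv] Kxy.
  rewrite big_nil addr0 -hk; apply: Hr.
    by split => //; split => //=; lra.
  apply/ball_planeE => /=; rewrite subrr normr0 ltr_norml; split => //.
  by apply/andP; split; lra.
Qed.

(** The zeros and poles are required to lie in the box itself. Seen from an adjoining box they are
    then all on one side, so [argL] or [argR] gives their arguments; and if [K] fills the box there
    can be none. *)
Definition good (K : set plane) f c d (u v : R) := exists2 l,
  (forall p, p \in l -> box u v c d p.1 /\ ~ K p.1) &
  haslog (K `&` box u v c d) (fun z => f z * ratfun l z).

(* Logarithms to the left and to the right of the line [z.1 = x] differ on it by a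
   step function; zeros and poles placed at the steps, off [K], absorb the jumps. *)
Lemma good_glue (K : set plane) f c d u x v : c <= d -> closed K -> u <= x -> x <= v ->
  good K f c d u x -> good K f c d x v -> good K f c d u v.
Proof.
move=> cd cK ux xv [l1 H1 L1] [l2 H2 L2].
pose A := K `&` box u x c d; pose B := K `&` box x v c d.
pose g z := f z * ratfun l1 z * ratfun l2 z.
have [s cs Hs] : haslog A g.
  apply: haslogM => //; have [|c2 h2] := @ratfun_log _ A l2 argL.
    move=> p /H2 [[? ? ? ?] nK]; apply: argLP; first by case.
    by move=> z [_ [? ? _ _]]; lra.
  by eexists; [exact: c2|exact: h2].
have [t ct Ht] : haslog B g.
  apply: (@haslog_eq _ _ _ (fun z => f z * ratfun l2 z * ratfun l1 z)); first by move=> z _; rewrite mulrAC.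
  apply: haslogM => //; have [|c2 h2] := @ratfun_log _ B l1 argR.
    move=> p /H1 [[? ? ? ?] nK]; apply: argRP; first by case.
    by move=> z [_ [? ? _ _]]; lra.
  by eexists; [exact: c2|exact: h2].
have subA : K `&` box x x c d `<=` A by move=> z [Kz [? ? ? ?]]; split => //; split => //; lra.
have subB : K `&` box x x c d `<=` B by move=> z [Kz [? ? ? ?]]; split => //; split => //; lra.
have [l [n [Hl El]]] := jumps cd cK (con_sub subA cs) (con_sub subB ct)
  (fun y h => Hs y (subA y h)) (fun y h => Ht y (subB y h)).
(* Below such a point [argL] exceeds [argR] by [2 pi], hence the opposite sign: the steps of [s - t]
   are cancelled. *)
pose l3 : seq (plane * int) := [seq ((x, p.1), - p.2) | p <- l].
have H3 p : p \in l3 -> [/\ p.1.1 = x, c <= p.1.2 <= d & ~ K p.1].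
  by move=> /mapP[q /Hl [? ?] ->]; split.
have [cA hA] : con A (fun z => \sum_(p <- l3) p.2%:~R * argL p.1 z) /\
    forall z, A z -> 0 < ratfun l3 z * uexp (- \sum_(p <- l3) p.2%:~R * argL p.1 z).
  apply: ratfun_log => p /H3[px _ nK]; apply: argLP; first by case.
  by move=> z [_ [? ? _ _]]; rewrite px.
have [cB hB] : con B (fun z => \sum_(p <- l3) p.2%:~R * argR p.1 z) /\
    forall z, B z -> 0 < ratfun l3 z * uexp (- \sum_(p <- l3) p.2%:~R * argR p.1 z).
  apply: ratfun_log => p /H3[px _ nK]; apply: argRP; first by case.
  by move=> z [_ [? ? _ _]]; rewrite px.
exists (l1 ++ l2 ++ l3).
  move=> p; rewrite !mem_cat => /or3P[/H1[[? ? ? ?] ?]|/H2[[? ? ? ?] ?]|/H3[px /andP[? ?] ?]].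
  - by split => //; split => //; lra.
  - by split => //; split => //; lra.
  - by split => //; split; rewrite ?px.
apply: (@haslog_eq _ _ _ (fun z => g z * ratfun l3 z)).
  by move=> z _; rewrite !ratfun_cat /g !mulrA.
apply: (@haslog_sub _ _ _ (A `|` B)).
  move=> z [Kz [? ? ? ?]]; case: (leP z.1 x) => h.
    by left; split => //; split.
  by right; split => //; split => //; exact: ltW.
apply: (haslogU (s := fun z => s z + \sum_(p <- l3) p.2%:~R * argL p.1 z)
  (t := fun z => t z + \sum_(p <- l3) p.2%:~R * argR p.1 z + n%:~R * (pi *+ 2))).
- by apply: closedI => //; exact: closed_box.
- by apply: closedI => //; exact: closed_box.
- exact: conD.
- by apply: conD; [exact: conD|exact: con_cst].
- by move=> z Az; rewrite opprD uexpD mulrACA mulr_gt0 ?Hs ?hA.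
- by move=> z Az; apply: angle_shift; rewrite opprD uexpD mulrACA mulr_gt0 ?Ht ?hB.
move=> [z1 y] [Kz [/= ? ? ? ?]] [_ [/= ? _ _ _]].
have zx : z1 = x by lra.
rewrite zx in Kz *; have yd : c <= y <= d by apply/andP.
have := El y yd Kz => E.
suff : \sum_(p <- l3) p.2%:~R * argL p.1 (x, y) - \sum_(p <- l3) p.2%:~R * argR p.1 (x, y)
   = - (\sum_(p <- l | y < p.1) p.2)%:~R * (pi *+ 2).
  by move: E; rewrite intrD mulrDl; lra.
rewrite -sumrB /l3 big_map /= rmorph_sum /= -sumrN mulr_suml [RHS]big_mkcond /=.
rewrite [LHS]big_seq [RHS]big_seq; apply: eq_bigr => p pl.
have [_ nK] := Hl _ pl.
rewrite -mulrBr (@arg_jump (x, p.1) y) /=; last by move=> e; apply: nK; rewrite e.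
by case: (y < p.1); rewrite ?mul1r ?mul0r ?mulr0 // mulrNz.
Qed.

(** By [strip_log] a thin strip around each vertical line needs no zeros or poles at all; they enter
    only when strips are glued from left to right. *)
Theorem rational_log (K : set plane) f c d u v : c <= d -> u <= v -> closed K -> lhl K f ->
  good K f c d u v.
Proof.
move=> cd uv cK lK; apply: (@cousin _ (good K f c d)) uv _ _.
- by move=> x y z _ xy yz _; exact: good_glue.
- move=> x _; have [e e0 He] := strip_log x cd cK lK.
  exists e => // y z xy yz zx _ _; exists [::] => //.
  apply: (@haslog_eq _ _ _ f); first by move=> w _; rewrite /ratfun big_nil mulr1.
  by apply: haslog_sub He => w [Kw [? ? ? ?]]; split => //; split => //; lra.
Qed.

End Rational.

(** * The index of a point *)
Section Index.
Variable R : realType.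
Notation plane := (R * R)%type.
Implicit Types (a : plane) (l : seq (plane * int)).

Definition within_box (M : R) : set plane := box (- M) M (- M) M.

Lemma compact_box M : compact (within_box M).
Proof.
have -> : within_box M = `[- M, M]%classic `*` `[- M, M]%classic.
  apply/seteqP; split => z /=; rewrite /within_box /box /= !in_itv /=.
    by case=> h1 h2 h3 h4; split; apply/andP.
  by case=> /andP[h1 h2] /andP[h3 h4].
by apply: compact_setX; exact: segment_compact.
Qed.

Lemma compact_plane (K : set plane) M : closed K -> K `<=` within_box M -> compact K.
Proof. by move=> cK KM; apply: subclosed_compact KM => //; exact: compact_box. Qed.

Lemma extension (K : set plane) M (th : plane -> R) : closed K -> K `<=` within_box M ->
  con K th -> exists2 g : plane -> R, con setT g & forall z, K z -> th z = g z.
Proof.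
move=> cK KM cth.
have /conP wth := cth.
have := continuous_compact wth (compact_plane cK KM) => /compact_bounded[B [_ HB]].
pose b := `|B| + 1.
have b0 : 0 < b by rewrite /b ltr_wpDl.
have hb z : K z -> `|th z| <= b.
  move=> Kz; apply: (HB b); last by exists z.
  by rewrite /b (le_lt_trans (ler_norm B)) // ltrDl.
have [g [g1 g2 _]] := continuous_bounded_extension pseudometric_normal cK b0 wth hb.
exists g; first exact: con_continuous.
by move=> z Kz; rewrite g1 // inE.
Qed.

Lemma log_circle_constant (D : R -> R) : (forall t, exists2 r, 0 < r &
  forall y, ball t r y -> D y = D t) -> forall u v, u <= v -> D u = D v.
Proof.
move=> H u v uv; apply: (@cousin _ (fun u v => D u = D v)) uv _ _.
- by move=> x y z _ _ _ _ -> ->.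
- move=> x _; have [r r0 Hr] := H x; exists r => // y z xy yz zx _ _.
  by rewrite !Hr // /ball /= ltr_norml; apply/andP; split; lra.
Qed.

Section Main.
Variables (K V : set plane) (a : plane) (k : int) (l : seq (plane * int)) (M : R).
Hypotheses (oV : open V) (cVK : closed (V `|` K)).
Hypotheses (VK : forall z, V z -> ~ K z) (VKM : V `|` K `<=` within_box M).
Hypotheses (Va : V a) (Hl : forall p, p \in l -> ~ (V `|` K) p.1).
Variable g : plane -> R.
Hypothesis cg : con setT g.
Hypothesis Hg : forall z, K z -> 0 < phi a z ^ k * ratfun l z * uexp (- g z).

(** By [Hg] the two formulas have the same argument on [K] but not the same modulus, so [h] may be
    discontinuous there. This is why only arguments, and not functions, are asked to be
    continuous. *)
Let h z := if pselect (V z) then uexp (g z) * (ratfun l z)^-1 else phi a z ^ k.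

Let hV z : V z -> h z = uexp (g z) * (ratfun l z)^-1.
Proof. by rewrite /h; case: pselect. Qed.

Let hnV z : ~ V z -> h z = phi a z ^ k.
Proof. by rewrite /h; case: pselect. Qed.

Let lhl_l : lhl (V `|` K) (ratfun l). Proof. exact: lhl_ratfun. Qed.

Let haslog_uexp (A : set plane) : haslog A (fun z => uexp (g z)).
Proof.
exists g; first exact: con_sub cg.
by move=> z _; rewrite -uexpD subrr uexp0 ltr01.
Qed.

(** Close to [z] the closed sets [V] with [K] and the complement of [V] overlap only in [K]. There
    the arguments [g - chi] and [psi] differ by a constant multiple of [2 pi], so one shift lets
    them be pasted. *)
Let lhl_h_boundary z : K z -> exists2 r, 0 < r & haslog (ball z r) h.
Proof.
move=> Kz.
have nVz : ~ V z by move=> /VK.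
have za : z <> a by move=> e; apply: nVz; rewrite e.
have [r1 r10 [psi cpsi Hpsi]] := lhlX k (@lhl_phi R (~` [set a]) a (fun h => h erefl)) za.
have [r2 r20 [chi cchi Hchi]] := lhl_l (or_intror Kz).
pose A := K `&` ball z r1 `&` ball z r2.
have Az : A z by split; [split=> //|]; exact: ballxx.
have A1 : A `<=` ~` [set a] `&` ball z r1.
  by move=> y [[Ky yb] _]; split => // ya; apply: VK Ky; rewrite ya.
have A2 : A `<=` (V `|` K) `&` ball z r2 by move=> y [[Ky _] yb]; split => //; right.
have gA y : A y -> 0 < (phi a y ^ k * ratfun l y) * uexp (- g y) by move=> [[Ky _] _]; exact: Hg.
have pA y : A y -> 0 < (phi a y ^ k * ratfun l y) * uexp (- (psi y + chi y)).
  move=> Ay; rewrite opprD uexpD mulrACA mulr_gt0 //.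
    by apply: Hpsi; exact: A1.
  by apply: Hchi; exact: A2.
have [r3 r30 Hr3] := log_diff_loc (con_sub (@subsetT _ _) cg)
  (conD (con_sub A1 cpsi) (con_sub A2 cchi)) gA pA Az.
have [j hj] := angle_uniq (gA _ Az) (pA _ Az).
pose r := Num.min (Num.min r1 r2) r3 / 2.
have m0 : 0 < Num.min (Num.min r1 r2) r3 by rewrite !lt_min r10 r20 r30.
have r0 : 0 < r by rewrite divr_gt0.
pose Q := box (z.1 - r) (z.1 + r) (z.2 - r) (z.2 + r).
have Qb y : Q y -> [/\ ball z r1 y, ball z r2 y & ball z r3 y].
  have [h1 h2 h3] : [/\ r < r1, r < r2 & r < r3].
    have : r < Num.min (Num.min r1 r2) r3 by rewrite /r; lra.
    by rewrite !lt_min => /andP[/andP[]].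
  move=> [? ? ? ?]; split; apply/ball_planeE; rewrite !ltr_norml; split; apply/andP; split; lra.
exists r => //.
apply: (@haslog_sub _ _ _ (((V `|` K) `&` Q) `|` (~` V `&` Q))).
  move=> y /ball_planeE; rewrite !ltr_norml => -[/andP[h1 h2] /andP[h3 h4]].
  have Qy : Q y by split; lra.
  by case: (pselect (V y)) => Vy; [left; split => //; left|right].
apply: (haslogU (s := fun y => g y - chi y) (t := fun y => psi y + j%:~R * (pi *+ 2))).
- by apply: closedI => //; exact: closed_box.
- by apply: closedI; [exact: open_closedC|exact: closed_box].
- apply: conB; first exact: con_sub cg.
  by apply: con_sub cchi => y [VKy /Qb[]].
- apply: conD; last exact: con_cst.
  by apply: con_sub cpsi => y [nVy /Qb[]]; split => // ya; apply: nVy; rewrite ya.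
- move=> y [VKy Qy]; have [b1 b2 b3] := Qb _ Qy.
  have hc := Hchi y (conj VKy b2).
  rewrite opprB uexpD; case: (VKy) => [Vy|Ky].
    rewrite hV // mulrC -mulrA [X in _ * X]mulrA.
    have -> : uexp (- g y) * uexp (g y) = 1 by rewrite -uexpD addNr uexp0.
    rewrite mul1r -(invrK (uexp (chi y))) -uexpN -invfM invr_gt0 mulrC //.
  have Ay : A y by [].
  rewrite hnV; last by move=> /VK.
  have := gA y Ay => H.
  have -> : phi a y ^ k * (uexp (chi y) * uexp (- g y)) =
      (phi a y ^ k * ratfun l y * uexp (- g y)) * (ratfun l y * uexp (- chi y))^-1.
    rewrite invfM -uexpN opprK; field.
    by apply: contraTneq hc => ->; rewrite mul0r ltxx.
  by rewrite mulr_gt0 // invr_gt0.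
- move=> y [nVy Qy]; have [b1 _ _] := Qb _ Qy.
  rewrite hnV //; apply: angle_shift; apply: Hpsi; split => // ya.
  by apply: nVy; rewrite ya.
- move=> y [VKy Qy] [nVy _]; case: VKy => // Ky; have [b1 b2 b3] := Qb _ Qy.
  have := Hr3 y (conj (conj Ky b1) b2) b3; rewrite hj; lra.
Qed.

Let lhl_h (A : set plane) : lhl A h.
Proof.
suff H z : exists2 r, 0 < r & haslog (ball z r) h.
  by move=> z _; have [r r0 Hr] := H z; exists r => //; apply: haslog_sub Hr => y [].
case: (pselect (K z)) => [/lhl_h_boundary//|nK].
case: (pselect (V z)) => [Vz|nV].
  have [r r0 Hr] := closed_far (open_closedC oV) (fun h => h Vz).
  have [s s0 Hs] := lhl_l (or_introl Vz).
  exists (Num.min r s); first by rewrite lt_min r0.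
  have sub : ball z (Num.min r s) `<=` V.
    move=> y yb; apply: contrapT; apply: Hr; apply: le_ball yb.
    by rewrite ge_min lexx.
  apply: (@haslog_eq _ _ _ (fun z => uexp (g z) * (ratfun l z)^-1)).
    by move=> y /sub Vy; rewrite hV.
  apply: (haslogM (haslog_uexp _)); apply: haslogV; apply: haslog_sub Hs => y yb.
  by split; [left; exact: sub|apply: le_ball yb; rewrite ge_min lexx orbT].
have [r r0 Hr] := closed_far cVK (fun h : (V `|` K) z => match h with
  or_introl v => nV v | or_intror v => nK v end).
have [s s0 Hs] := lhlX k (@lhl_phi R (~` V) a (fun h => h Va)) nV.
exists (Num.min r s); first by rewrite lt_min r0.
have sub : ball z (Num.min r s) `<=` ~` V.
  move=> y yb Vy; apply: (Hr y); last by left.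
  by apply: le_ball yb; rewrite ge_min lexx.
apply: (@haslog_eq _ _ _ (fun z => phi a z ^ k)).
  by move=> y /sub Vy; rewrite hnV.
apply: haslog_sub Hs => y yb.
by split; [exact: sub|apply: le_ball yb; rewrite ge_min lexx orbT].
Qed.

Lemma index_zero_aux : k = 0.
Proof.
have [Ma1 Ma2 Ma3 Ma4] := VKM (or_introl Va).
have M0 : 0 <= M by lra.
(* The circle of radius [rho] around [a] leaves the box of size [M], which contains [a] and [V], and
   stays inside the box of size [N]. *)
pose rho := 4 * M + 4; pose N := 5 * M + 5.
have [l' Hl' [Th cTh HTh]] : good (within_box N) h (- N) N (- N) N.
  have NN : - N <= N by rewrite /N; lra.
  by apply: (rational_log NN NN); [exact: closed_box|exact: lhl_h].
(* [rational_log] was applied to the full square, where zeros and poles have no place; hence [h]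
   itself has an argument on it. *)
have {Hl'}l'0 : l' = [::].
  by case: l' Hl' {HTh} => // p l' /(_ p (mem_head _ _))[].
pose gam t : plane := (a.1 + rho * cos t, a.2 + rho * sin t).
have cgam : con setT gam.
  apply: con_pair; apply: conD; try exact: con_cst; apply: conM; try exact: con_cst.
    by apply: con_cos; exact: con_id.
  by apply: con_sin; exact: con_id.
have gamN t : within_box N (gam t).
  have /andP[? ?] : -1 <= cos t <= 1 by rewrite cos_geN1 cos_le1.
  have /andP[? ?] : -1 <= sin t <= 1 by rewrite sin_geN1 sin_le1.
  by split; rewrite /= /rho /N; nra.
have gamV t : ~ V (gam t).
  move=> /(or_introl) /VKM [/= h1 h2 h3 h4].
  have := cos2Dsin2 t.
  have : cos t <= 1/2 by rewrite /rho in h2; nra.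
  have : -1/2 <= cos t by rewrite /rho in h1; nra.
  have : sin t <= 1/2 by rewrite /rho in h4; nra.
  have : -1/2 <= sin t by rewrite /rho in h3; nra.
  nra.
have pos1 t : 0 < h (gam t) * uexp (- Th (gam t)).
  have := HTh (gam t) (conj (gamN t) (gamN t)).
  by rewrite l'0 /ratfun big_nil mulr1.
have rho0 : 0 < (rho%:C : R[i]) by rewrite ltcR /rho; lra.
have pos2 t : 0 < h (gam t) * uexp (- (k%:~R * t)).
  rewrite hnV // (_ : phi a (gam t) = rho%:C * uexp t); last first.
    by rewrite /phi /gam /= /uexp; simpc; congr (_ +i* _); ring.
  rewrite exprzMl ?unitfE ?uexp_neq0 ?gt_eqF // -uexpMz -mulrA -uexpD subrr uexp0 mulr1.
  exact: exprz_gt0.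
have cTg : con setT (fun t => Th (gam t)).
  by apply: (con_comp cgam cTh) => t _; split; exact: gamN.
have ck : con setT (fun t : R => k%:~R * t).
  by apply: conM; [exact: con_cst|exact: con_id].
have loc t : exists2 r, 0 < r & forall y, ball t r y ->
    Th (gam y) - k%:~R * y = Th (gam t) - k%:~R * t.
  have [r r0 Hr] := log_diff_loc cTg ck (fun t _ => pos1 t) (fun t _ => pos2 t) (I : setT t).
  by exists r => // y yb; exact: Hr.
have pi0 : (0 : R) <= pi *+ 2 by rewrite mulrn_wge0 // pi_ge0.
have := log_circle_constant loc pi0.
have -> : gam (pi *+ 2) = gam 0.
  by rewrite /gam cos2pi sin2pi cos0 sin0.
rewrite mulr0 => /eqP; rewrite -subr_eq0.
have -> x : x - 0 - (x - k%:~R * (pi *+ 2)) = k%:~R * (pi *+ 2) :> R by ring.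
rewrite mulf_eq0 intr_eq0 => /orP[/eqP//|].
by rewrite mulrn_eq0 /= gt_eqF // pi_gt0.
Qed.

End Main.

(* The index of [a] is recovered from a logarithm on the frontier of [V]:
   gluing it to [phi a ^ k] gives a map of a large square without zeros whose
   winding number along a large circle is [k]. *)
Theorem index_zero (K V : set plane) a (k : int) l M :
  closed K -> open V -> closed (V `|` K) -> (forall z, V z -> ~ K z) ->
  V `|` K `<=` within_box M -> V a -> (forall p, p \in l -> ~ (V `|` K) p.1) ->
  haslog K (fun z => phi a z ^ k * ratfun l z) -> k = 0.
Proof.
move=> cK oV cVK VK VKM Va Hl [th cth Hth].
have KM : K `<=` within_box M by move=> z Kz; apply: VKM; right.
have [g cg Hg] := extension cK KM cth.
refine (index_zero_aux oV cVK VK VKM Va Hl cg _) => z Kz.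
by rewrite -Hg //; exact: Hth.
Qed.

End Index.

(** * Classes of points off a compact set *)
Section Classes.
Variable R : realType.
Notation plane := (R * R)%type.
Implicit Types (a b : plane) (K : set plane).

Definition I01 : set R := [set t | 0 <= t <= 1].

Lemma I01E : I01 = `[0, 1]%classic.
Proof. by apply/seteqP; split => x /=; rewrite in_itv. Qed.

Lemma path_lift (F : R -> R[i]) : lhl I01 F -> haslog I01 F.
Proof.
move=> lF.
apply: (@cousin _ (fun u v => haslog [set x : R | u <= x <= v] F)) ler01 _ _.
- move=> u y v _ uy yv _ [s cs Hs] [t ct Ht].
  have [k hk] : exists k : int, s y - t y = k%:~R * (pi *+ 2).
    by apply: angle_uniq; [apply: Hs|apply: Ht]; rewrite /= lexx ?uy ?yv.
  apply: (@haslog_sub _ _ _ ([set x | u <= x <= y] `|` [set x | y <= x <= v])).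
    by move=> x /= /andP[h1 h2]; case: (leP x y) => h; [left|right]; apply/andP; split => //; exact: ltW.
  apply: (haslogU (s := s) (t := fun z => t z + k%:~R * (pi *+ 2))) => //; try exact: closed_segment.
  + by apply: conD => //; exact: con_cst.
  + by move=> z /Ht; exact: angle_shift.
  + move=> z /= h1 h2; have -> : z = y by lra.
    by rewrite -hk; lra.
- move=> x hx; have [r r0 Hr] := lF x hx; exists r => // u v xu uv vx u0 v1.
  apply: haslog_sub Hr => z /= h; split; first by rewrite /I01 /=; lra.
  by rewrite /ball /= ltr_norml; apply/andP; split; lra.
Qed.

Lemma cconV (T : topologicalType) (A : set T) (f : T -> R[i]) : ccon A f ->
  (forall z, A z -> f z != 0) -> ccon A (fun z => (f z)^-1).
Proof.
move=> [cx cy] f0.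
have cn : con A (fun z => (complex.Re (f z) * complex.Re (f z) + complex.Im (f z) * complex.Im (f z))^-1).
  apply: conV; first by apply: conD; exact: conM.
  move=> z /f0; apply: contra_neq => h; apply/eqP; rewrite eq_complex /=.
  by move/eqP: h; rewrite -!expr2 paddr_eq0 ?sqr_ge0 // !sqrf_eq0.
split.
  by apply: con_eq (conM cx cn) => z _; case: (f z) => x y; rewrite -!expr2.
by apply: con_eq (conN (conM cy cn)) => z _; case: (f z) => x y; rewrite -!expr2 /= ?mulNr.
Qed.

(** For [z] in [K] the vectors from [a] to [z] and from [b] to [z] form an acute angle: some
    coordinate of [z - a] is at least [r], while [b] is within [r / 2] of [a] in both. The quotient
    therefore has positive real part. *)
Lemma haslog_near K a r b : 0 < r -> (forall y, ball a r y -> ~ K y) ->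
  ball a (r / 2) b -> haslog K (fun z => phi a z * (phi b z)^-1).
Proof.
move=> r0 far /ball_planeE[b1 b2].
have nb z : K z -> r <= `|z.1 - a.1| \/ r <= `|z.2 - a.2|.
  move=> Kz; case: (ltP `|z.1 - a.1| r) => h1; last by left.
  case: (ltP `|z.2 - a.2| r) => h2; last by right.
  by exfalso; apply: (far z) => //; apply/ball_planeE; rewrite !(distrC a.1) !(distrC a.2).
have pos z : K z -> 0 < (z.1 - a.1) * (z.1 - b.1) + (z.2 - a.2) * (z.2 - b.2).
  have aux (u1 u2 d1 d2 : R) : `|d1| < r / 2 -> `|d2| < r / 2 -> r <= `|u1| ->
      0 < u1 * (u1 + d1) + u2 * (u2 + d2).
    move=> h1 h2 h3.
    have e1 : r * r / 2 < u1 * (u1 + d1).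
      have n1 : - `|d1| <= d1 by rewrite lerNl -normrN ler_norm.
      have p1 : d1 <= `|d1| by exact: ler_norm.
      case: (ler0P u1) h3 => hu h3; nra.
    have e2 : - (r * r / 4) <= u2 * (u2 + d2).
      have e3 : d2 ^+ 2 <= (r / 2) ^+ 2.
        by rewrite -(real_normK (num_real d2)) lerXn2r ?nnegrE ?normr_ge0 ?divr_ge0 ?ltW.
      nra.
    nra.
  move=> /nb[h|h].
    have := aux _ (z.2 - a.2) _ _ b1 b2 h.
    by rewrite !addrA !subrK.
  have := aux _ (z.1 - a.1) _ _ b2 b1 h.
  by rewrite !addrA !subrK; lra.
have b0 z : K z -> phi b z != 0.
  move=> Kz; apply/eqP => /eqP; rewrite eq_complex /= => /andP[/eqP h1 /eqP h2].
  by have := pos z Kz; rewrite h1 h2 !mulr0 addr0 ltxx.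
apply: haslog_slit.
  by apply: cconM; [exact: ccon_phi|apply: cconV => //; exact: ccon_phi].
move=> z Kz; rewrite lecE => /andP[_]; apply/negP; rewrite -ltNge /=.
have n0 : 0 < (z.1 - b.1) ^+ 2 + (z.2 - b.2) ^+ 2.
  have := b0 z Kz; rewrite eq_complex /= negb_and => /orP[h|h].
    by rewrite ltr_wpDr ?sqr_ge0 // exprn_even_gt0.
  by rewrite ltr_wpDl ?sqr_ge0 // exprn_even_gt0.
have := pos z Kz; set A1 := _ - a.1; set A2 := _ - a.2; set B1 := _ - b.1 in n0 *; set B2 := _ - b.2 in n0 *.
set n := _ + _ in n0 * => pp.
have -> : A1 * (B1 / n) - A2 * - (B2 / n) = (A1 * B1 + A2 * B2) / n by ring.
by rewrite divr_gt0.
Qed.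

Lemma haslog_far K M a : K `<=` within_box M -> ~ within_box M a -> haslog K (phi a).
Proof.
move=> KM nM.
have nK : ~ K a by move=> /KM.
have [h|h] := pselect (a.2 < - M \/ M < a.2).
  apply: haslog_slit; first exact: ccon_phi.
  move=> z /KM[? ? ? ?]; rewrite lecE /= => /andP[/eqP h1 _]; case: h => h; lra.
have [h'|h'] := pselect (M < a.1).
  have [c1 c2] := @argLP R K a nK (fun z Kz => let: And4 _ h _ _ := KM z Kz in le_trans h (ltW h')).
  by exists (argL a).
have h3 : a.1 < - M.
  rewrite ltNge; apply/negP => h3; apply: nM; split => //.
  - by rewrite leNgt; apply/negP.
  - by rewrite leNgt; apply/negP => ?; apply: h; left.
  - by rewrite leNgt; apply/negP => ?; apply: h; right.
have [c1 c2] := @argRP R K a nK (fun z Kz => let: And4 h _ _ _ := KM z Kz in le_trans (ltW h3) h).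
by exists (argR a).
Qed.

(* With [F = (phi b)^-1] this is the class of [b], a union of components of the
   complement of [K]; with [F = 1] it is the class of the unbounded component. *)
Definition cls K (F : plane -> R[i]) : set plane :=
  [set z | ~ K z /\ haslog K (fun y => phi z y * F y)].

Lemma cls_move K F a b : ~ K a -> haslog K (fun z => phi a z * (phi b z)^-1) ->
  haslog K (fun y => phi b y * F y) -> haslog K (fun y => phi a y * F y).
Proof.
move=> nK h1 h2; apply: haslog_eq (haslogM h1 h2) => z Kz.
have := haslog_neq0 h1 Kz; rewrite mulf_eq0 invr_eq0 negb_or => /andP[_ b0].
by field.
Qed.

Lemma haslog_sym K a b : haslog K (fun z => phi a z * (phi b z)^-1) ->
  haslog K (fun z => phi b z * (phi a z)^-1).
Proof. by move=> h; apply: haslog_eq (haslogV h) => z _; rewrite invfM invrK mulrC. Qed.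

Lemma open_cls K F : closed K -> open (cls K F).
Proof.
move=> cK; rewrite openE => z [nK Hz].
have [r r0 Hr] := closed_far cK nK.
apply/nbhs_ballP; exists (r / 2) => /=; first by rewrite divr_gt0.
move=> y zy; have nKy : ~ K y.
  by apply: Hr; apply: le_ball zy; lra.
by split => //; apply: cls_move Hz => //; apply: haslog_sym; exact: haslog_near zy.
Qed.

Lemma closed_cls K F : closed K -> closed (cls K F `|` K).
Proof.
move=> cK; apply: far_closed => z nz.
have nK : ~ K z by move=> h; apply: nz; right.
have [r r0 Hr] := closed_far cK nK.
exists (r / 2) => [|y zy]; first by rewrite divr_gt0.
case=> [[nKy Hy]|]; last by apply: Hr; apply: le_ball zy; lra.
by apply: nz; left; split => //; apply: cls_move Hy => //; exact: haslog_near zy.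
Qed.

Lemma int_dependent (q : nat) (T : finType) (E : {set T}) (w : 'I_q -> T -> int) :
  (#|E| < q)%N -> exists k : 'I_q -> int, (exists j, k j != 0) /\
    forall e, e \in E -> \sum_j k j * w j e = 0.
Proof.
move=> Eq.
pose A : 'M[rat]_(q, #|E|) := \matrix_(j, i) (w j (enum_val i))%:~R.
have : kermx A != 0.
  rewrite kermx_eq0 /row_free neq_ltn (leq_ltn_trans _ Eq) // rank_leq_col //.
move=> /rowV0Pn[v /sub_kermxP vA v0].
(* The rational kernel vector is packed into a polynomial so that [rat_poly_scale] clears all
   denominators at once. *)
pose p := \poly_(i < q) (if insub i is Some j then v 0 j else 0).
have [P [d d0 Pd]] := rat_poly_scale p.
have coefp (j : 'I_q) : p`_j = v 0 j.
  by rewrite coef_poly ltn_ord valK.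
have Pj (j : 'I_q) : (P`_j)%:~R = d%:~R * v 0 j :> rat.
  rewrite -coefp Pd coefZ coef_map /= mulrA divff ?mul1r // intr_eq0 //.
exists (fun j => P`_j); split.
  have [j vj] : exists j, v 0 j != 0.
    apply/existsP; apply: contraNT v0 => /existsPn h; apply/eqP/rowP => j.
    by rewrite mxE; apply/eqP; rewrite -[_ == _]negbK h.
  exists j; apply: contra_neq vj => P0.
  have := Pj j; rewrite P0 => /esym/eqP.
  by rewrite mulf_eq0 intr_eq0 (negPf d0) /= => /eqP.
move=> e eE; apply/eqP; rewrite -(intr_eq0 rat) rmorph_sum /=; apply/eqP.
have := congr1 (fun B : 'rV_ _ => d%:~R * B 0 (enum_rank_in eE e)) vA.
rewrite !mxE mulr0 mulr_sumr => h; rewrite -[RHS]h; apply: eq_bigr => j _.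
by rewrite rmorphM /= Pj !mxE enum_rankK_in // mulrA.
Qed.

End Classes.

(** * Winding along the edges of a plane graph *)
Section Quotient.
Variable R : realType.
Notation plane := (R * R)%type.

Lemma compact_I01 : compact (@I01 R).
Proof. by rewrite I01E; exact: segment_compact. Qed.

Lemma hausdorff_plane : hausdorff_space plane.
Proof. exact: norm_hausdorff. Qed.

Lemma closed_image (C : set R) (g : R -> plane) : closed C -> C `<=` @I01 R ->
  con C g -> closed (g @` C).
Proof.
move=> cC CI cg; apply: compact_closed; first exact: hausdorff_plane.
apply: continuous_compact; first exact/conP.
by apply: subclosed_compact CI => //; exact: compact_I01.
Qed.

(** A continuous map of a compact interval is a quotient map onto its image: the times at which [th]
    is off by at least [e] form a compact set, whose image is closed and misses the given point. *)
Lemma con_image (g : R -> plane) (th : plane -> R) : con (@I01 R) g ->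
  con (@I01 R) (th \o g) -> con (g @` @I01 R) th.
Proof.
move=> cg cth; apply: ball_con => _ e [t0 It0 <-] e0.
pose C := [set t | I01 t /\ e <= `|th (g t0) - th (g t)|].
have cC : closed C.
  apply: far_closed => t nC; case: (pselect (I01 t)) => It; last first.
    have cI : closed (@I01 R) by rewrite I01E; exact: itv_closed.
    have [r r0 Hr] := closed_far cI It.
    by exists r => // y /Hr nI [].
  have lt : `|th (g t0) - th (g t)| < e by rewrite ltNge; apply/negP => h; apply: nC.
  have d0 : 0 < e - `|th (g t0) - th (g t)| by rewrite subr_gt0.
  have [d dd Hd] := con_ball cth It d0; exists d => // y ty [Iy].
  have := Hd y Iy ty; rewrite /ball /=.
  have := ler_distD (th (g t)) (th (g t0)) (th (g y)); lra.
have nz : ~ (g @` C) (g t0).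
  by case=> t [It]; move=> h h2; move: h; rewrite h2 subrr normr0; lra.
have CI : C `<=` @I01 R by move=> t [].
have [r r0 Hr] := closed_far (closed_image cC CI (con_sub CI cg)) nz.
exists r => // _ [t It <-] /Hr h; rewrite /ball /= ltNge; apply/negP => h2.
by apply: h; exists t.
Qed.

End Quotient.

Section Winding.
Variables (R : realType) (G : sgraph) (D : embedding R G).
Notation plane := (R * R)%type.
Variables (src tgt : {set G} -> G) (gam : {set G} -> R -> plane).
Implicit Types (E : {set {set G}}) (w : {set G} -> int).

Definition parametrized (E : {set {set G}}) := forall e, e \in E ->
  [/\ e = [set src e; tgt e]%SET, src e != tgt e, e \in edges G &
   [/\ con (@I01 R) (gam e), forall s t, I01 s -> I01 t -> gam e s = gam e t -> s = t,
     gam e 0 = pos D (src e), gam e 1 = pos D (tgt e) & curve D e = gam e @` @I01 R]].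

(** Only edges are recorded, so isolated vertices are points of the complement and have a class like
    any other point. *)
Definition KE (E : {set {set G}}) : set plane := [set z | exists2 e, e \in E & curve D e z].

(* [w e] counts the turns of [f] along [e] relative to arguments [al] chosen at the
   ends; another choice of [al] changes [w] by a coboundary. *)
Definition winding (E : {set {set G}}) (f : plane -> R[i]) (w : {set G} -> int) :=
  exists (al : G -> R) (lam : {set G} -> R -> R), forall e, e \in E ->
  [/\ con (@I01 R) (lam e), forall t, I01 t -> 0 < f (gam e t) * uexp (- lam e t),
      lam e 0 = al (src e) & lam e 1 = al (tgt e) + (w e)%:~R * (pi *+ 2)].

Let I0 : I01 (0 : R). Proof. by rewrite /I01 /= lexx ler01. Qed.
Let I1 : I01 (1 : R). Proof. by rewrite /I01 /= lexx ler01. Qed.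

Lemma parametrized_sub E E' : E' \subset E -> parametrized E -> parametrized E'.
Proof. by move=> /fintype.subsetP s H e /s; exact: H. Qed.

Lemma KE_sub E E' : E' \subset E -> KE E' `<=` KE E.
Proof. by move=> /fintype.subsetP s z [e /s eE ez]; exists e. Qed.

Lemma gam_in E e t : parametrized E -> e \in E -> I01 t -> KE E (gam e t).
Proof. by move=> P eE It; exists e => //; have [_ _ _ [_ _ _ _ ->]] := P e eE; exists t. Qed.

Lemma closed_KE E : parametrized E -> closed (KE E).
Proof.
move=> P; have -> : KE E = \bigcup_(e in [set` E]) curve D e.
  by apply/seteqP; split => z [e ? ?]; exists e.
apply: closed_bigcup; first exact: finite_finset.
move=> e eE; have [_ _ _ [c _ _ _ ->]] := P e eE.
by apply: closed_image => //; rewrite I01E; exact: itv_closed.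
Qed.

Lemma bounded_finite (T : finType) (P : T -> R -> Prop) :
  (forall x M N, P x M -> M <= N -> P x N) -> (forall x, exists M, P x M) ->
  exists M, forall x, P x M.
Proof.
move=> mono ex; have /choice[f Hf] := ex.
exists (\sum_x `|f x|) => x; apply: mono (Hf x) _.
rewrite (bigD1 x) //= (le_trans (ler_norm _)) // lerDl.
by apply: sumr_ge0.
Qed.

Lemma within_box_mono M N : M <= N -> @within_box R M `<=` within_box N.
Proof. by move=> MN z [? ? ? ?]; split; lra. Qed.

Lemma within_box_ex (z : plane) : exists M, within_box M z.
Proof.
exists (`|z.1| + `|z.2|).
have h1 := ler_norm z.1; have h2 := ler_norm z.2.
have h3 := ler_norm (- z.1); have h4 := ler_norm (- z.2).
rewrite !normrN in h3 h4.
have := normr_ge0 z.1; have := normr_ge0 z.2.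
by split; lra.
Qed.

Lemma bounded_compact (A : set plane) : compact A -> exists M, A `<=` within_box M.
Proof.
move=> /compact_bounded[B [_ HB]]; exists (`|B| + 1) => z Az.
have : `|z| <= `|B| + 1 by apply: HB Az; rewrite (le_lt_trans (ler_norm B)) // ltrDl.
rewrite prod_normE ge_max => /andP[]; rewrite !ler_norml => /andP[? ?] /andP[? ?].
by split.
Qed.

Lemma bounded_KE E : parametrized E -> exists M, KE E `<=` within_box M.
Proof.
move=> P; have [M HM] : exists M, forall e : {set G}, e \in E -> curve D e `<=` within_box M.
  apply: bounded_finite => [e M N h MN eE z ez|e]; first exact: (within_box_mono MN (h eE z ez)).
  case: (boolP (e \in E)) => [eE|_]; last by exists 0.
  have [_ _ _ [c _ _ _ ->]] := P e eE.
  have [M HM] := bounded_compact (continuous_compact ((conP _ _).1 c) (@compact_I01 R)).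
  by exists M.
by exists M => z [e eE]; exact: HM.
Qed.

Lemma gam_vertex E e t v : parametrized E -> e \in E -> I01 t -> gam e t = pos D v ->
  (v = src e /\ t = 0) \/ (v = tgt e /\ t = 1).
Proof.
move=> P eE It gv; have [de _ eG [_ inj g0 g1 ce]] := P e eE.
have : v \in [set src e; tgt e]%SET.
  by rewrite -de; apply: (@curve_vertex _ _ D _ _ eG); rewrite ce -gv; exists t.
rewrite !inE => /orP[/eqP ve|/eqP ve]; [left|right]; split => //.
  by apply: (inj t 0) => //; rewrite gv ve g0.
by apply: (inj t 1) => //; rewrite gv ve g1.
Qed.

Lemma gam_common E e e' t t' : parametrized E -> e \in E -> e' \in E -> I01 t -> I01 t' ->
  gam e t = gam e' t' -> e <> e' -> exists2 v, v \in e :&: e' & gam e t = pos D v.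
Proof.
move=> P eE eE' It It' gg ee.
have [_ _ eG [_ _ _ _ ce]] := P e eE; have [_ _ eG' [_ _ _ _ ce']] := P e' eE'.
apply: (@curve_cross _ _ D _ _ _ eG eG' ee); first by rewrite ce; exists t.
by rewrite gg ce'; exists t'.
Qed.

(** When [w] vanishes, the lifts along all edges take the value [al v] at each common vertex [v].
    Edges meet nowhere else, so the lifts define one function, continuous on each of finitely many
    closed curves. *)
Lemma winding0_log E f w : parametrized E -> winding E f w ->
  (forall e, e \in E -> w e = 0) -> haslog (KE E) f.
Proof.
move=> P [al [lam H]] w0.
have vert e t v : e \in E -> I01 t -> gam e t = pos D v -> lam e t = al v.
  move=> eE It gv; have [_ _ l0 l1] := H e eE.
  have [[-> ->]|[-> ->]] := gam_vertex P eE It gv; first by [].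
  by rewrite l1 w0 // mul0r addr0.
have cons e e' t t' : e \in E -> e' \in E -> I01 t -> I01 t' -> gam e t = gam e' t' ->
    lam e t = lam e' t'.
  move=> eE eE' It It' gg; case: (pselect (e = e')) => [ee|ee].
    move: gg; rewrite -ee => gg; have [_ _ _ [_ inj _ _ _]] := P e eE.
    by rewrite (inj t t').
  have [v _ gv] := gam_common P eE eE' It It' gg ee.
  by rewrite (vert e t v) // (vert e' t' v) // -gg.
have /choice[th Hth] : forall z, exists x, forall e t, e \in E -> I01 t -> gam e t = z -> lam e t = x.
  move=> z; case: (pselect (exists e t, [/\ e \in E, I01 t & gam e t = z])) => [[e [t [eE It gz]]]|n].
    by exists (lam e t) => e' t' eE' It' gz'; apply: cons => //; rewrite gz.
  by exists 0 => e t eE It gz; exfalso; apply: n; exists e, t.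
exists th; last first.
  move=> z [e eE]; have [_ _ _ [_ _ _ _ ->]] := P e eE; move=> [t It <-].
  by rewrite -(Hth (gam e t) e t) //; have [_ + _ _] := H e eE; apply.
have cone e : e \in E -> con (curve D e) th.
  move=> eE; have [_ _ _ [c _ _ _ ->]] := P e eE; apply: con_image => //.
  have [cl _ _ _] := H e eE.
  by apply: con_eq cl => t It; exact: Hth.
have clo e : e \in E -> closed (curve D e).
  move=> eE; have [_ _ _ [c _ _ _ ->]] := P e eE.
  by apply: closed_image => //; rewrite I01E; exact: itv_closed.
have -> : KE E = [set z | exists2 e, e \in enum E & curve D e z].
  by apply/seteqP; split => z [e eE ez]; exists e => //; rewrite ?mem_enum // -mem_enum.
have : {subset enum E <= E} by move=> e; rewrite mem_enum.
elim: (enum E) => [|e s IH] sub.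
  by have -> : [set z | exists2 e, e \in [::] & curve D e z] = set0; [apply/seteqP; split => z // []|].
have cl : closed [set z | exists2 e, e \in s & curve D e z].
  have -> : [set z | exists2 e, e \in s & curve D e z] = KE [set e in s].
    by apply/seteqP; split => z [e' h ?]; exists e' => //; rewrite inE in h *.
  apply: closed_KE; apply: parametrized_sub P; apply/fintype.subsetP => e'.
  by rewrite inE => h; apply: sub; rewrite in_cons h orbT.
have -> : [set z | exists2 e0, e0 \in e :: s & curve D e0 z] =
    curve D e `|` [set z | exists2 e, e \in s & curve D e z].
  apply/seteqP; split => z.
    by case=> e'; rewrite in_cons => /orP[/eqP ->|es ez]; [left|right; exists e'].
  by case=> [ez|[e' es ez]]; [exists e|exists e'] => //; rewrite in_cons ?eqxx ?es ?orbT.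
apply: conU => //; [apply: clo|apply: cone|apply: IH]; try by apply: sub; rewrite in_cons eqxx.
by move=> e' h; apply: sub; rewrite in_cons h orbT.
Qed.

Lemma const_on_I01 (d : R -> R) : (forall t, I01 t -> exists2 r, 0 < r & forall y,
  I01 y -> ball t r y -> d y = d t) -> d 0 = d 1.
Proof.
move=> H; apply: (@cousin _ (fun u v => d u = d v)) ler01 _ _.
- by move=> x y z _ _ _ _ -> ->.
- move=> x hx; have [r r0 Hr] := H x hx; exists r => // y z xy yz zx y0 z1.
  by rewrite !Hr // /ball /= ?ltr_norml; try (apply/andP; split; lra).
Qed.

(** Along an edge the lift [lam e] and the global argument differ by a constant; [be] reads off this
    multiple of [2 pi] at a vertex, with [al] in place of the lift, and the two ends disagree by
    [w e]. *)
Lemma log_winding E f w : parametrized E -> haslog (KE E) f -> winding E f w ->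
  exists be : G -> int, forall e, e \in E -> w e = be (src e) - be (tgt e).
Proof.
move=> P [th cth Hth] [al [lam H]].
have pi0 : (pi *+ 2 : R) != 0 by rewrite gt_eqF // pmulrn_lgt0 // pi_gt0.
exists (fun v => Num.floor ((al v - th (pos D v)) / (pi *+ 2))) => e eE.
have [_ _ _ [cg _ g0 g1 _]] := P e eE; have [cl Hl l0 l1] := H e eE.
have cthg : con (@I01 R) (fun t => th (gam e t)).
  by apply: (con_comp cg cth) => t It; exact: (gam_in P).
have posth t : I01 t -> 0 < f (gam e t) * uexp (- th (gam e t)).
  by move=> It; apply: Hth; exact: (gam_in P).
have := @const_on_I01 (fun t => lam e t - th (gam e t)) (fun t It =>
  log_diff_loc cl cthg Hl posth It).
have [n hn] := angle_uniq (Hl 0 I0) (posth 0 I0).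
rewrite hn l1 g1 => h1; rewrite l0 g0 in hn.
have -> : (al (src e) - th (pos D (src e))) / (pi *+ 2) = n%:~R by rewrite hn mulfK.
have -> : (al (tgt e) - th (pos D (tgt e))) / (pi *+ 2) = (n - w e)%:~R.
  have -> : al (tgt e) - th (pos D (tgt e)) = (n - w e)%:~R * (pi *+ 2).
    by rewrite intrD mulrDl h1 rmorphN /=; ring.
  by rewrite mulfK.
by rewrite !intrKfloor; ring.
Qed.

Lemma winding_ex E f : parametrized E -> lhl (KE E) f -> exists w, winding E f w.
Proof.
move=> P lf.
have /choice[al Hal] : forall v, exists t, f (pos D v) != 0 -> 0 < f (pos D v) * uexp (- t).
  move=> v; case: (pselect (f (pos D v) != 0)) => [h|h]; last by exists 0.
  by have [t Ht] := angle_ex h; exists t.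
have /choice[p Hp] : forall e, exists p : (R -> R) * int, e \in E ->
    [/\ con (@I01 R) p.1, forall t, I01 t -> 0 < f (gam e t) * uexp (- p.1 t),
      p.1 0 = al (src e) & p.1 1 = al (tgt e) + p.2%:~R * (pi *+ 2)].
  move=> e; case: (boolP (e \in E)) => eE; last by exists (fun=> 0, 0).
  have [_ _ _ [cg _ g0 g1 _]] := P e eE.
  have : lhl (@I01 R) (f \o gam e).
    move=> t It; have [r r0 Hr] := lf _ (gam_in P eE It).
    have [d d0 Hd] := con_ball cg It r0; exists d => //.
    apply: haslog_comp Hr; first by apply: con_sub cg => y [].
    by move=> y [Iy yb]; split; [exact: (gam_in P)|exact: Hd].
  move=> /path_lift[s cs Hs].
  have a0 : 0 < f (gam e 0) * uexp (- al (src e)).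
    by rewrite g0; apply: Hal; have := Hs 0 I0; rewrite /= g0; apply: contraTN => /eqP ->; rewrite mul0r ltxx.
  have [k hk] := angle_uniq a0 (Hs 0 I0).
  pose s' t := s t + k%:~R * (pi *+ 2).
  have Hs' t : I01 t -> 0 < f (gam e t) * uexp (- s' t) by move=> /Hs; exact: angle_shift.
  have a1 : 0 < f (gam e 1) * uexp (- al (tgt e)).
    by rewrite g1; apply: Hal; have := Hs 1 I1; rewrite /= g1; apply: contraTN => /eqP ->; rewrite mul0r ltxx.
  have [j hj] := angle_uniq (Hs' 1 I1) a1.
  exists (s', j) => _; split => //=.
  - by apply: conD => //; exact: con_cst.
  - by rewrite /s' -hk; lra.
  - by rewrite -hj; lra.
by exists (fun e => (p e).2), al, (fun e => (p e).1) => e; exact: Hp.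
Qed.

Lemma windingM E f g v w : winding E f v -> winding E g w ->
  winding E (fun z => f z * g z) (fun e => v e + w e).
Proof.
move=> [a [l H]] [b [m I]]; exists (fun x => a x + b x), (fun e t => l e t + m e t) => e eE.
have [l1 l2 l3 l4] := H e eE; have [m1 m2 m3 m4] := I e eE; split.
- exact: conD.
- by move=> t It; rewrite opprD uexpD mulrACA mulr_gt0 ?l2 ?m2.
- by rewrite l3 m3.
- by rewrite l4 m4 intrD; ring.
Qed.

Lemma windingX E f w k : winding E f w -> winding E (fun z => f z ^ k) (fun e => k * w e).
Proof.
move=> [a [l H]]; exists (fun x => k%:~R * a x), (fun e t => k%:~R * l e t) => e eE.
have [l1 l2 l3 l4] := H e eE; split.
- by apply: conM => //; exact: con_cst.
- move=> t It; have := exprz_gt0 k (l2 t It).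
  rewrite exprzMl ?unitfE ?uexp_neq0 //; first by rewrite -uexpMz mulrN.
  by apply: contraTN (l2 t It) => /eqP ->; rewrite mul0r ltxx.
- by rewrite l3.
- by rewrite l4 intrM; ring.
Qed.

Lemma winding1 E : winding E (fun=> 1) (fun=> 0).
Proof.
exists (fun=> 0), (fun _ _ => 0) => e eE; split => //; first exact: con_cst.
- by move=> t _; rewrite oppr0 uexp0 mulr1 ltr01.
- by rewrite mul0r addr0.
Qed.

Lemma winding_eq E f g v w : (forall z, f z = g z) -> (forall e, e \in E -> v e = w e) ->
  winding E f v -> winding E g w.
Proof.
move=> fg vw [a [l H]]; exists a, l => e eE; have [l1 l2 l3 l4] := H e eE; split => //.
- by move=> t It; rewrite -fg; exact: l2.
- by rewrite -vw.
Qed.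

Lemma winding_prod E (I : Type) (r : seq I) (f : I -> plane -> R[i])
    (ws : I -> {set G} -> int) :
  (forall i, winding E (f i) (ws i)) ->
  winding E (fun z => \prod_(i <- r) f i z) (fun e => \sum_(i <- r) ws i e).
Proof.
move=> H; elim: r => [|i r IH].
  by apply: winding_eq (winding1 E) => [z|e _]; rewrite big_nil.
by apply: winding_eq (windingM (H i) IH) => [z|e _]; rewrite big_cons.
Qed.

Lemma winding_sub E E' f w : E' \subset E -> winding E f w -> winding E' f w.
Proof. by move=> /fintype.subsetP s [a [l H]]; exists a, l => e /s; exact: H. Qed.

Lemma winding_shift E f w (be : G -> int) : winding E f w ->
  winding E f (fun e => w e + be (src e) - be (tgt e)).
Proof.
move=> [a [l H]]; exists (fun v => a v + (be v)%:~R * (pi *+ 2)),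
  (fun e t => l e t + (be (src e))%:~R * (pi *+ 2)) => e eE.
have [l1 l2 l3 l4] := H e eE; split.
- by apply: conD => //; exact: con_cst.
- by move=> t /l2; exact: angle_shift.
- by rewrite l3.
- by rewrite l4 !intrD rmorphN /=; ring.
Qed.

(** Demanded of every nonempty subset, this says that [E] is a forest; demanded of those with fewer
    than [g] edges, that the girth is at least [g]. No notion of cycle is needed. *)
Definition has_leaf (E : {set {set G}}) := exists2 v : G, exists2 e, e \in E & v \in e &
  forall e e', e \in E -> e' \in E -> v \in e -> v \in e' -> e = e'.

(** A leaf edge is removed and the potential of the rest found by induction; the value at the leaf
    vertex, which lies on no other edge, is then chosen to fit the removed edge. *)
Lemma acyclic_coboundary E : parametrized E ->
  (forall E' : {set {set G}}, E' \subset E -> E' != finset.set0 -> has_leaf E') ->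
  forall w : {set G} -> int, exists be : G -> int, forall e, e \in E -> w e = be (src e) - be (tgt e).
Proof.
move: {2}#|E| (leqnn #|E|) => n; elim: n E => [|n IH] E.
  by rewrite leqn0 cards_eq0 => /eqP -> _ _ w; exists (fun=> 0) => e; rewrite inE.
move=> En P acy w; have [E0|E0] := eqVneq E finset.set0.
  by exists (fun=> 0) => e; rewrite E0 inE.
have [v [e0 e0E ve0] uniq_v] := acy E (fintype.subxx _) E0.
have sub : E :\ e0 \subset E by apply: subD1set.
have [||be Hbe] := IH (E :\ e0) _ (parametrized_sub sub P) _ w.
- by rewrite (cardsD1 e0 E) e0E in En.
- by move=> E' sE'; apply: acy; apply: fintype.subset_trans sE' sub.
have [de0 neq _ _] := P e0 e0E.
pose be' x := if x == v then (if v == src e0 then w e0 + be (tgt e0) else be (src e0) - w e0) else be x.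
exists be' => e eE; case: (eqVneq e e0) => [->|ne].
  have : v \in [set src e0; tgt e0]%SET by rewrite -de0.
  rewrite !inE /be'.
  case: (eqVneq v (src e0)) => [-> _|nv /= /eqP ->].
    by rewrite ?eqxx [tgt e0 == _]eq_sym (negPf neq); ring.
  by rewrite ?(negPf neq) eqxx; ring.
have [de _ _ _] := P e eE.
have nve x : x \in e -> (x == v) = false.
  by move=> xe; apply/eqP => xv; move/eqP: ne; apply; apply: uniq_v => //; rewrite -xv.
have [se te] : src e \in e /\ tgt e \in e.
  suff : src e \in [set src e; tgt e]%SET /\ tgt e \in [set src e; tgt e]%SET by rewrite -de.
  by rewrite !inE !eqxx orbT.
rewrite /be' !nve //.
by apply: Hbe; rewrite !inE ne.
Qed.

Lemma acyclic_log E f : parametrized E ->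
  (forall E' : {set {set G}}, E' \subset E -> E' != finset.set0 -> has_leaf E') ->
  lhl (KE E) f -> haslog (KE E) f.
Proof.
move=> P acy lf; have [w Hw] := winding_ex P lf.
have [be Hbe] := acyclic_coboundary P acy w.
apply: (winding0_log P (winding_shift (fun v => - be v) Hw)) => e eE.
by rewrite Hbe //; ring.
Qed.

End Winding.

(** * The Euler inequality *)
Section Euler.
Variables (R : realType) (G : sgraph) (D : embedding R G).
Notation plane := (R * R)%type.
Variables (src tgt : {set G} -> G) (gam : {set G} -> R -> plane).
Variable E : {set {set G}}.
Hypothesis P : parametrized D src tgt gam E.

Notation K := (KE D E).

(* Equal homotopy classes of [phi a] and [phi b], as maps from [A] to the punctured
   plane; [outer_class] is triviality of the class of [phi a]. *)
Definition same_class (A : set plane) a b := haslog A (fun z => phi a z * (phi b z)^-1).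
Definition outer_class (A : set plane) a := haslog A (phi a).

Let cK : closed K. Proof. exact: closed_KE P. Qed.

Lemma same_class_neq0 A a b z : same_class A a b -> A z -> (phi a z != 0) /\ (phi b z != 0).
Proof. by move=> h /(haslog_neq0 h); rewrite mulf_eq0 invr_eq0 negb_or => /andP. Qed.

Lemma same_class_outer A a b : same_class A a b -> outer_class A a -> outer_class A b.
Proof.
move=> h ha; apply: haslog_eq (haslogM (haslogV h) ha) => z Az.
by have [? ?] := same_class_neq0 h Az; field; apply/andP.
Qed.

Lemma same_class_trans A a b c : same_class A a b -> same_class A b c -> same_class A a c.
Proof.
move=> h h'; apply: haslog_eq (haslogM h h') => z Az.
by have [? ?] := same_class_neq0 h Az; have [? ?] := same_class_neq0 h' Az; field; apply/andP.
Qed.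

Lemma same_class_refl A a : ~ A a -> same_class A a a.
Proof.
move=> nA; apply: (@haslog_eq _ _ _ (fun=> 1)); last exact: haslog1.
move=> z Az; rewrite divff //.
by apply: phi_neq0 => za; apply: nA; rewrite -za.
Qed.

Lemma cls_bounded (A : set plane) M a : A `<=` within_box M -> ~ outer_class A a ->
  cls A (fun z => (phi a z)^-1) `<=` within_box M.
Proof.
move=> AM nz z [nA h]; apply: contrapT => nM; apply: nz.
exact: (@same_class_outer _ z a h (haslog_far AM nM)).
Qed.

(** [index_zero] needs an open set that is closed together with [K], not a connected one, so a whole
    class can serve as [V]. *)
Lemma index_cls (F : plane -> R[i]) M a k l : K `<=` within_box M ->
  cls K F `<=` within_box M -> cls K F a ->
  (forall p, p \in l -> ~ cls K F p.1 /\ ~ K p.1) ->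
  haslog K (fun z => phi a z ^ k * ratfun l z) -> k = 0.
Proof.
move=> KM FM Fa Hl; apply: (@index_zero _ K (cls K F) a k l M) => //.
- exact: open_cls.
- exact: closed_cls.
- by move=> z [].
- by move=> z [/FM|/KM].
- by move=> p /Hl[? ?] [].
Qed.

(** The outer class is excluded, so that [q] counts bounded faces only: it is the trivial class and
    has no part in independence. *)
Definition inequivalent q (a : 'I_q -> plane) := [/\ forall i, ~ K (a i),
  forall i j, i != j -> ~ same_class K (a i) (a j) & forall i, ~ outer_class K (a i)].

(** More winding vectors than edges satisfy an integer relation, that is, a product of powers of the
    [phi (a i)] has an argument on [K]; [index_cls] makes every exponent zero. *)
Lemma inequivalent_card q (a : 'I_q -> plane) : inequivalent a -> (q <= #|E|)%N.
Proof.
move=> [nK ne nz]; rewrite leqNgt; apply/negP => Eq.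
have [M KM] := bounded_KE P.
have /choice[w Hw] : forall i, exists w, winding src tgt gam E (phi (a i)) w.
  by move=> i; apply: winding_ex P _; exact: lhl_phi.
have [k [[j kj] Hk]] := int_dependent w Eq.
have W0 := winding_prod (index_enum 'I_q) (fun i => windingX (k i) (Hw i)).
have L := winding0_log P W0 Hk.
apply/negP: kj; rewrite negbK; apply/eqP.
pose l : seq (plane * int) := [seq (a i, k i) | i <- enum 'I_q & i != j].
apply: (@index_cls (fun z => (phi (a j) z)^-1) M (a j) (k j) l) => //.
- exact: cls_bounded.
- by split => //; exact: same_class_refl.
- move=> p /mapP[x].
  rewrite mem_filter => /andP[ij _] -> /=; split => //.
  by move=> [_ h]; exact: (ne x j ij h).
- apply: haslog_eq L => z Kz.
  rewrite (bigD1 j) //= /ratfun /l big_map big_filter big_enum_cond /=.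
  by congr (_ * _); apply: eq_bigl.
Qed.

Lemma inequivalent_max : exists q (a : 'I_q -> plane), inequivalent a /\
  forall z, ~ K z -> outer_class K z \/ exists i, same_class K z (a i).
Proof.
pose Q q := `[< exists a : 'I_q -> plane, inequivalent a >].
have exQ : exists q, Q q.
  exists 0%N; apply/asboolP; exists (fun=> (0, 0)); split; by case.
have bQ q : Q q -> (q <= #|E|)%N by move=> /asboolP[a]; exact: inequivalent_card.
case: (ex_maxnP exQ bQ) => q /asboolP[a Fa] mx; exists q, a; split => // z nKz.
apply: contrapT => h.
have [nK ne nz] := Fa.
suff /mx : Q q.+1 by rewrite ltnn.
apply/asboolP; exists (fun i => oapp a z (unlift ord_max i)); split.
- by move=> i; case: unliftP => [j _|_] /=.
- move=> i i'; case: unliftP => [j|] -> /=; case: unliftP => [j'|] -> /=.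
  + by rewrite (inj_eq lift_inj); exact: ne.
  + by move=> _ h'; apply: h; right; exists j; exact: haslog_sym.
  + by move=> _ h'; apply: h; right; exists j'.
  + by rewrite eqxx.
- by move=> i; case: unliftP => [j _|_] //= h'; apply: h; left.
Qed.

Section Spanning.
Variable e : {set G}.
Hypothesis eE : e \in E.

Let I0 : I01 (0 : R). Proof. by rewrite /I01 /= lexx ler01. Qed.
Let I1 : I01 (1 : R). Proof. by rewrite /I01 /= lexx ler01. Qed.

Let subE : E :\ e \subset E. Proof. exact: subD1set. Qed.
Let PD : parametrized D src tgt gam (E :\ e). Proof. exact: parametrized_sub subE P. Qed.

Lemma meet_ends t : I01 t -> KE D (E :\ e) (gam e t) -> t = 0 \/ t = 1.
Proof.
move=> It [e' e'E]; have [_ _ _ [_ _ _ _ ->]] := PD e'E.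
move=> [t' It' gg].
have [v _ gv] := @gam_common _ _ _ _ _ _ _ e e' t t' P eE (fintype.subsetP subE _ e'E) It It'
  (esym gg) (fun h => ltac:(by move: e'E; rewrite -h !inE eqxx)).
by have [[_ ->]|[_ ->]] := gam_vertex P eE It gv; [left|right].
Qed.

(** A full turn along [e] begins and ends at 1, so it fits the constant 1 on all other edges. This
    realises the unit vector of [e] as a winding. *)
Lemma loop_ex : exists F : plane -> R[i],
  (forall t, I01 t -> F (gam e t) = uexp ((pi *+ 2) * t)) /\
  (forall z, KE D (E :\ e) z -> F z = 1).
Proof.
have [_ _ _ [_ inj _ _ _]] := P eE.
have /choice[F HF] : forall z, exists x, (forall t, I01 t -> gam e t = z -> x = uexp ((pi *+ 2) * t)) /\
    (KE D (E :\ e) z -> x = 1 :> R[i]).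
  move=> z; case: (pselect (exists2 t, I01 t & gam e t = z)) => [[t It gz]|n].
    exists (uexp ((pi *+ 2) * t)); split.
      by move=> t' It' gz'; rewrite (inj t t') // gz.
    rewrite -gz => /(meet_ends It)[] ->; first by rewrite mulr0 uexp0.
    by have := @uexp2pi R 1; rewrite mul1r mulr1.
  by exists 1; split => // t It gz; exfalso; apply: n; exists t.
by exists F; split=> [t It|z]; [exact: (HF (gam e t)).1|exact: (HF z).2].
Qed.

(** Away from one end [v] of [e], the other edges meet [e] only at its second end, where the
    argument [th] along [e] has the value [c], which is 0 or [2 pi]; it can be pasted with the
    constant [c] on those edges. *)
Lemma loop_lhl F : (forall t, I01 t -> F (gam e t) = uexp ((pi *+ 2) * t)) ->
  (forall z, KE D (E :\ e) z -> F z = 1) -> lhl K F.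
Proof.
move=> F1 F2.
have [_ neq _ [cg inj g0 g1 ce]] := P eE.
have /choice[th Hth] : forall z, exists x, forall t, I01 t -> gam e t = z -> x = (pi *+ 2) * t.
  move=> z; case: (pselect (exists2 t, I01 t & gam e t = z)) => [[t It gz]|n].
    by exists ((pi *+ 2) * t) => t' It' gz'; rewrite (inj t t') // gz.
  by exists 0 => t It gz; exfalso; apply: n; exists t.
have cth : con (curve D e) th.
  rewrite ce; apply: con_image => //.
  apply: (@con_eq _ _ _ (fun t => (pi *+ 2) * t)).
    by move=> t It; rewrite /= (Hth (gam e t) t).
  by apply: conM; [exact: con_cst|exact: con_id].
have clo : closed (curve D e).
  by rewrite ce; apply: closed_image => //; rewrite I01E; exact: itv_closed.
have Fth z : curve D e z -> 0 < F z * uexp (- th z).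
  rewrite ce => -[t It <-]; rewrite F1 // (Hth (gam e t) t) //.
  by rewrite -uexpD subrr uexp0 ltr01.
have pne : pos D (src e) <> pos D (tgt e) by move/pos_inj => h; rewrite h eqxx in neq.
have piece (v : plane) c : (forall z, curve D e z -> KE D (E :\ e) z -> z = v \/ th z = c) ->
    uexp c = 1 -> forall z, z <> v -> exists2 r, 0 < r & haslog (K `&` ball z r) F.
  move=> Hv c1 z zv.
  have [r r0 Hr] := @closed_far _ _ [set v] z (compact_closed (@hausdorff_plane R) (@compact_set1 _ v)) zv.
  exists (r / 2); first by rewrite divr_gt0.
  pose Q := box (z.1 - r / 2) (z.1 + r / 2) (z.2 - r / 2) (z.2 + r / 2).
  have Qb y : Q y -> ball z r y.
    move=> [? ? ? ?]; apply/ball_planeE; rewrite !ltr_norml; split; apply/andP; split; lra.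
  apply: (@haslog_sub _ _ _ ((curve D e `&` Q) `|` (KE D (E :\ e) `&` Q))).
    move=> y [[e' e'E e'y] /ball_planeE]; rewrite !ltr_norml => -[/andP[h1 h2] /andP[h3 h4]].
    have Qy : Q y by split; lra.
    case: (eqVneq e' e) => [ee|ne]; first by left; split => //; rewrite -ee.
    by right; split => //; exists e' => //; rewrite !inE ne.
  apply: (haslogU (s := th) (t := fun=> c)).
  - by apply: closedI => //; exact: closed_box.
  - by apply: closedI; [exact: closed_KE PD|exact: closed_box].
  - by apply: con_sub cth => y [].
  - exact: con_cst.
  - by move=> y [/Fth].
  - by move=> y [/F2 -> _]; rewrite uexpN c1 invr1 mulr1 ltr01.
  - move=> y [ey Qy] [Ey _]; have [yv|//] := Hv y ey Ey.
    by exfalso; apply: (Hr y (Qb y Qy)).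
have two : uexp (pi *+ 2) = 1 :> R[i] by have := @uexp2pi R 1; rewrite mul1r.
move=> z Kz; case: (pselect (z = pos D (tgt e))) => [->|zt].
  apply: (piece (pos D (src e)) (pi *+ 2)) => //; last by move=> h; apply: pne.
  move=> y; rewrite ce => -[t It <-] /(meet_ends It)[] t0; rewrite t0; first by left.
  by right; rewrite (Hth (gam e 1) 1) // mulr1.
apply: (piece (pos D (tgt e)) 0) => //; last by rewrite uexp0.
move=> y; rewrite ce => -[t It <-] /(meet_ends It)[] t0; rewrite t0; last by left.
by right; rewrite (Hth (gam e 0) 0) // mulr0.
Qed.

Lemma loop_winding F : (forall t, I01 t -> F (gam e t) = uexp ((pi *+ 2) * t)) ->
  (forall z, KE D (E :\ e) z -> F z = 1) ->
  winding src tgt gam E F (fun e' => (e' == e)%:Z).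
Proof.
move=> F1 F2; exists (fun=> 0), (fun e' t => if e' == e then (pi *+ 2) * t else 0) => e' e'E.
case: (eqVneq e' e) => [->|ne]; split.
- by apply: conM; [exact: con_cst|exact: con_id].
- by move=> t It; rewrite F1 // -uexpD subrr uexp0 ltr01.
- by rewrite mulr0.
- by rewrite mulr1 add0r mul1r.
- exact: con_cst.
- move=> t It; rewrite F2 ?oppr0 ?uexp0 ?mulr1 ?ltr01 //.
  by apply: (gam_in PD) => //; rewrite !inE ne.
- by [].
- by rewrite add0r mul0r.
Qed.

(** The function turning once along [e] has an argument after multiplication by a rational function.
    Taking windings expresses the unit vector of [e] by the [w i] modulo a coboundary. *)
Lemma span_edge q (a : 'I_q -> plane) (w : 'I_q -> {set G} -> int) : inequivalent a ->
  (forall z, ~ K z -> outer_class K z \/ exists i, same_class K z (a i)) ->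
  (forall i, winding src tgt gam E (phi (a i)) (w i)) ->
  exists (c : 'I_q -> int) (be : G -> int), forall e', e' \in E ->
    (e' == e)%:Z + \sum_i c i * w i e' = be (src e') - be (tgt e').
Proof.
move=> [nK ne nz] mx Hw.
have [M KM] := bounded_KE P.
have [F [F1 F2]] := loop_ex.
have MM : - `|M| <= `|M| by have := normr_ge0 M; lra.
have [l Hl Ll] := rational_log MM MM cK (loop_lhl F1 F2).
have n0 i z : K z -> phi (a i) z != 0.
  by move=> Kz; apply: phi_neq0 => za; apply: (nK i); rewrite -za.
pose B (c : 'I_q -> int) z := \prod_i phi (a i) z ^ c i.
(* Each zero or pole is replaced by the representative of its class, or dropped if it is in the
   outer class; neither affects the existence of an argument on [K]. *)
have [c Hc] : exists c, haslog K (fun z => (ratfun l z)^-1 * B c z).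
  have : forall p, p \in l -> ~ K p.1 by move=> p /Hl[].
  elim: l {Hl Ll} => [|p l IH] H.
    exists (fun=> 0); apply: (@haslog_eq _ _ _ (fun=> 1)); last exact: haslog1.
    move=> z _.
    by rewrite /ratfun big_nil invr1 mul1r /B big1.
  have [|c Hc] := IH; first by move=> p' pl; apply: H; rewrite in_cons pl orbT.
  have nKp := H p (mem_head _ _).
  have p0 z : K z -> phi p.1 z != 0.
    by move=> Kz; apply: phi_neq0 => zp; apply: nKp; rewrite -zp.
  case: (mx _ nKp) => [zp|[i ei]].
    exists c; apply: haslog_eq (haslogM (haslogX (- p.2) zp) Hc) => z Kz.
    by rewrite /ratfun big_cons invfM -invr_expz mulrA.
  exists (fun j => c j + (if j == i then p.2 else 0)).
  apply: haslog_eq (haslogM (haslogX (- p.2) ei) Hc) => z Kz.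
  rewrite /ratfun big_cons invfM.
  have -> : B (fun j => c j + (if j == i then p.2 else 0)) z = B c z * phi (a i) z ^ p.2.
    rewrite /B (bigD1 i) //= [in RHS](bigD1 i) //= eqxx expfzDr ?n0 // mulrAC.
    by congr (_ * _ * _); apply: eq_bigr => j /negPf ->; rewrite addr0.
  rewrite exprzMl ?unitfE ?invr_eq0 ?n0 ?p0 // exprz_inv opprK -!invr_expz; ring.
have {Ll}Ll : haslog K (fun z => F z * ratfun l z).
  apply: haslog_sub Ll => z Kz; split => //.
  have MM' : M <= `|M| by exact: ler_norm.
  by have := within_box_mono MM' (KM z Kz).
have L : haslog K (fun z => F z * B c z).
  apply: haslog_eq (haslogM Ll Hc) => z Kz.
  rewrite mulrACA -mulrA [X in _ * X]mulrCA !mulrA; congr (_ * _).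
  rewrite -mulrA divff ?mulr1 //.
  by have := haslog_neq0 Ll Kz; rewrite mulf_eq0 negb_or => /andP[].
have WB := winding_prod (index_enum 'I_q) (fun i => windingX (c i) (Hw i)).
have [be Hbe] := log_winding P L (windingM (loop_winding F1 F2) WB).
by exists c, be.
Qed.

End Spanning.

(** By [span_edge] the identity matrix on [E] is a sum of two products, one factoring through the
    [q] winding vectors and one through the incidence vectors of [X]; its rank is at most the sum of
    the two inner dimensions. *)
Lemma card_span (X : {set G}) : (forall e, e \in E -> e \subset X) ->
  forall q (a : 'I_q -> plane), inequivalent a ->
  (forall z, ~ K z -> outer_class K z \/ exists i, same_class K z (a i)) -> (#|E| <= q + #|X|)%N.
Proof.
move=> EX q a Fa mx.
have [nK _ _] := Fa.
have /choice[w Hw] : forall i, exists w, winding src tgt gam E (phi (a i)) w.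
  by move=> i; apply: winding_ex P _; exact: lhl_phi.
have /choice[c Hc] : forall e, exists c : ('I_q -> int) * (G -> int), e \in E ->
    forall e', e' \in E -> (e' == e)%:Z + \sum_i c.1 i * w i e' = c.2 (src e') - c.2 (tgt e').
  move=> e; case: (boolP (e \in E)) => eE; last by exists (fun=> 0, fun=> 0).
  by have [c [be H]] := span_edge eE Fa mx Hw; exists (c, be).
pose n := #|E|.
pose A : 'M[rat]_(n, q) := \matrix_(i, j) (- (c (enum_val i)).1 j)%:~R.
pose B : 'M[rat]_(q, n) := \matrix_(j, i) (w j (enum_val i))%:~R.
pose A' : 'M[rat]_(n, #|X|) := \matrix_(i, v) ((c (enum_val i)).2 (enum_val v))%:~R.
pose B' : 'M[rat]_(#|X|, n) := \matrix_(v, i)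
  ((enum_val v == src (enum_val i))%:R - (enum_val v == tgt (enum_val i))%:R).
have eq1 : 1%:M = A *m B + A' *m B'.
  apply/matrixP => i i'; rewrite !mxE.
  have eE := enum_valP i; have e'E := enum_valP i'.
  have := Hc _ eE _ e'E; set e := enum_val i; set e' := enum_val i' => H.
  have sX : src e' \in X /\ tgt e' \in X.
    have := EX _ e'E; have [-> _ _ _] := P e'E => /fintype.subsetP s.
    by split; apply: s; rewrite -/e' !inE eqxx ?orbT.
  have sel (f : G -> int) x : x \in X ->
      \sum_(v : 'I_#|X|) (f (enum_val v))%:~R * (enum_val v == x)%:R = (f x)%:~R :> rat.
    move=> xX; rewrite (bigD1 (enum_rank_in xX x)) //= enum_rankK_in // eqxx mulr1.
    rewrite big1 ?addr0 // => v nv; have -> : (enum_val v == x) = false.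
      apply/negP => /eqP vx; move/negP: nv; apply; apply/eqP.
      by apply: enum_val_inj; rewrite enum_rankK_in.
    by rewrite mulr0.
  have -> : \sum_j A' i j * B' j i' = ((c e).2 (src e') - (c e).2 (tgt e'))%:~R.
    rewrite intrD rmorphN /= -(sel (c e).2 _ sX.1) -(sel (c e).2 _ sX.2) -sumrB.
    by apply: eq_bigr => v _; rewrite !mxE mulrBr.
  rewrite -H intrD addrCA addrC.
  have -> : \sum_j A i j * B j i' = - (\sum_j (c e).1 j * w j e')%:~R.
    rewrite rmorph_sum /= -sumrN; apply: eq_bigr => j _.
    by rewrite !mxE rmorphM rmorphN /= mulNr.
  rewrite addNr add0r.
  rewrite -[i == i'](inj_eq enum_val_inj) eq_sym -/e -/e'.
  by case: (e' == e).
suff : (\rank (1%:M : 'M[rat]_n) <= q + #|X|)%N by rewrite mxrank1.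
rewrite eq1; apply: leq_trans (mxrank_add _ _) _; apply: leq_add.
  exact: mulmx_max_rank.
exact: mulmx_max_rank.
Qed.

End Euler.

(** * Faces and the edges around them *)

Section Faces.
Variables (R : realType) (G : sgraph) (D : embedding R G).
Notation plane := (R * R)%type.
Variables (src tgt : {set G} -> G) (gam : {set G} -> R -> plane).
Variable E : {set {set G}}.
Hypothesis P : parametrized D src tgt gam E.
Variables (q : nat) (a : 'I_q -> plane).
Hypothesis Fa : inequivalent D E a.

Notation K := (KE D E).

Definition face_fun (o : option 'I_q) (z : plane) : R[i] :=
  if o is Some x then (phi (a x) z)^-1 else 1.

Definition face o := cls K (face_fun o).

(** Only interior points of the edge count: any number of faces may come together at a vertex. *)
Definition touches (o : option 'I_q) (e : {set G}) := exists2 t, 0 < t < 1 &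
  forall r, 0 < r -> exists2 b, face o b & ball (gam e t) r b.

Let cK : closed K. Proof. exact: closed_KE P. Qed.

Lemma face_none z : face None z <-> ~ K z /\ outer_class K z.
Proof.
split=> -[nK h]; split => //.
  by apply: haslog_eq h => y _; rewrite mulr1.
by apply: haslog_eq h => y _; rewrite mulr1.
Qed.

Lemma face_uniq o o' b b' : face o b -> face o' b' -> same_class K b b' -> o = o'.
Proof.
move=> [nb hb] [nb' hb'] bb'; have [nK ne nz] := Fa.
have h2 := cls_move nb bb' hb'.
have h : haslog K (fun z => face_fun o z * (face_fun o' z)^-1).
  apply: haslog_eq (haslogM hb (haslogV h2)) => z Kz.
  have := haslog_neq0 hb Kz; rewrite mulf_eq0 negb_or => /andP[b0 _].
  by rewrite invfM mulrACA divff // mul1r.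
case: o o' {hb hb' h2} h => [x|] [y|] //= h.
- case: (eqVneq x y) => [->//|xy]; exfalso; apply: (ne y x); first by rewrite eq_sym.
  by apply: haslog_eq h => z _; rewrite invrK mulrC.
- exfalso; apply: (nz x); apply: haslog_eq (haslogV h) => z _.
  by rewrite invr1 mulr1 invrK.
- exfalso; apply: (nz y); apply: haslog_eq h => z _.
  by rewrite mul1r invrK.
Qed.

Lemma face_bounded M x : K `<=` within_box M -> face (Some x) `<=` within_box M.
Proof. by move=> KM; apply: cls_bounded => //; have [_ _] := Fa. Qed.

Lemma haslog_add_point (A : set plane) (f : plane -> R[i]) z : closed A -> haslog A f -> f z != 0 ->
  haslog (A `|` [set z]) f.
Proof.
move=> cA h fz; case: (pselect (A z)) => [Az|nA].
  by apply: haslog_sub h => y [//|->].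
have [s cs Hs] := h; have [t Ht] := angle_ex fz.
apply: (haslogU (s := s) (t := fun=> t)) => //.
- exact: compact_closed (@hausdorff_plane R) (@compact_set1 _ z).
- exact: con_cst.
- by move=> y ->.
- by move=> y Ay yz; exfalso; apply: nA; rewrite -yz.
Qed.

Lemma closed_add_point (A : set plane) z : closed A -> closed (A `|` [set z]).
Proof.
by move=> cA; apply: closedU => //; exact: compact_closed (@hausdorff_plane R) (@compact_set1 _ z).
Qed.

Section Boundary.
Variable o : option 'I_q.
Variable E' : {set {set G}}.
Hypothesis E'E : E' \subset E.
Hypothesis HE' : forall e, e \in E -> touches o e -> e \in E'.
Hypothesis acy : forall F : {set {set G}}, F \subset E' -> F != finset.set0 -> has_leaf F.

Let P' : parametrized D src tgt gam E'. Proof. exact: parametrized_sub E'E P. Qed.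

(* [KE D E'] with the ends of the edges in [s]: the frontier of a face may contain
   vertices that are on no edge it touches. *)
Definition skeleton (s : seq {set G}) : set plane :=
  foldr (fun e A => A `|` [set pos D (src e)] `|` [set pos D (tgt e)]) (KE D E') s.

Lemma closed_skeleton s : closed (skeleton s).
Proof.
elim: s => [|e s IH] /=; first exact: closed_KE P'.
by apply: closed_add_point; exact: closed_add_point.
Qed.

Lemma ends_in e : e \in E -> K (pos D (src e)) /\ K (pos D (tgt e)).
Proof.
move=> eE; have [_ _ _ [_ _ <- <- _]] := P eE.
by split; apply: (gam_in P) => //; rewrite /I01 /= lexx ler01.
Qed.

Lemma skeleton_sub s : {subset s <= E} -> skeleton s `<=` K.
Proof.
elim: s => [|e s IH] sE /=; first exact: KE_sub.
have [k1 k2] := ends_in (sE e (mem_head _ _)).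
move=> z [[|->//]|->//]; apply: IH => e' es; apply: sE; by rewrite in_cons es orbT.
Qed.

Lemma haslog_skeleton s b : {subset s <= E} -> ~ K b -> haslog (skeleton s) (phi b).
Proof.
move=> sE nK; elim: s sE => [|e s IH] sE /=.
  apply: (acyclic_log P' acy); apply: lhl_phi.
  by move=> h; apply: nK; exact: (KE_sub E'E h).
have [k1 k2] := ends_in (sE e (mem_head _ _)).
have cs := @closed_skeleton s.
have ne v : K v -> phi b v != 0 by move=> Kv; apply: phi_neq0 => vb; apply: nK; rewrite -vb.
apply: haslog_add_point; [exact: closed_add_point|apply: haslog_add_point|]; try exact: ne.
  exact: cs.
by apply: IH => e' es; apply: sE; rewrite in_cons es orbT.
Qed.

Lemma skeleton_mem s e : e \in s -> skeleton s (pos D (src e)) /\ skeleton s (pos D (tgt e)).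
Proof.
elim: s => // e' s IH; rewrite in_cons => /orP[/eqP ->|/IH[h1 h2]] /=.
  by split; [left; right|right].
by split; left; left.
Qed.

Lemma skeleton_KE s : KE D E' `<=` skeleton s.
Proof. by elim: s => //= e s IH z /IH h; left; left. Qed.

Let K' := skeleton (enum E).

Let enumE : {subset enum E <= E}. Proof. by move=> e; rewrite mem_enum. Qed.

(** If points of the face accumulate inside an open edge, the edge is touched and so belongs to
    [E']; the remaining points of [K] are ends of edges, and all of these are in the skeleton. *)
Lemma closed_face_skeleton : closed (face o `|` K').
Proof.
apply: far_closed => z nz.
have nK' : ~ K' z by move=> h; apply: nz; right.
have nF : ~ face o z by move=> h; apply: nz; left.
case: (pselect (K z)) => [[e eE]|nK]; last first.
  have [r r0 Hr] := closed_far (@closed_cls _ _ (face_fun o) cK) (fun h => match h with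
    or_introl h => nF h | or_intror h => nK h end).
  exists r => // y /Hr h [fy|ky]; apply: h; [by left|right].
  exact: (skeleton_sub enumE ky).
have [_ _ _ [_ _ g0 g1 ->]] := P eE; move=> [t /andP[t0 t1] gt].
have [s1 s2] : skeleton (enum E) (pos D (src e)) /\ skeleton (enum E) (pos D (tgt e)).
  by apply: skeleton_mem; rewrite mem_enum.
have t01 : 0 < t < 1.
  rewrite !lt_neqAle t0 t1 !andbT; apply/andP; split; apply/eqP => h; apply: nK'.
    by rewrite /K' -gt -h g0.
  by rewrite /K' -gt h g1.
have nE' : e \notin E'.
  apply/negP => h; apply: nK'; apply: skeleton_KE; exists e => //.
  by have [_ _ _ [_ _ _ _ ->]] := P eE; exists t => //; rewrite /I01 /= t0.
have [r [r0 Hr]] : exists r, 0 < r /\ forall b, ball z r b -> ~ face o b.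
  apply: contrapT => h; move/negP: nE'; apply; apply: HE' => //; exists t => // r r0.
  apply: contrapT => h'; apply: h; exists r; split => // b zb fb; apply: h'.
  by exists b => //; rewrite gt.
have [s s0 Hs] := closed_far (@closed_skeleton (enum E)) nK'.
exists (Num.min r s); first by rewrite lt_min r0.
move=> y yb [|].
  by apply: Hr; apply: le_ball yb; rewrite ge_min lexx.
by apply: Hs; apply: le_ball yb; rewrite ge_min lexx orbT.
Qed.

(** If the touched edges formed a forest, [phi b] would have an argument on the frontier for every
    [b] off [K], against [index_zero] with exponent 1. For a bounded face [b] is taken inside it.
    The outer face is unbounded, so the rest of the plane is used in its place, and [x0] supplies a
    point there. *)
Lemma no_acyclic_boundary (x0 : 'I_q) : False.
Proof.
have [nK ne nz] := Fa.
have [M KM] := bounded_KE P.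
have K'K : K' `<=` K := skeleton_sub enumE.
have K'M : K' `<=` within_box M by move=> z /K'K/KM.
have cK' : closed K' by exact: closed_skeleton.
have index1 (V : set plane) b : open V -> closed (V `|` K') -> (forall z, V z -> ~ K' z) ->
    V `<=` within_box M -> V b -> ~ K b -> False.
  move=> oV cV dV VM Vb nKb.
  suff : (1 : int) = 0 by [].
  apply: (@index_zero _ K' V b 1 [::] M) => //; first by move=> z [/VM|/K'M].
  apply: haslog_eq (haslog_skeleton enumE nKb) => z _.
  by rewrite /ratfun big_nil mulr1.
have oF o' : open (face o') by exact: open_cls.
have dF z : face o z -> ~ K' z by move=> [h _] /K'K.
case: (pselect (o = None)) => [noneo|]; last first.
  case ox: o => [x|] on_; last by [].
  apply: (index1 (face o) (a x)) => //.
  - exact: closed_face_skeleton.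
  - by rewrite ox; exact: face_bounded.
  - by rewrite ox; split => //; exact: same_class_refl.
have far z : ~ within_box M z -> face o z.
  move=> nM; rewrite noneo; apply/face_none; split; first by move=> /KM.
  exact: haslog_far KM nM.
apply: (index1 (~` (face o `|` K')) (a x0)) => //.
- by apply: closed_openC; exact: closed_face_skeleton.
- have -> : ~` (face o `|` K') `|` K' = ~` face o.
    apply/seteqP; split => z.
      by case=> [h|kz] fz; [apply: h; left|exact: dF fz kz].
    by move=> nf; case: (pselect (K' z)) => kz; [right|left => -[|]].
  exact: open_closedC.
- by move=> z h kz; apply: h; right.
- by move=> z h; apply: contrapT => /far fz; apply: h; left.
- by case=> [|/K'K /nK//]; rewrite noneo => /face_none[_] /nz.
Qed.

End Boundary.

Lemma touches_ge (o : option 'I_q) (x0 : 'I_q) g :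
  (forall F : {set {set G}}, F \subset E -> F != finset.set0 -> (#|F| < g)%N -> has_leaf F) ->
  (g <= #|[set e in E | `[< touches o e >]]%SET|)%N.
Proof.
move=> girth; rewrite leqNgt; apply/negP => lt.
set E' := [set e in E | _]%SET in lt.
have E'E : E' \subset E by apply/fintype.subsetP => e; rewrite inE => /andP[].
apply: (@no_acyclic_boundary o E' E'E _ _ x0).
  by move=> e eE te; rewrite inE eE; apply/asboolP.
move=> F FE' F0; apply: girth => //; first exact: fintype.subset_trans FE' E'E.
exact: leq_ltn_trans (subset_leq_card FE') lt.
Qed.

Section Sides.
Variable e : {set G}.
Hypothesis eE : e \in E.

Let PD : parametrized D src tgt gam (E :\ e).
Proof. by apply: parametrized_sub P; exact: subD1set. Qed.

Notation K1 := (KE D (E :\ e)).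

Let cK1 : closed K1. Proof. exact: closed_KE PD. Qed.

Lemma interior_avoids t : 0 < t < 1 -> ~ K1 (gam e t).
Proof.
move=> /andP[t0 t1] h.
have It : I01 t by rewrite /I01 /= !ltW.
by case: (meet_ends P eE It h) => h'; move: t0 t1; rewrite h' ltxx.
Qed.

Lemma interior_same_class s t : 0 < s -> s <= t -> t < 1 -> same_class K1 (gam e s) (gam e t).
Proof.
move=> s0 st t1; have [_ _ _ [cg _ _ _ _]] := P eE.
apply: (@cousin _ (fun u v => same_class K1 (gam e u) (gam e v))) st _ _.
  by move=> x y z _ _ _ _; exact: same_class_trans.
move=> x /andP[sx xt]; have x01 : 0 < x < 1 by lra.
have [r r0 Hr] := closed_far cK1 (interior_avoids x01).
have r20 : 0 < r / 2 by rewrite divr_gt0.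
have Ix : I01 x by rewrite /I01 /=; lra.
have [d d0 Hd] := con_ball cg Ix r20.
exists d => // y z xy yz zx sy zt.
have near u : x - d < u -> u < x + d -> s <= u -> u <= t -> same_class K1 (gam e x) (gam e u).
  move=> h1 h2 h3 h4; apply: (haslog_near r0 Hr); apply: Hd; first by rewrite /I01 /=; lra.
  by rewrite /ball /= ltr_norml; apply/andP; split; lra.
by apply: (@same_class_trans _ _ _ (gam e x)); [apply: haslog_sym|]; apply: near; lra.
Qed.

Lemma touches_point o : touches o e -> exists t b, [/\ 0 < t < 1, face o b &
  same_class K1 b (gam e t)].
Proof.
move=> [t t01 H]; have [r r0 Hr] := closed_far cK1 (interior_avoids t01).
have [b fb bb] := H _ (divr_gt0 r0 (ltr0n _ 2)).
exists t, b; split => //; apply: haslog_sym; exact: (haslog_near r0 Hr bb).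
Qed.

Lemma winding_outside f : lhl K f -> haslog K1 f ->
  exists w, winding src tgt gam E f w /\ forall e', e' \in E -> e' != e -> w e' = 0.
Proof.
move=> lf h1; have [w Hw] := winding_ex P lf.
have [be Hbe] := log_winding PD h1 (winding_sub (subD1set E e) Hw).
eexists; split; first exact: (winding_shift (fun v => - be v) Hw).
move=> e' e'E ne; rewrite /= Hbe; last by rewrite !inE ne.
ring.
Qed.

(** Once [e] is removed the three points have the same class, so the quotients of their [phi] wind
    only along [e]. One edge leaves room for one winding number, hence a relation with exponents of
    sum zero. At most one of the faces is the outer one, so [index_cls] kills two exponents and with
    them the third. *)
Lemma three_sides o1 o2 o3 : touches o1 e -> touches o2 e -> touches o3 e ->
  o1 != o2 -> o2 != o3 -> o3 != o1 -> False.
Proof.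
move=> /touches_point[t1 [b1 [h1 f1 e1]]] /touches_point[t2 [b2 [h2 f2 e2]]]
  /touches_point[t3 [b3 [h3 f3 e3]]] o12 o23 o31.
have path s t : 0 < s < 1 -> 0 < t < 1 -> same_class K1 (gam e s) (gam e t).
  move=> /andP[? ?] /andP[? ?]; case: (leP s t) => st; first exact: interior_same_class.
  by apply: haslog_sym; apply: interior_same_class => //; exact: ltW.
have join b b' t t' : same_class K1 b (gam e t) -> same_class K1 b' (gam e t') -> 0 < t < 1 -> 0 < t' < 1 ->
    same_class K1 b b'.
  move=> hb hb' ht ht'; apply: same_class_trans hb _; apply: same_class_trans (path _ _ ht ht') _.
  exact: haslog_sym.
have e13 := join _ _ _ _ e1 e3 h1 h3; have e23 := join _ _ _ _ e2 e3 h2 h3.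
have [n1 n2 n3] : [/\ ~ K b1, ~ K b2 & ~ K b3] by split; [case: f1|case: f2|case: f3].
have lq b b' : ~ K b -> ~ K b' -> lhl K (fun z => phi b z * (phi b' z)^-1).
  move=> nb nb'; apply: lhlM; first exact: lhl_phi.
  exact: (lhlX (-1) (lhl_phi nb')).
have [w13 [W13 z13]] := winding_outside (lq _ _ n1 n3) e13.
have [w23 [W23 z23]] := winding_outside (lq _ _ n2 n3) e23.
have [k1 [k2 [kn Hk]]] : exists k1 k2 : int, (k1 != 0) || (k2 != 0) /\
    k1 * w13 e + k2 * w23 e = 0.
  case: (eqVneq (w13 e) 0) => [w0|w0]; first by exists 1, 0; split => //; rewrite w0; ring.
  by exists (w23 e), (- w13 e); split; [rewrite oppr_eq0 w0 orbT|ring].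
have L : haslog K (fun z => (phi b1 z * (phi b3 z)^-1) ^ k1 * (phi b2 z * (phi b3 z)^-1) ^ k2).
  apply: (winding0_log P (windingM (windingX k1 W13) (windingX k2 W23))) => e' e'E.
  case: (eqVneq e' e) => [->//|ne]; rewrite z13 // z23 // !mulr0 addr0 //.
have nb b z : ~ K b -> K z -> phi b z != 0.
  by move=> nKb Kz; apply: phi_neq0 => zb; apply: nKb; rewrite -zb.
have {}L : haslog K (fun z => phi b1 z ^ k1 * phi b2 z ^ k2 * phi b3 z ^ (- (k1 + k2))).
  apply: haslog_eq L => z Kz.
  have [[m1 m2] m3] := (nb _ _ n1 Kz, nb _ _ n2 Kz, nb _ _ n3 Kz).
  rewrite !exprzMl ?unitfE ?invr_eq0 // opprD (expfzDr _ _ m3) !exprz_inv; ring.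
have [M KM] := bounded_KE P.
have sep o o' b b' : face o b -> face o' b' -> o != o' -> ~ face o b'.
  move=> fb fb' oo fb2; move/eqP: oo; apply; apply: (face_uniq fb2 fb').
  by apply: same_class_refl; case: fb'.
have zero x o' o'' b b' b'' k k' k'' : face (Some x) b -> face o' b' -> face o'' b'' ->
    Some x != o' -> Some x != o'' ->
    haslog K (fun z => phi b z ^ k * phi b' z ^ k' * phi b'' z ^ k'') -> k = 0.
  move=> fb fb' fb'' xo' xo'' LL.
  apply: (@index_cls _ _ _ _ _ _ _ P (face_fun (Some x)) M b k [:: (b', k'); (b'', k'')]) => //.
  - exact: face_bounded.
  - move=> p; rewrite !inE => /orP[] /eqP -> /=.
      by split; [exact: sep fb fb' xo'|case: fb'].
    by split; [exact: sep fb fb'' xo''|case: fb''].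
  - by apply: haslog_eq LL => z _; rewrite /ratfun !big_cons big_nil mulr1 /= mulrA.
have z1 : o1 <> None -> k1 = 0.
  case: o1 f1 o12 o31 => // x f1 o12 o31 _.
  by apply: (zero x o2 o3 b1 b2 b3 k1 k2 (- (k1 + k2))) => //; rewrite eq_sym.
have z2 : o2 <> None -> k2 = 0.
  case: o2 f2 o12 o23 {z1} => // x f2 o12 o23 _.
  apply: (zero x o1 o3 b2 b1 b3 k2 k1 (- (k1 + k2))) => //; first by rewrite eq_sym.
  by apply: haslog_eq L => z _; rewrite [X in X * _]mulrC.
have z3 : o3 <> None -> - (k1 + k2) = 0.
  case: o3 f3 o23 o31 {z1 z2} => // x f3 o23 o31 _.
  apply: (zero x o1 o2 b3 b1 b2 (- (k1 + k2)) k1 k2) => //; first by rewrite eq_sym.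
  by apply: haslog_eq L => z _; ring.
have : k1 = 0 /\ k2 = 0.
  case: (pselect (o1 = None)) => [E1|/z1 k10].
    have /z2 k20 : o2 <> None by move=> E2; rewrite E1 E2 eqxx in o12.
    have /z3 : o3 <> None by move=> E3; rewrite E1 E3 eqxx in o31.
    lia.
  case: (pselect (o2 = None)) => [E2|/z2 //].
  have /z3 : o3 <> None by move=> E3; rewrite E2 E3 eqxx in o23.
  lia.
by case=> k10 k20; rewrite k10 k20 eqxx in kn.
Qed.

Lemma touches_le2 : (#|[set o | `[< touches o e >]]%SET| <= 2)%N.
Proof.
rewrite leqNgt; apply/negP => /card_gt2P[ o1 [ o2 [ o3 [[]]]]].
rewrite !inE => h1 h2 h3 [q1 q2 q3].
exact: (three_sides h1 h2 h3 q1 q2 q3).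
Qed.

End Sides.

Lemma face_count g (x0 : 'I_q) :
  (forall F : {set {set G}}, F \subset E -> F != finset.set0 -> (#|F| < g)%N -> has_leaf F) ->
  (g * q.+1 <= 2 * #|E|)%N.
Proof.
move=> girth.
have -> : (g * q.+1 = \sum_(o : option 'I_q) g)%N.
  by rewrite sum_nat_const cardT -cardE card_option card_ord mulnC.
apply: (@leq_trans (\sum_(o : option 'I_q) \sum_(e in E) `[< touches o e >])).
  apply: leq_sum => o _; apply: leq_trans (touches_ge o x0 girth) _.
  by rewrite -sum1_card big_mkcond [X in (_ <= X)%N]big_mkcond leq_sum // => e _; rewrite inE; case: (e \in E); case: `[< _ >].
rewrite exchange_big /= mulnC -sum_nat_const.
apply: leq_sum => e eE; apply: leq_trans (touches_le2 eE).
by rewrite -sum1_card [X in (_ <= X)%N]big_mkcond leq_sum // => o _; rewrite inE; case: `[< _ >].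
Qed.

End Faces.

Lemma parametrization (R : realType) (G : sgraph) (D : embedding R G) (v0 : G) :
  exists src tgt gam, parametrized D src tgt gam (edges G).
Proof.
have /choice[p Hp] : forall e, exists p : G * G * (R -> R * R), e \in edges G ->
  [/\ e = [set p.1.1; p.1.2]%SET, p.1.1 != p.1.2, e \in edges G &
   [/\ con (@I01 R) p.2, forall s t, I01 s -> I01 t -> p.2 s = p.2 t -> s = t,
     p.2 0 = pos D p.1.1, p.2 1 = pos D p.1.2 & curve D e = p.2 @` @I01 R]].
  move=> e; case: (boolP (e \in edges G)) => [eG|_]; last by exists (v0, v0, fun=> (0, 0)).
  have /imsetP[[x y]] := eG; rewrite inE /= => xy exy.
  have [g [cg ig g0 g1 cu]] := curve_arc D xy.
  exists (x, y, g) => _ /=; split => //.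
    by apply/eqP => h; rewrite h adj_irr in xy.
  rewrite I01E; split => //; [exact/conP|by rewrite exy].
by exists (fun e => (p e).1.1), (fun e => (p e).1.2), (fun e => (p e).2) => e /Hp.
Qed.

(* For [E] the edges of a plane graph of girth at least [g] this is the usual
   count: every face has at least [g] sides, every edge at most two. *)
Theorem euler_girth (R : realType) (G : sgraph) (D : embedding R G)
    (E : {set {set G}}) (X : {set G}) g :
  E \subset edges G -> (forall e, e \in E -> e \subset X) ->
  (forall F : {set {set G}}, F \subset E -> F != finset.set0 -> (#|F| < g)%N -> has_leaf F) ->
  (#|E| <= #|X|)%N \/ (g * #|E| + g <= 2 * #|E| + g * #|X|)%N.
Proof.
move=> EG EX girth.
have [->|/set0Pn[e eE]] := eqVneq E finset.set0; first by left; rewrite cards0.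
have [v0] : exists v0 : G, True.
  by have /imsetP[[x y] _ _] := fintype.subsetP EG _ eE; exists x.
move=> _; have [src [tgt [gam P0]]] := parametrization D v0.
have P := parametrized_sub EG P0.
have [q [a [Fa mx]]] := inequivalent_max P.
have le := card_span P EX Fa mx.
case: q a Fa mx le => [|q] a Fa mx le; first by left.
right; have := face_count P Fa ord0 girth.
have : (g * #|E| <= g * (q.+1 + #|X|))%N by rewrite leq_mul2l le orbT.
rewrite mulnDr mulnS; lia.
Qed.

(** * Arcs in the complement of a plane graph *)
Section Reach.
Variable R : realType.
Notation plane := (R * R)%type.
Implicit Types (O K : set plane).

Definition arc_in O (a b : plane) (g : R -> plane) :=
  [/\ con (@I01 R) g, forall s t, I01 s -> I01 t -> g s = g t -> s = t,
    g 0 = a, g 1 = b & forall t, I01 t -> O (g t)].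

(** Edges of drawings are injective arcs, so injectivity is built in from the start; the case
    [a = b], which no injective arc covers, is added separately. *)
Definition reach O a b := O b /\ (a = b \/ exists g, arc_in O a b g).

Let I0 : I01 (0 : R). Proof. by rewrite /I01 /= lexx ler01. Qed.
Let I1 : I01 (1 : R). Proof. by rewrite /I01 /= lexx ler01. Qed.

Definition seg (a b : plane) (t : R) : plane := (a.1 + t * (b.1 - a.1), a.2 + t * (b.2 - a.2)).

Lemma con_seg A a b (f : R -> R) : con A f -> con A (fun t => seg a b (f t)).
Proof.
move=> cf; apply: con_pair; apply: conD; try exact: con_cst; apply: conM => //; exact: con_cst.
Qed.

Lemma seg_inj a b s t : a <> b -> seg a b s = seg a b t -> s = t.
Proof.
move=> ab [/addrI h1 /addrI h2].
case: (eqVneq b.1 a.1) => [e1|n1]; last by apply: (mulIf _ h1); rewrite subr_eq0.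
case: (eqVneq b.2 a.2) => [e2|n2]; last by apply: (mulIf _ h2); rewrite subr_eq0.
by exfalso; apply: ab; rewrite (surjective_pairing a) (surjective_pairing b) e1 e2.
Qed.

Lemma seg0 a b : seg a b 0 = a.
Proof. by rewrite /seg !mul0r !addr0; case: a. Qed.

Lemma seg1 a b : seg a b 1 = b.
Proof. by rewrite /seg !mul1r ![_ + (_ - _)]addrC !subrK; case: b. Qed.

Lemma seg_convex (x y a b t : R) : I01 t -> x <= a <= y -> x <= b <= y ->
  x <= a + t * (b - a) <= y.
Proof. by rewrite /I01 /= => *; apply/andP; split; nra. Qed.

Lemma seg_box x y c d a b t : I01 t -> box x y c d a -> box x y c d b ->
  box x y c d (seg a b t).
Proof.
move=> It [a1 a2 a3 a4] [b1 b2 b3 b4].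
have /andP[? ?] : x <= a.1 + t * (b.1 - a.1) <= y by apply: seg_convex => //; apply/andP.
have /andP[? ?] : c <= a.2 + t * (b.2 - a.2) <= d by apply: seg_convex => //; apply/andP.
by split.
Qed.

Lemma first_time (S : set R) : closed S -> S `<=` @I01 R -> S 1 ->
  exists t0, [/\ S t0, I01 t0 & forall t, I01 t -> S t -> t0 <= t].
Proof.
move=> cS SI S1.
have lbS : lbound S 0 by move=> t /SI /andP[].
have hS : has_inf S by split; [exists 1|exists 0].
have lb t : S t -> inf S <= t by move=> St; apply: ge_inf => //; exists 0.
have Sinf : S (inf S).
  apply: contrapT => nS; have [r r0 Hr] := closed_far cS nS.
  have [s Ss sr] := inf_adherent r0 hS.
  apply: (Hr s) => //; rewrite /ball /= ltr_norml; have := lb s Ss.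
  by move=> ?; apply/andP; split; lra.
by exists (inf S); split => //; [exact: SI|move=> t _ /lb].
Qed.

Lemma con_cut (g : R -> plane) c : I01 c -> con (@I01 R) g ->
  con (@I01 R) (fun t => g (c * t)).
Proof.
move=> Ic cg; apply: (con_comp (B := @I01 R) (f := fun t => c * t)) cg _.
  by apply: conM; [exact: con_cst|exact: con_id].
by move: Ic; rewrite /I01 /= => ? ? ?; apply/andP; split; nra.
Qed.

Lemma arc_cut O a b g c : arc_in O a b g -> I01 c -> 0 < c ->
  arc_in O a (g c) (fun t => g (c * t)).
Proof.
move=> [cg ig g0 g1 gO] Ic c0.
have Ict t : I01 t -> I01 (c * t).
  by move: Ic; rewrite /I01 /= => ? ?; apply/andP; split; nra.
split.
- exact: con_cut.
- move=> s t Is It /ig h; apply: (mulfI (lt0r_neq0 c0)).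
  by apply: h; exact: Ict.
- by rewrite mulr0.
- by rewrite mulr1.
- by move=> t /Ict/gO.
Qed.

(** The arc to [w] is cut at its first entry into the box and continued by a segment to [z]. Before
    that moment the arc is outside the box and the segment stays inside, so the result is injective.
    From a point [a] in the box the segment alone suffices. *)
Lemma reach_box O a x y c d w z : box x y c d `<=` O -> O a -> box x y c d w ->
  reach O a w -> box x y c d z -> reach O a z.
Proof.
move=> QO Oa Qw [Ow aw] Qz; split; first exact: QO.
case: (pselect (a = z)) => az; [by left|right].
case: (pselect (box x y c d a)) => Qa.
  exists (seg a z); split; rewrite ?seg0 ?seg1 //.
  - by apply: con_seg; exact: con_id.
  - by move=> s t _ _; exact: seg_inj.
  - by move=> t It; apply: QO; exact: seg_box.
case: aw => [aw|[g [cg ig g0 g1 gO]]]; first by move: Qa; rewrite aw.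
have cI : closed (@I01 R) by rewrite I01E; exact: itv_closed.
pose S := [set t | I01 t /\ box x y c d (g t)].
have cS : closed S.
  apply: far_closed => t nS; case: (pselect (I01 t)) => It; last first.
    by have [r r0 Hr] := closed_far cI It; exists r => // s /Hr nI [].
  have nQ : ~ box x y c d (g t) by move=> h; apply: nS.
  have [r r0 Hr] := closed_far (@closed_box R x y c d) nQ.
  have [e e0 He] := con_ball cg It r0.
  by exists e => // s st [Is]; apply: Hr; exact: He.
have [|t0 [[_ Qt0] It0 Hmin]] := @first_time S cS (fun t h => h.1).
  by split; rewrite ?g1.
have t0p : 0 < t0.
  rewrite lt_neqAle; move: (It0) => /andP[-> _]; rewrite andbT; apply/eqP => h.
  by apply: Qa; rewrite -g0 h.
have before t : I01 t -> t < t0 -> ~ box x y c d (g t).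
  by move=> It tt0 Qt; have := Hmin t It (conj It Qt); rewrite leNgt tt0.
have arcg : arc_in O a w g by [].
set v := g t0 in Qt0.
case: (pselect (v = z)) => vz.
  by exists (fun t => g (t0 * t)); rewrite -vz; exact: (arc_cut arcg).
pose A := [set t : R | 0 <= t <= 1/2]; pose B := [set t : R | 1/2 <= t <= 1].
have I01AB : @I01 R = A `|` B.
  apply/seteqP; split => t; rewrite /I01 /A /B /=.
    by move=> /andP[h1 h2]; case: (leP t (1/2)) => h; [left|right]; apply/andP; split => //; exact: ltW.
  by case=> /andP[? ?]; apply/andP; split; lra.
pose h t := if t <= 1/2 then g (t0 * (2 * t)) else seg v z (2 * t - 1).
have hA t : A t -> g (t0 * (2 * t)) = h t by move=> /andP[_ ht]; rewrite /h ht.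
have hB t : B t -> seg v z (2 * t - 1) = h t.
  move=> /andP[ht _]; rewrite /h; case: ifP => // ht'.
  have -> : t = 1/2 by lra.
  have -> : 2 * (1/2) - 1 = 0 :> R by lra.
  by rewrite seg0; congr g; lra.
have It02 s : A s -> I01 (t0 * (2 * s)).
  by move: It0; rewrite /I01 /A /= => ? ?; apply/andP; split; nra.
have I2 s : B s -> I01 (2 * s - 1).
  by rewrite /I01 /B /= => ?; apply/andP; split; lra.
have Qh t : B t -> box x y c d (h t).
  by move=> Bt; rewrite -hB //; apply: seg_box => //; exact: I2.
have nQh t : A t -> t < 1/2 -> ~ box x y c d (h t).
  move=> At t2; rewrite -hA //; apply: before; first exact: It02.
  nra.
exists h; split.
- rewrite I01AB; apply: conU; try exact: closed_segment.
  + apply: (con_eq hA); apply: (con_comp _ cg It02).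
    by apply: conM; [exact: con_cst|apply: conM; [exact: con_cst|exact: con_id]].
  + apply: (con_eq hB); apply: con_seg; apply: conB; last exact: con_cst.
    by apply: conM; [exact: con_cst|exact: con_id].
- have injA s t : A s -> A t -> h s = h t -> s = t.
    move=> As At; rewrite -!hA // => /ig e.
    have := e (It02 s As) (It02 t At) => /(mulfI (lt0r_neq0 t0p)); lra.
  have injB s t : B s -> B t -> h s = h t -> s = t.
    move=> Bs Bt; rewrite -!hB // => /(seg_inj vz); lra.
  have mix s t : A s -> B t -> h s = h t -> s = t.
    move=> As Bt hst; case: (ltP s (1/2)) => hs.
      by exfalso; apply: (nQh s) => //; rewrite hst; exact: Qh.
    by apply: injB => //; move: As; rewrite /A /B /= => ?; apply/andP; split; lra.
  move=> s t; rewrite I01AB => -[As|Bs] [At|Bt]; [exact: injA|exact: mix| |exact: injB].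
  by move=> e; apply/esym; apply: mix.
- rewrite -hA; first by rewrite !mulr0.
  by rewrite /A /=; lra.
- rewrite -hB; last by rewrite /B /=; lra.
  by rewrite (_ : 2 * 1 - 1 = 1) ?seg1 //; lra.
- move=> t; rewrite I01AB => -[At|Bt]; last by apply: QO; exact: Qh.
  by rewrite -hA //; apply: gO; exact: It02.
Qed.

Lemma box_around O z : open O -> O z -> exists2 r, 0 < r &
  box (z.1 - r) (z.1 + r) (z.2 - r) (z.2 + r) `<=` O.
Proof.
move=> oO Oz; have [r r0 Hr] := closed_far (open_closedC oO) (fun h => h Oz).
exists (r / 2); first by rewrite divr_gt0.
move=> y [? ? ? ?]; apply: contrapT; apply: Hr; apply/ball_planeE.
by rewrite !ltr_norml; split; apply/andP; split; lra.
Qed.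

Lemma reach_near O a z : open O -> O a -> O z -> exists2 r, 0 < r &
  forall y y', ball z r y -> ball z r y' -> reach O a y -> reach O a y'.
Proof.
move=> oO Oa Oz; have [r r0 Hr] := box_around oO Oz; exists r => // y y'.
move=> /ball_planeE + /ball_planeE; rewrite !ltr_norml.
move=> [/andP[? ?] /andP[? ?]] [/andP[? ?] /andP[? ?]] h.
by apply: (reach_box Hr Oa _ h); split; lra.
Qed.

Lemma open_reach O a : open O -> O a -> open (reach O a).
Proof.
move=> oO Oa; rewrite openE => z rz; have [r r0 Hr] := reach_near oO Oa rz.1.
apply/nbhs_ballP; exists r => // y zy; exact: (Hr z y (ballxx z r0) zy rz).
Qed.

Lemma closed_reach K a : closed K -> ~ K a -> closed (reach (~` K) a `|` K).
Proof.
move=> cK nKa; have oO := closed_openC cK.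
apply: far_closed => z nz.
have nK : ~ K z by move=> h; apply: nz; right.
have [r r0 Hr] := reach_near oO nKa nK.
have [s s0 Hs] := closed_far cK nK.
exists (Num.min r s); first by rewrite lt_min r0.
move=> y yb [ry|Ky]; last by apply: (Hs y) => //; apply: le_ball yb; rewrite ge_min lexx orbT.
apply: nz; left; apply: (Hr y z) => //; last exact: ballxx.
by apply: le_ball yb; rewrite ge_min lexx.
Qed.

Lemma reach_seg O a y z : open O -> O a -> (forall t, I01 t -> O (seg y z t)) ->
  reach O a y -> reach O a z.
Proof.
move=> oO Oa Os; rewrite -{1}(seg0 y z) -{2}(seg1 y z).
apply: (@cousin _ (fun u v => reach O a (seg y z u) -> reach O a (seg y z v))) ler01 _ _.
- by move=> u v w _ _ _ _ h1 h2 /h1/h2.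
- move=> t It; have [r r0 Hr] := reach_near oO Oa (Os t It).
  have cs : con (@I01 R) (seg y z) by apply: con_seg; exact: con_id.
  have [d d0 Hd] := con_ball cs It r0; exists d => // u v h1 h2 h3 h4 h5.
  by apply: Hr; apply: Hd; rewrite /I01 /ball /= ?ltr_norml; apply/andP; split; lra.
Qed.

(** The outside of a square is covered by four half-planes, and consecutive ones share a corner
    beyond the square; segments through these corners link any two points. *)
Lemma reach_outside K M a y z : closed K -> K `<=` within_box M -> ~ K a -> 0 <= M ->
  ~ within_box M y -> ~ within_box M z -> reach (~` K) a y -> reach (~` K) a z.
Proof.
move=> cK KM nKa M0 ny nz.
have oO := closed_openC cK.
pose half (n : nat) (p : plane) := match n with
  0%N => M < p.1 | 1%N => M < p.2 | 2%N => p.1 < - M | _ => p.2 < - M end.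
have half_out n p : half n p -> ~ within_box M p.
  by move: n => [|[|[|n]]] /= h [? ? ? ?]; lra.
have out_half p : ~ within_box M p -> exists n, half n p.
  move=> np; apply: contrapT => h; apply: np; split; rewrite leNgt; apply/negP => h'; apply: h.
  - by exists 2%N.
  - by exists 0%N.
  - by exists 3%N.
  - by exists 1%N.
have half_seg n p p' t : half n p -> half n p' -> I01 t -> half n (seg p p' t).
  move=> h h' /andP[t0 t1].
  have conv (x u v : R) : x < u -> x < v -> x < u + t * (v - u).
    by move=> xu xv; case: (leP u v) => uv; nra.
  have conv' (x u v : R) : u < x -> v < x -> u + t * (v - u) < x.
    by move=> xu xv; case: (leP u v) => uv; nra.
  by move: n h h' => [|[|[|n]]] /= h h'; [exact: conv|exact: conv|exact: conv'|exact: conv'].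
have step n p p' : half n p -> half n p' -> reach (~` K) a p -> reach (~` K) a p'.
  move=> hp hp'; apply: reach_seg => // t It /KM; exact: (half_out _ _ (half_seg _ _ _ _ hp hp' It)).
pose N := M + 1.
pose corner (n : nat) : plane := match n with
  0%N => (N, N) | 1%N => (- N, N) | 2%N => (- N, - N) | _ => (N, - N) end.
have c01 : half 1%N (corner 0%N) /\ half 1%N (corner 1%N) by rewrite /= /N; lra.
have c12 : half 2%N (corner 1%N) /\ half 2%N (corner 2%N) by rewrite /= /N; lra.
have c23 : half 3%N (corner 2%N) /\ half 3%N (corner 3%N) by rewrite /= /N; lra.
have c30 : half 0%N (corner 3%N) /\ half 0%N (corner 0%N) by rewrite /= /N; lra.
have all_corners : reach (~` K) a (corner 0%N) -> forall n, half n z -> reach (~` K) a z.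
  move=> r0; have r1 := step _ _ _ c01.1 c01.2 r0; have r2 := step _ _ _ c12.1 c12.2 r1.
  move=> [|[|[|n]]] hz.
  - exact: (step 0%N _ _ c30.2 hz r0).
  - exact: (step 1%N _ _ c01.1 hz r0).
  - exact: (step 2%N _ _ c12.2 hz r2).
  - exact: (step 3%N _ _ c23.1 hz r2).
have [n hy] := out_half _ ny; have [n' hz] := out_half _ nz.
move=> ry; apply: (all_corners _ n' hz).
move: n hy => [|[|[|n]]] hy.
- exact: (step 0%N _ _ hy c30.2 ry).
- exact: (step 1%N _ _ hy c01.1 ry).
- exact: (step 1%N _ _ c01.2 c01.1 (step 2%N _ _ hy c12.1 ry)).
- exact: (step 0%N _ _ c30.1 c30.2 (step 3%N _ _ hy c23.2 ry)).
Qed.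

(* Points with the same class are in the same component of the complement:
   otherwise one of the two components is bounded by [K] alone. *)
Lemma same_class_reach K M a b : closed K -> K `<=` within_box M -> ~ K a -> ~ K b ->
  same_class K a b -> reach (~` K) a b.
Proof.
move=> cK KM0 nKa nKb ab; apply: contrapT => nr.
pose N := `|M|; have N0 : 0 <= N by exact: normr_ge0.
have KM : K `<=` within_box N.
  have MN : M <= N by exact: ler_norm.
  by move=> z /KM0; exact: (within_box_mono MN).
have oO := closed_openC cK.
have U1 := open_reach oO nKa; have U2 := closed_reach cK nKa.
have raa : reach (~` K) a a by split; [|left].
have contra (V : set plane) c d : same_class K c d -> open V -> closed (V `|` K) ->
    (forall z, V z -> ~ K z) -> V `<=` within_box N -> V c -> ~ V d -> ~ K d -> False.
  move=> cd oV cV dV VN Vc nVd nKd; suff : (1 : int) = 0 by [].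
  apply: (@index_zero _ K V c 1 [:: (d, -1)] N) => //; first by move=> z [/VN|/KM].
    by move=> p; rewrite inE => /eqP -> /= -[].
  apply: haslog_eq cd => z _; by rewrite /ratfun big_cons big_nil mulr1.
case: (pselect (exists2 y, reach (~` K) a y & ~ within_box N y)) => [[y ry ny]|nb].
  apply: (contra (~` (reach (~` K) a `|` K)) b a) => //.
  - exact: haslog_sym.
  - exact: closed_openC.
  - have -> : ~` (reach (~` K) a `|` K) `|` K = ~` reach (~` K) a.
      apply/seteqP; split => z; first by case=> [h rz|kz [h _]]; [apply: h; left|].
      by move=> nrz; case: (pselect (K z)) => kz; [right|left => -[|]].
    exact: open_closedC.
  - by move=> z h kz; apply: h; right.
  - move=> z h; apply: contrapT => nz; apply: h; left.
    exact: (reach_outside cK KM nKa N0 ny nz ry).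
  - by case.
  - by move=> h; apply: h; left.
apply: (contra (reach (~` K) a) a b) => //.
- by move=> z [].
- by move=> z rz; apply: contrapT => nz; apply: nb; exists z.
Qed.

(** Pigeonhole: bounded classes number at most [#|edges G|], and one more point may lie in the outer
    class; it is dropped before the count. *)
Lemma graph_same_class_pair (G : sgraph) (D : embedding R G) n (p : 'I_n -> plane) :
  (#|edges G| + 2 <= n)%N -> (forall x, ~ KE D (edges G) (p x)) ->
  exists x y, x != y /\ same_class (KE D (edges G)) (p x) (p y).
Proof.
case: n p => [|n] p; first by rewrite addn2.
rewrite addn2 ltnS => le nK.
case: (pselect (exists v : G, True)) => [[v _]|nv]; last first.
  have nK' z : ~ KE D (edges G) z.
    by move=> [e /imsetP[[x y] _ _] _]; apply: nv; exists x.
  case: n p nK le => // n p nK le.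
  exists ord0, ord_max; split => //.
  by exists (fun=> 0) => z /nK'.
have [src [tgt [gam P]]] := parametrization D v.
apply: contrapT => h.
have ne x y : x != y -> ~ same_class (KE D (edges G)) (p x) (p y).
  by move=> xy h'; apply: h; exists x, y.
have bound m (a : 'I_m -> plane) : (#|edges G| < m)%N -> ~ inequivalent D (edges G) a.
  by move=> lt /(inequivalent_card P); rewrite leqNgt lt.
case: (pselect (exists x, outer_class (KE D (edges G)) (p x))) => [[x zx]|nz].
  apply: (bound n (fun j => p (lift x j))) => //; split.
  - by move=> j.
  - by move=> j k jk; apply: ne; rewrite (inj_eq lift_inj).
  - move=> j zj; apply: (ne x (lift x j)); first exact: neq_lift.
    exact: haslogM zx (haslogV zj).
apply: (bound n.+1 p); first exact: leqW.
by split => // x zx; apply: nz; exists x.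
Qed.

Lemma closed_bounded_graph (G : sgraph) (D : embedding R G) :
  closed (KE D (edges G)) /\ exists M, KE D (edges G) `<=` within_box M.
Proof.
case: (pselect (exists v : G, True)) => [[v _]|nv].
  have [src [tgt [gam P]]] := parametrization D v.
  by split; [exact: closed_KE P|exact: bounded_KE P].
have -> : KE D (edges G) = set0.
  by apply/seteqP; split => z // [e /imsetP[[x y] _ _] _]; exfalso; apply: nv; exists x.
by split; [exact: closed0|exists 0].
Qed.

End Reach.

(** * Adding an edge to a drawing *)
Section AddEdge.
Variables (R : realType) (H : plane_graph R) (d : nat).
Notation plane := (R * R)%type.
Notation D := (drawing H).
Notation K := (KE D (edges H)).
Notation T := (vertex H + 'I_d)%type.
Variables (pT : T -> plane) (s1 s2 : T) (g : R -> plane).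
Hypotheses (pT_inj : injective pT) (pT_old : forall v : H, pT (inl v) = pos D v).
Hypothesis pT_new : forall x, ~ K (pT (inr x)).
Hypotheses (s12 : s1 != s2) (slot1 : ~ K (pT s1)) (slot2 : ~ K (pT s2)).
Hypothesis arcg : arc_in (~` K) (pT s1) (pT s2) g.
Hypothesis avoid : forall t w, I01 t -> ~ K (pT w) -> g t = pT w -> w = s1 \/ w = s2.

Lemma is_arc_ends (A : set plane) p q : is_arc A p q -> A p /\ A q.
Proof.
move=> [h [_ _ h0 h1 ->]]; split; [exists 0|exists 1] => //;
by rewrite /= in_itv /= ?lexx ?ler01.
Qed.

Lemma adj_edge (G : sgraph) (x y : G) : adj x y -> [set x; y]%SET \in edges G.
Proof. by move=> xy; apply/imsetP; exists (x, y). Qed.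

Lemma adj_K (x y : H) : adj x y -> K (pos D x) /\ K (pos D y).
Proof.
move=> xy; have [h1 h2] := is_arc_ends (curve_arc D xy).
by split; exists [set x; y]%SET => //; exact: adj_edge.
Qed.

(** Spare points become vertices only as ends of the new edge, since [adds_edge] allows no other new
    vertices. *)
Definition in_new (t : T) := (if t is inl _ then true else false) || (t == s1) || (t == s2).

Definition old_adj (t t' : T) := match t, t' with inl x, inl y => adj x y | _, _ => false end.

Definition new_pair (t t' : T) := ((t == s1) && (t' == s2)) || ((t == s2) && (t' == s1)).

Definition newV : finType := {t : T | in_new t}.

Definition adj' (u v : newV) := old_adj (val u) (val v) || new_pair (val u) (val v).

Lemma adj'_sym : symmetric adj'.
Proof.
move=> u v; rewrite /adj' /new_pair orbC [X in _ = _ || X]orbC orbC.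
by congr (_ || _); [case: (val u) (val v) => [x|x] [y|y] //=; exact: adj_sym|rewrite andbC [X in _ || X]andbC].
Qed.

Lemma adj'_irr : irreflexive adj'.
Proof.
move=> u; rewrite /adj' /new_pair; case: (val u) => [x|x] /=; rewrite ?adj_irr /=.
  by case: eqP => [->|_] /=; rewrite ?(negPf s12) ?andbF.
by case: eqP => [->|_] /=; rewrite ?(negPf s12) ?andbF.
Qed.

Definition newG : sgraph := SGraph adj'_sym adj'_irr.

Definition old (v : H) : newG := Sub (inl v) isT.

Lemma in1 : in_new s1. Proof. by rewrite /in_new eqxx orbT. Qed.
Lemma in2 : in_new s2. Proof. by rewrite /in_new eqxx !orbT. Qed.

Definition end1 : newG := Sub s1 in1.
Definition end2 : newG := Sub s2 in2.

Lemma old_inj : injective old.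
Proof. by move=> x y /(congr1 val) /= []. Qed.

Lemma ends_neq : end1 != end2.
Proof. by rewrite -val_eqE /=. Qed.

Lemma newG_cover (z : newG) : [\/ exists x, z = old x, z = end1 | z = end2].
Proof.
case: z => t ht; have := ht; rewrite /in_new => /orP[/orP[|/eqP ts]|/eqP ts].
- by case: t ht => // v ht _; apply: Or31; exists v; apply: val_inj.
- by apply: Or32; apply: val_inj.
- by apply: Or33; apply: val_inj.
Qed.

Lemma adj'P (u v : newG) : adj u v ->
  (exists x y, [/\ u = old x, v = old y & adj x y]) \/
  (u = end1 /\ v = end2) \/ (u = end2 /\ v = end1).
Proof.
rewrite /= /adj' => /orP[|/orP[/andP[/eqP h1 /eqP h2]|/andP[/eqP h1 /eqP h2]]].
- case: u v => [[x|x] hx] [[y|y] hy] //= xy; left; exists x, y.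
  by split => //; apply: val_inj.
- by right; left; split; apply: val_inj.
- by right; right; split; apply: val_inj.
Qed.

Lemma old_new_edge (x y : H) : adj x y -> [set old x; old y]%SET <> [set end1; end2]%SET.
Proof.
move=> xy e; have : end1 \in [set old x; old y]%SET by rewrite e !inE eqxx.
have [kx ky] := adj_K xy.
by rewrite !inE -!val_eqE /= => /orP[] /eqP h; apply: slot1; rewrite h pT_old.
Qed.

Lemma edges_newG : edges newG = ([set end1; end2] |: [set old @: e | e : {set H} in edges H])%SET.
Proof.
apply/setP => e; rewrite !inE; apply/idP/idP.
  move=> /imsetP[[u v]]; rewrite inE /= => uv ->.
  have [[x [y [-> -> xy]]]|[[-> ->]|[-> ->]]] := adj'P uv.
  - apply/orP; right; apply/imsetP; exists [set x; y]%SET; first exact: adj_edge.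
    by rewrite imsetU1 imset_set1.
  - by rewrite eqxx.
  - by rewrite [[set end2; end1]%SET]finset.setUC eqxx.
move=> /orP[/eqP ->|/imsetP[e0 /imsetP[[x y]]]].
  by apply: (@adj_edge newG); rewrite /= /adj' /new_pair /= !eqxx orbT.
rewrite inE /= => xy -> ->; rewrite imsetU1 imset_set1.
by apply: (@adj_edge newG); rewrite /= /adj' /= xy.
Qed.

Lemma newG_edgeP (e : {set newG}) : e \in edges newG ->
  e = [set end1; end2]%SET \/ exists x y, [/\ adj x y, e = [set old x; old y]%SET & old @^-1: e = [set x; y]%SET].
Proof.
rewrite edges_newG !inE => /orP[/eqP|/imsetP[e0 /imsetP[[x y]]]]; first by left.
rewrite inE /= => xy -> ->; right; exists x, y; split => //.
  by rewrite imsetU1 imset_set1.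
by apply/setP => v; rewrite inE mem_imset //; exact: old_inj.
Qed.

Definition newpos (z : newG) : plane := pT (val z).

Definition newcurve (e : {set newG}) : set plane :=
  if e == [set end1; end2]%SET then g @` @I01 R else curve D (old @^-1: e).

Lemma newcurve_old (x y : H) : adj x y ->
  newcurve [set old x; old y]%SET = curve D [set x; y]%SET.
Proof.
move=> xy; rewrite /newcurve; case: eqP => [/(old_new_edge xy)//|_].
congr (curve D _); apply/setP => v; rewrite !inE.
by rewrite !(inj_eq old_inj).
Qed.

Lemma is_arc_sym (A : set plane) p q : is_arc A p q -> is_arc A q p.
Proof.
move=> [h [ch ih h0 h1 ->]].
have rI t : I01 t -> I01 (1 - t :> R) by rewrite /I01 /= => ?; apply/andP; split; lra.
exists (fun t => h (1 - t)); split.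
- apply/conP; rewrite -I01E.
  have ch' : con (@I01 R) h by rewrite I01E; apply/conP.
  apply: (con_comp _ ch' rI); apply: conB; [exact: con_cst|exact: con_id].
- move=> s t; rewrite !in_itv /= => hs ht e.
  have : 1 - s = 1 - t by apply: ih => //; rewrite in_itv /=; apply/andP; split; lra.
  lra.
- by rewrite subr0.
- by rewrite subrr.
- rewrite -I01E; apply/seteqP; split => _ [t It <-]; exists (1 - t); try exact: rI.
    by rewrite /= subKr.
  by [].
Qed.

Lemma newarc : is_arc (g @` @I01 R) (pT s1) (pT s2).
Proof.
have [cg ig g0 g1 _] := arcg; exists g; split; [| |exact: g0|exact: g1|].
- by apply/conP; rewrite -I01E.
- by move=> s t; rewrite !in_itv /= => Is It; exact: ig.
- by rewrite -I01E.
Qed.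

Lemma newcurve_arc (x y : newG) : adj x y ->
  is_arc (newcurve [set x; y]%SET) (newpos x) (newpos y).
Proof.
move=> /adj'P[[a [b [-> -> ab]]]|[[-> ->]|[-> ->]]].
- by rewrite newcurve_old // /newpos /= !pT_old; exact: curve_arc.
- by rewrite /newcurve eqxx; exact: newarc.
- by rewrite finset.setUC /newcurve eqxx; apply: is_arc_sym; exact: newarc.
Qed.

Lemma curve_K (x y : H) z : adj x y -> curve D [set x; y]%SET z -> K z.
Proof. by move=> xy; exists [set x; y]%SET => //; exact: adj_edge. Qed.

Lemma newcurve_vertex e z : e \in edges newG -> newcurve e (newpos z) -> z \in e.
Proof.
move=> /newG_edgeP[->|[x [y [xy -> _]]]].
  rewrite /newcurve eqxx => -[t It gt]; have [_ _ _ _ gK] := arcg.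
  have nK : ~ K (pT (val z)) by rewrite -[pT _]gt; exact: gK.
  by have [h|h] := avoid It nK gt; rewrite !inE -!val_eqE /= h eqxx ?orbT.
rewrite newcurve_old // /newpos => cz.
case: (newG_cover z) cz => [[v ->]|->|->] /=.
- rewrite pT_old => /(curve_vertex (adj_edge xy)).
  by rewrite !inE !(inj_eq old_inj).
- by move=> /(curve_K xy)/slot1.
- by move=> /(curve_K xy)/slot2.
Qed.

Lemma newcurve_cross e f p : e \in edges newG -> f \in edges newG -> e <> f ->
  newcurve e p -> newcurve f p -> exists2 z, z \in e :&: f & p = newpos z.
Proof.
have new_old x y : adj x y -> newcurve [set end1; end2]%SET p -> newcurve [set old x; old y]%SET p -> False.
  move=> xy; rewrite newcurve_old // /newcurve eqxx => -[t It <-] /(curve_K xy).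
  by have [_ _ _ _ gK] := arcg; exact: gK.
move=> /newG_edgeP[->|[x [y [xy -> _]]]] /newG_edgeP[->|[x' [y' [xy' -> _]]]] // ne.
- by move=> h1 h2; case: (new_old _ _ xy' h1 h2).
- by move=> h1 h2; case: (new_old _ _ xy h2 h1).
rewrite !newcurve_old // => h1 h2.
have ne' : [set x; y]%SET <> [set x'; y']%SET.
  move=> h; apply: ne; have := congr1 (fun A : {set H} => old @: A) h.
  by rewrite !imsetU1 !imset_set1.
have [v vv ->] := curve_cross (adj_edge xy) (adj_edge xy') ne' h1 h2.
exists (old v); last by rewrite /newpos /= pT_old.
by move: vv; rewrite !inE !(inj_eq old_inj).
Qed.

Lemma newpos_inj : injective newpos.
Proof. by move=> x y /pT_inj/val_inj. Qed.

Definition newH : plane_graph R := PlaneGraph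
  (Embedding newpos_inj newcurve_arc newcurve_vertex newcurve_cross).

Lemma adds_newH : adds_edge H newH.
Proof.
exists old, end1, end2; split.
- exact: old_inj.
- exact: newG_cover.
- rewrite ends_neq /=; apply/negP => /imsetP[e0 /imsetP[[x y]]].
  rewrite inE /= => xy -> e; apply: (old_new_edge xy).
  by rewrite e imsetU1 imset_set1.
- exact: edges_newG.
- split=> [x|e /imsetP[[x y]]]; first exact: pT_old.
  by rewrite inE /= => xy ->; rewrite imsetU1 imset_set1; exact: newcurve_old.
Qed.

Lemma newH_subgraph (G : sgraph) (F : T -> G) : injective F ->
  (forall x y : H, adj x y -> adj (F (inl x)) (F (inl y))) ->
  adj (F s1) (F s2) -> is_subgraph newH G.
Proof.
move=> Finj Fadj F12; exists (fun z : newH => F (val z)).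
  by move=> x y /Finj/val_inj.
move=> x y /adj'P[[a [b [-> -> ab]]]|[[-> ->]|[-> ->]]] /=.
- exact: Fadj.
- by [].
- by rewrite adj_sym.
Qed.

End AddEdge.

Lemma extend_injection (T U : finType) (A : {set T}) (f : T -> U) :
  (#|T| <= #|U|)%N -> {in A &, injective f} ->
  exists2 F : T -> U, injective F & {in A, F =1 f}.
Proof.
move=> TU fA; pose C := ~: (f @: A).
have le : (#|~: A| <= #|C|)%N.
  by rewrite -(leq_add2l #|A|) cardsC -(card_in_imset fA) cardsC.
pose F t := if t \in A then f t else nth (f t) (enum C) (index t (enum (~: A))).
have idx t : t \notin A -> (index t (enum (~: A)) < size (enum C))%N.
  move=> tA; rewrite -cardE; apply: leq_trans le.
  by rewrite cardE index_mem mem_enum inE.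
have FC t : t \notin A -> F t \in C.
  by move=> tA; rewrite /F (negPf tA) -mem_enum; apply: mem_nth; exact: idx.
have Ff t : t \in A -> F t = f t by rewrite /F => ->.
exists F => // x y; case: (boolP (x \in A)) (boolP (y \in A)) => xA [] yA.
- by rewrite !Ff //; exact: fA.
- move=> e; have := FC y yA; rewrite -e Ff // inE => /negP[]; exact: imset_f.
- move=> e; have := FC x xA; rewrite e Ff // inE => /negP[]; exact: imset_f.
rewrite /F (negPf xA) (negPf yA) (set_nth_default (f x)) ?idx //.
move=> /eqP; rewrite nth_uniq ?idx ?enum_uniq // => /eqP e.
have mem z : z \notin A -> z \in enum (~: A) by move=> zA; rewrite mem_enum inE.
by rewrite -(nth_index x (mem x xA)) e nth_index // mem.
Qed.

(** * Saturation makes the uncovered vertices independent *)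

Section Saturation.
Variables (R : realType) (H : plane_graph R) (G : sgraph).
Notation plane := (R * R)%type.
Hypothesis sat : plane_saturated H G.

(* Isolated vertices are left out because they may be mapped anywhere. *)
Definition core (H : sgraph) : {set H} := [set x | [exists y, adj x y]]%SET.

Definition core_emb (H G : sgraph) (f : H -> G) :=
  {in core H &, injective f} /\ forall x y, adj x y -> adj (f x) (f y).

Lemma card_core (H' : sgraph) : (#|core H'| <= 2 * #|edges H'|)%N.
Proof.
have sub : core H' \subset finset.cover (edges H').
  apply/fintype.subsetP => x; rewrite inE => /existsP[y xy].
  by apply/finset.bigcupP; exists [set x; y]%SET; rewrite ?adj_edge // !inE eqxx.
apply: leq_trans (subset_leq_card sub) _.
apply: leq_trans (leq_card_cover _).1 _.
rewrite mulnC -sum_nat_const; apply: leq_sum => e /imsetP[[x y] _ ->] /=.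
by rewrite cards2; case: (_ != _).
Qed.

(** Let [m = #|edges H|]. Spare points bring the number of vertices up to [#|G|]; at most [2 m] of
    them lie on edges, so at least [m + 2] are off the drawn edges and two of these share a face. An
    arc joining them would realise an uncovered edge of [G], against saturation. *)
Lemma saturated_independent : (3 * #|edges H| + 2 <= #|G|)%N ->
  forall f : H -> G, core_emb f -> forall x y, x \notin f @: core H -> y \notin f @: core H ->
  ~~ adj x y.
Proof.
move=> big f [finj fadj] x y nx ny; apply/negP => xy.
have [[h hinj hadj] nosub] := sat.
have HG : (#|H| <= #|G|)%N by exact: leq_card hinj.
pose d := (#|G| - #|H|)%N.
pose T : finType := (H + 'I_d)%type.
pose K := KE (drawing H) (edges H).
have cardT : #|T| = #|G| by rewrite card_sum card_ord subnKC.
have [cK [M0 KM0]] := closed_bounded_graph (drawing H).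
have [N0 HN0] : exists N0, forall v : H, within_box N0 (pos (drawing H) v).
  apply: bounded_finite => [v M N hv MN|v]; first exact: (within_box_mono MN hv).
  exact: within_box_ex.
pose M := `|M0| + `|N0|.
have MM0 : M0 <= M by have := ler_norm M0; have := normr_ge0 N0; rewrite /M; lra.
have MN0 : N0 <= M by have := ler_norm N0; have := normr_ge0 M0; rewrite /M; lra.
(* The spare vertices sit to the right of a box holding all vertices and edges of the drawing. *)
pose pT (t : T) : plane := match t with
  inl v => pos (drawing H) v | inr k => (M + 1 + (val k)%:R, 0) end.
have far (k : 'I_d) : M < (pT (inr k)).1.
  by rewrite /=; have := ler0n R (val k); lra.
have pT_inj : injective pT.
  move=> [v|k] [v'|k'] e.
  - by congr inl; exact: pos_inj e.
  - exfalso; have := far k'; rewrite -e /=; have [_ ? _ _] := HN0 v; lra.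
  - exfalso; have := far k; rewrite e /=; have [_ ? _ _] := HN0 v'; lra.
  - congr inr; apply: val_inj; case: e => /addrI/eqP.
    by rewrite eqr_nat => /eqP.
have pT_new (k : 'I_d) : ~ K (pT (inr k)).
  by move=> /KM0[_ h1 _ _]; have := far k; lra.
pose slots := [set t : T | `[< ~ K (pT t) >]]%SET.
have slotP t : reflect (~ K (pT t)) (t \in slots) by rewrite inE; exact: asboolP.
have nonslot t : t \notin slots -> exists2 v, t = inl v & v \in core H.
  move=> /slotP/contrapT; case: t => [v|k]; last by move=> /pT_new.
  move=> [e eH ev]; exists v => //.
  have ve := curve_vertex eH ev; move: eH ve => /imsetP[[a b]].
  rewrite inE /= => ab ->; rewrite !inE => /orP[] /eqP ->; apply/existsP; first by exists b.
  by exists a; rewrite adj_sym.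
have coreK v : v \in core H -> K (pT (inl v)).
  by rewrite inE => /existsP[w vw]; have [] := adj_K vw.
have card_slots : (#|edges H| + 2 <= #|slots|)%N.
  have : (#|~: slots| <= #|core H|)%N.
    have sub : ~: slots \subset inl @: core H.
      by apply/fintype.subsetP => t; rewrite inE => /nonslot[v -> vc]; exact: imset_f.
    exact: leq_trans (subset_leq_card sub) (leq_imset_card _ _).
  have := cardsC slots; have := card_core H.
  rewrite cardT; lia.
pose p (k : 'I_#|slots|) := pT (enum_val k).
have pK k : ~ K (p k) by apply/slotP; exact: enum_valP.
have [k1 [k2 [k12 eq12]]] := graph_same_class_pair card_slots pK.
pose s1 := enum_val k1; pose s2 := enum_val k2.
have s12 : s1 != s2 by rewrite (inj_eq enum_val_inj).
have [_ [e12|[g arcg]]] := same_class_reach cK KM0 (pK k1) (pK k2) eq12.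
  by move: s12; rewrite /s1 /s2 (pT_inj _ _ e12) eqxx.
have /choice[tau Htau] : forall w : T, exists t, (exists2 t, I01 t & g t = pT w) -> I01 t /\ g t = pT w.
  move=> w; case: (pselect (exists2 t, I01 t & g t = pT w)) => [[t It gt]|n]; last by exists 0.
  by exists t.
have [cg ig g0 g1 gK] := arcg.
have I0 : I01 (0 : R) by rewrite /I01 /= lexx ler01.
have I1 : I01 (1 : R) by rewrite /I01 /= lexx ler01.
(* The arc may run through further isolated vertices, so it is cut at the first one it meets after
   [s1]. *)
pose S := [set w in slots | (w != s1) && `[< exists2 t, I01 t & g t = pT w >]]%SET.
have S2 : s2 \in S.
  rewrite inE; apply/and3P; split; [exact: enum_valP|by rewrite eq_sym|].
  by apply/asboolP; exists 1.
case: (@arg_minP _ R T s2 [pred w | w \in S] tau S2) => s3 /= S3 min3.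
have {S3}[sl3 [s13 [t3 [I3 g3 t3e]]]] : s3 \in slots /\ s3 != s1 /\
    exists t3, [/\ I01 t3, g t3 = pT s3 & tau s3 = t3].
  move: S3; rewrite inE => /and3P[h1 h2 /asboolP h3]; split => //; split => //.
  by exists (tau s3); have [] := Htau s3 h3.
have t30 : 0 < t3.
  move: (I3) => /andP[t3ge _]; rewrite lt_neqAle t3ge andbT; apply/eqP => e.
  by move: s13; rewrite -(inj_eq pT_inj) -g3 -e g0 eqxx.
have arc3 := arc_cut arcg I3 t30; rewrite g3 in arc3.
have avoid t w : I01 t -> ~ K (pT w) -> g (t3 * t) = pT w -> w = s1 \/ w = s3.
  move=> It nK gw; case: (eqVneq w s1) => ws; [by left|right].
  have It3 : I01 (t3 * t).
    by move: I3 It; rewrite /I01 /= => ? ?; apply/andP; split; nra.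
  have wS : w \in S.
    rewrite inE ws; apply/and3P; split => //; first exact/slotP.
    by apply/asboolP; exists (t3 * t).
  have := min3 w wS; rewrite t3e.
  have [|Iw gtw] := Htau w; first by exists (t3 * t).
  have -> : tau w = t3 * t by apply: ig => //; rewrite gtw.
  rewrite -[X in X <= _]mulr1 ler_pM2l // => t1.
  have {}t1 : t = 1 by move: It; rewrite /I01 /= => ?; lra.
  by apply: pT_inj; rewrite -gw t1 mulr1.
have slot1 : ~ K (pT s1) by exact: pK.
have slot3 : ~ K (pT s3) by exact/slotP.
have s13' : s1 != s3 by rewrite eq_sym.
apply: (nosub _ (adds_newH pT_inj (fun v => erefl) s13' slot1 slot3 arc3 avoid)).
pose A : {set T} := (s1 |: (s3 |: inl @: core H))%SET.
(* [f] is injective only on the core; all other vertices are placed anew by [extend_injection],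
   which has room because [#|T| = #|G|]. *)
pose f0 (t : T) := if t == s1 then x else if t == s3 then y else if t is inl v then f v else x.
have core_ne v s : v \in core H -> ~ K (pT s) -> (inl v == s :> T) = false.
  by move=> vc nK; apply/eqP => e; apply: nK; rewrite -e; exact: coreK.
have f0v v : v \in core H -> f0 (inl v) = f v.
  by move=> vc; rewrite /f0 !core_ne.
have f01 : f0 s1 = x by rewrite /f0 eqxx.
have f03 : f0 s3 = y by rewrite /f0 eqxx (negPf s13).
have xney : x != y by apply/eqP => e; rewrite e adj_irr in xy.
have nfx v : v \in core H -> (f v == x) = false.
  by move=> vc; apply/eqP => e; move/negP: nx; apply; rewrite -e imset_f.
have nfy v : v \in core H -> (f v == y) = false.
  by move=> vc; apply/eqP => e; move/negP: ny; apply; rewrite -e imset_f.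
have inj0 : {in A &, injective f0}.
  move=> t t'; rewrite !inE => /or3P[/eqP ->|/eqP ->|/imsetP[v vc ->]]
    /or3P[/eqP ->|/eqP ->|/imsetP[v' vc' ->]] //; rewrite ?f01 ?f03 ?f0v // => /eqP.
  - by rewrite (negPf xney).
  - by rewrite eq_sym nfx.
  - by rewrite eq_sym (negPf xney).
  - by rewrite eq_sym nfy.
  - by rewrite nfx.
  - by rewrite nfy.
  - by move=> /eqP /finj -> .
have leT : (#|T| <= #|G|)%N by rewrite cardT.
have [F Finj FA] := extend_injection leT inj0.
apply: (newH_subgraph pT_inj (fun v => erefl) s13' slot1 slot3 arc3 avoid Finj).
- move=> a b ab.
  have ca : a \in core H by rewrite inE; apply/existsP; exists b.
  have cb : b \in core H by rewrite inE; apply/existsP; exists a; rewrite adj_sym.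
  by rewrite !FA ?f0v ?fadj // !inE imset_f ?orbT.
- by rewrite !FA ?f01 ?f03 // !inE eqxx ?orbT.
Qed.

End Saturation.

(** * Edges of a twin-free planar graph *)
Section BipartiteEdges.
Variable G : sgraph.
Implicit Types (F : {set {set G}}) (Q S X : {set G}).

Definition incident F (v : G) : {set {set G}} := [set e in F | v \in e]%SET.

Lemma no_leaf_incident F v e : ~ has_leaf F -> e \in F -> v \in e -> (2 <= #|incident F v|)%N.
Proof.
move=> nl eF ve; rewrite ltnNge; apply/negP => le1; apply: nl; exists v; first by exists e.
move=> e1 e2 e1F e2F v1 v2; move/card_le1_eqP: le1; apply; by rewrite inE ?e1F ?e2F.
Qed.

Lemma no_leaf_other F v e : ~ has_leaf F -> e \in F -> v \in e ->
  exists e', [/\ e' \in F, v \in e' & e' != e].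
Proof.
move=> nl eF ve; have := no_leaf_incident nl eF ve.
rewrite (cardsD1 e) inE eF ve ltnS card_gt0 => /set0Pn[e'].
by rewrite !inE => /and3P[? ? ?]; exists e'.
Qed.

Lemma edge_other (e : {set G}) x : e \in edges G -> x \in e ->
  exists2 y, adj x y & e = [set x; y]%SET.
Proof.
move=> /imsetP[[a b]]; rewrite inE /= => ab ->; rewrite !inE => /orP[]/eqP ->.
  by exists b.
by exists a; [rewrite adj_sym|rewrite finset.setUC].
Qed.

Lemma set2_inj (x y z : G) : [set x; y]%SET = [set x; z]%SET -> y = z.
Proof.
move=> e; have : y \in [set x; z]%SET by rewrite -e !inE eqxx orbT.
have : z \in [set x; y]%SET by rewrite e !inE eqxx orbT.
by rewrite !inE => /orP[]/eqP -> // /orP[]/eqP ->.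
Qed.

Lemma girth3 F : F \subset edges G -> F != finset.set0 -> (#|F| < 3)%N -> has_leaf F.
Proof.
move=> FE /set0Pn[e eF] lt; apply: contrapT => nl; move: lt; rewrite ltnNge => /negP; apply.
have [x xe] : exists x, x \in e.
  have /imsetP[[a b] _ ->] := fintype.subsetP FE _ eF.
  by exists a; rewrite !inE eqxx.
have [y xy ey] := edge_other (fintype.subsetP FE _ eF) xe.
have [e1 [e1F xe1 ne1]] := no_leaf_other nl eF xe.
have [z xz e1z] := edge_other (fintype.subsetP FE _ e1F) xe1.
have ze1 : z \in e1 by rewrite e1z !inE eqxx orbT.
have [e2 [e2F ze2 ne2]] := no_leaf_other nl e1F ze1.
have zy : z != y by apply: contra_neq ne1 => h; rewrite e1z ey h.
have zx : z != x by apply: contraTneq xz => ->; rewrite adj_irr.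
apply/card_gt2P; exists e, e1, e2; split => //; split; [by rewrite eq_sym|by rewrite eq_sym|].
by apply: contraTneq ze2 => ->; rewrite ey !inE (negPf zx) (negPf zy).
Qed.

Definition between Q S : {set {set G}} :=
  [set [set p.1; p.2]%SET | p in [pred p : G * G | [&& p.1 \in Q, p.2 \in S & adj p.1 p.2]]]%SET.

Lemma between_edges Q S : between Q S \subset edges G.
Proof.
apply/fintype.subsetP => e /imsetP[[x y]]; rewrite inE /= => /and3P[_ _ xy] ->.
exact: adj_edge.
Qed.

Lemma between_sub Q S e : e \in between Q S -> e \subset Q :|: S.
Proof.
move=> /imsetP[[x y]]; rewrite inE /= => /and3P[xQ yS _] ->.
by apply/fintype.subsetP => z; rewrite !inE => /orP[]/eqP ->; rewrite ?xQ ?yS ?orbT.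
Qed.

Section Disjoint.
Variables Q S : {set G}.
Hypothesis QS : forall x, x \in Q -> x \notin S.

Lemma between_left e x : e \in between Q S -> x \in e -> x \in Q ->
  exists y, [/\ y \in S, adj x y & e = [set x; y]%SET].
Proof.
move=> /imsetP[[a b]]; rewrite inE /= => /and3P[aQ bS ab] ->.
rewrite !inE => /orP[]/eqP -> xQ; first by exists b.
by have := QS xQ; rewrite bS.
Qed.

Lemma between_right e y : e \in between Q S -> y \in e -> y \in S ->
  exists x, [/\ x \in Q, adj x y & e = [set x; y]%SET].
Proof.
move=> /imsetP[[a b]]; rewrite inE /= => /and3P[aQ bS ab] ->.
rewrite !inE => /orP[]/eqP -> yS; last by exists a.
by have := QS aQ; rewrite yS.
Qed.

Lemma sum_incident F : F \subset between Q S -> (\sum_(x in Q) #|incident F x| <= #|F|)%N.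
Proof.
move=> FB.
have -> : (\sum_(x in Q) #|incident F x| = \sum_(e in F) #|[set x in Q | x \in e]%SET|)%N.
  under eq_bigr do rewrite -sum1_card; under [RHS]eq_bigr do rewrite -sum1_card.
  rewrite (exchange_big_dep (mem F)) /=; last by move=> x e _; rewrite inE => /andP[].
  by apply: eq_bigr => e eF; apply: eq_bigl => x; rewrite !inE eF.
rewrite -sum1_card; apply: leq_sum => e eF.
apply/card_le1_eqP => x x'; rewrite !inE => /andP[xQ xe] /andP[xQ' xe'].
have [y [yS _ ey]] := between_left (fintype.subsetP FB _ eF) xe xQ.
move: xe'; rewrite ey !inE => /orP[]/eqP // xy.
by have := QS xQ'; rewrite xy yS.
Qed.

Lemma sum_between : (\sum_(x in Q) #|nbhd x :&: S| <= #|between Q S|)%N.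
Proof.
apply: leq_trans (sum_incident (fintype.subxx _)); apply: leq_sum => x xQ.
have inj : {in nbhd x :&: S &, injective (fun y => [set x; y]%SET)}.
  by move=> y z _ _; exact: set2_inj.
rewrite -(card_in_imset inj); apply: subset_leq_card; apply/fintype.subsetP => e /imsetP[y].
rewrite !inE => /andP[xy yS] ->; apply/andP; split; last by rewrite !inE eqxx.
by apply/imsetP; exists (x, y); rewrite // inE /= xQ yS.
Qed.

Section NoLeaf.
Variable F : {set {set G}}.
Hypotheses (FB : F \subset between Q S) (F0 : F != finset.set0) (nl : ~ has_leaf F).

Lemma start_path : exists x y z, [/\ x \in Q, y \in S, z \in S, z != y &
  [set x; y]%SET \in F /\ [set x; z]%SET \in F].
Proof.
have /set0Pn[e eF] := F0.
have /imsetP[[x y0]] := fintype.subsetP FB _ eF; rewrite inE /= => /and3P[xQ y0S xy0] ey0.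
have xe : x \in e by rewrite ey0 !inE eqxx.
have [e' [e'F xe' ne]] := no_leaf_other nl eF xe.
have [z [zS _ e'z]] := between_left (fintype.subsetP FB _ e'F) xe' xQ.
exists x, y0, z; split => //; last by rewrite -ey0 -e'z.
by apply: contra_neq ne => h; rewrite e'z h ey0.
Qed.

Lemma extend_path x y : x \in Q -> y \in S -> [set x; y]%SET \in F ->
  exists w, [/\ w \in Q, w != x & [set w; y]%SET \in F].
Proof.
move=> xQ yS eF; have ye : y \in [set x; y]%SET by rewrite !inE eqxx orbT.
have [e' [e'F ye' ne]] := no_leaf_other nl eF ye.
have [w [wQ _ e'w]] := between_right (fintype.subsetP FB _ e'F) ye' yS.
exists w; split => //; last by rewrite -e'w.
by apply: contra_neq ne => h; rewrite e'w h.
Qed.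

Lemma incident2 x y : [set x; y]%SET \in F -> (2 <= #|incident F x|)%N.
Proof. by move=> eF; apply: (no_leaf_incident nl eF); rewrite !inE eqxx. Qed.

(** A path [y x z w] exhibits two vertices [x] and [w] of [Q], each on two edges of [F], and no edge
    has both its ends in [Q]. *)
Lemma no_leaf_card4 : (4 <= #|F|)%N.
Proof.
have [x [y [z [xQ yS zS zy [xyF xzF]]]]] := start_path.
have [w [wQ wx wzF]] := extend_path xQ zS xzF.
apply: leq_trans (sum_incident FB).
rewrite (bigD1 x) //= (bigD1 w) /=; last by rewrite wQ.
apply: (@leq_add 2 2); first exact: incident2 xyF.
by apply: leq_trans (leq_addr _ _); exact: incident2 wzF.
Qed.

Lemma F_adj x y : x \in Q -> [set x; y]%SET \in F -> y \in nbhd x :&: S.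
Proof.
move=> xQ eF; have xe : x \in [set x; y]%SET by rewrite !inE eqxx.
have [y' [y'S xy' /set2_inj ->]] := between_left (fintype.subsetP FB _ eF) xe xQ.
by rewrite !inE xy'.
Qed.

(** The path [y x z w] is continued beyond [y] by a vertex [u] of [Q]. If [u] were [w], then [x] and
    [w] would have the same two neighbours in [S]; so three vertices of [Q] lie on two edges
    each. *)
Lemma no_leaf_card6 : (forall x, x \in Q -> #|nbhd x :&: S| = 2) ->
  (forall x x', x \in Q -> x' \in Q -> nbhd x :&: S = nbhd x' :&: S -> x = x') ->
  (6 <= #|F|)%N.
Proof.
move=> two uniqN; have [x [y [z [xQ yS zS zy [xyF xzF]]]]] := start_path.
have [w [wQ wx wzF]] := extend_path xQ zS xzF.
have [u [uQ ux uyF]] := extend_path xQ yS xyF.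
have pairE v : v \in Q -> [set v; y]%SET \in F -> [set v; z]%SET \in F ->
    nbhd v :&: S = [set y; z]%SET.
  move=> vQ vy vz; apply/esym/eqP; rewrite eqEcard two // cards2 eq_sym zy andbT.
  by apply/fintype.subsetP => a /set2P[] ->; exact: F_adj.
have uw : u != w.
  apply/eqP => uw; move/eqP: wx; apply; apply: uniqN => //.
  by rewrite !pairE // -uw.
apply: leq_trans (sum_incident FB).
rewrite (bigD1 x) //= (bigD1 w) /=; last by rewrite wQ.
rewrite (bigD1 u) /=; last by rewrite uQ ux.
apply: (@leq_add 2 4); first exact: incident2 xyF.
apply: (@leq_add 2 2); first exact: incident2 wzF.
by apply: leq_trans (leq_addr _ _); exact: incident2 uyF.
Qed.

End NoLeaf.

Lemma card_between4 (R : realType) (D : embedding R G) :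
  (#|between Q S| <= 2 * (#|Q| + #|S|))%N.
Proof.
have leX : (#|Q :|: S| <= #|Q| + #|S|)%N by rewrite cardsU leq_subr.
have [] := @euler_girth R G D (between Q S) (Q :|: S) 4 (between_edges _ _) (@between_sub Q S).
- move=> F FB F0 lt; apply: contrapT => nl; have := no_leaf_card4 FB F0 nl; lia.
- lia.
- lia.
Qed.

Lemma card_between6 (R : realType) (D : embedding R G) :
  (forall x, x \in Q -> #|nbhd x :&: S| = 2) ->
  (forall x x', x \in Q -> x' \in Q -> nbhd x :&: S = nbhd x' :&: S -> x = x') ->
  (2 * #|between Q S| <= 3 * (#|Q| + #|S|))%N.
Proof.
move=> two uniqN.
have leX : (#|Q :|: S| <= #|Q| + #|S|)%N by rewrite cardsU leq_subr.
have [] := @euler_girth R G D (between Q S) (Q :|: S) 6 (between_edges _ _) (@between_sub Q S).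
- move=> F FB F0 lt; apply: contrapT => nl; have := no_leaf_card6 FB F0 nl two uniqN; lia.
- lia.
- lia.
Qed.

End Disjoint.

End BipartiteEdges.

Lemma card_edges3 (R : realType) (G : sgraph) (D : embedding R G) (E : {set {set G}}) (X : {set G}) :
  E \subset edges G -> (forall e, e \in E -> e \subset X) -> (0 < #|X|)%N -> (#|E| < 3 * #|X|)%N.
Proof.
move=> EG EX X0; have [] := @euler_girth R G D E X 3 EG EX.
- by move=> F FE; apply: girth3; exact: fintype.subset_trans FE EG.
- lia.
- lia.
Qed.

(** * Counting edges from a partition of the vertices *)

Section Count.
Variables (R : realType) (G : sgraph) (D : embedding R G).
Variables (J A P L : {set G}).
Hypothesis cover4 : forall v, [|| v \in J, v \in A, v \in P | v \in L].
Hypotheses (JA : forall v, v \in J -> v \notin A) (PA : forall v, v \in P -> v \notin A).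
Hypothesis JP : forall v, v \in J -> v \notin P.
Hypothesis J_indep : forall x y, x \in J -> y \in J -> ~~ adj x y.
Hypothesis P_J : forall v x, v \in P -> x \in J -> ~~ adj v x.
Hypothesis P_A : forall v, v \in P -> (3 <= #|nbhd v :&: A|)%N.
Hypothesis L_J : forall v, v \in L -> (#|nbhd v :&: J| <= 1)%N.
Hypothesis tf : twin_free G.

Let N := A :|: P :|: L.
Let c x := #|nbhd x :&: A|.
(** Outside [W] a vertex of [J] has all its neighbours in [A]; twin-freeness limits those with one
    or two neighbours, planarity those with more. The vertices of [W] are charged to [L]. *)
Let Q3 := [set x in J | (2 < c x)%N]%SET.
Let W := [set x in J | [exists v in L, adj x v]]%SET.
Let J1 := [set x in J | (x \notin W) && (c x == 1)%N]%SET.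
Let J2 := [set x in J | (x \notin W) && (c x == 2)%N]%SET.

Lemma sum_J_L : (\sum_(x in J) #|nbhd x :&: L| <= #|L|)%N.
Proof.
have -> : (\sum_(x in J) #|nbhd x :&: L| = \sum_(v in L) #|nbhd v :&: J|)%N.
  under eq_bigr do rewrite -sum1_card; under [RHS]eq_bigr do rewrite -sum1_card.
  rewrite (exchange_big_dep (mem L)) /=; last by move=> x v _; rewrite inE => /andP[].
  by apply: eq_bigr => v vL; apply: eq_bigl => x; rewrite !inE vL andbT adj_sym andbC.
by rewrite -sum1_card; apply: leq_sum => v; exact: L_J.
Qed.

Lemma card_W : (#|W| <= #|L|)%N.
Proof.
apply: leq_trans sum_J_L; rewrite -sum1_card.
rewrite [X in (_ <= X)%N](bigID (mem W)) /=; apply: leq_trans (leq_addr _ _).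
rewrite (eq_bigl (fun x => (x \in J) && (x \in W))); last first.
  by move=> x; rewrite [x \in W]inE; case: (x \in J).
apply: leq_sum => x /andP[_]; rewrite inE => /andP[_ /existsP[v /andP[vL xv]]].
by rewrite card_gt0; apply/set0Pn; exists v; rewrite !inE xv.
Qed.

Lemma nbhd_J x : x \in J -> x \notin W -> nbhd x :&: A = nbhd x.
Proof.
move=> xJ xW; apply/finset.setIidPl/fintype.subsetP => v; rewrite inE => xv.
have := cover4 v => /or4P[vJ|//|vP|vL].
- by have := J_indep xJ vJ; rewrite xv.
- by have := P_J vP xJ; rewrite adj_sym xv.
- by exfalso; move: xW; rewrite inE xJ => /negP; apply; apply/existsP; exists v; rewrite vL.
Qed.

Lemma nbhd_inj (x x' : G) : nbhd x = nbhd x' -> x = x'.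
Proof. by move=> e; apply: contrapT => ne; apply: (tf (x := x) (y := x')). Qed.

Lemma card_J1 : (#|J1| <= #|A|)%N.
Proof.
have inj : {in J1 &, injective (@nbhd G)} by move=> x x' _ _; exact: nbhd_inj.
rewrite -(card_in_imset inj) -(card_imset (mem A) (@set1_inj G)).
apply: subset_leq_card; apply/fintype.subsetP => B /imsetP[x].
rewrite inE => /and3P[xJ xW /cards1P[v nv]] ->.
have vA : v \in A.
  suff : v \in nbhd x :&: A by rewrite !inE => /andP[].
  by rewrite nv inE.
by apply/imsetP; exists v => //; rewrite -nv nbhd_J.
Qed.

(** By twin-freeness distinct vertices of [J2] have distinct pairs of neighbours, so they subdivide
    edges of a simple graph on [A]. The girth is 6, and [4 |J2| <= 3 (|J2| + |A|)]. *)
Lemma card_J2 : (#|J2| <= 3 * #|A|)%N.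
Proof.
have dis x : x \in J2 -> x \notin A by rewrite inE => /andP[/JA].
have two x : x \in J2 -> #|nbhd x :&: A| = 2 by rewrite inE => /and3P[_ _ /eqP].
have uniqN x x' : x \in J2 -> x' \in J2 -> nbhd x :&: A = nbhd x' :&: A -> x = x'.
  move=> /setIdP[xJ /andP[xW _]] /setIdP[xJ' /andP[xW' _]].
  by rewrite !nbhd_J //; exact: nbhd_inj.
have := card_between6 dis D two uniqN; have := sum_between dis.
rewrite (eq_bigr (fun=> 2%N)) ?sum_nat_const; last by move=> x; exact: two.
lia.
Qed.

(** A degree [d >= 3] satisfies [d - 2 >= d / 3] and [d - 2 >= 1]. The bipartite bound [2 n] thus
    leaves a third of the degrees in [Q3] plus [|P|] to be covered by [2 |A|]. The gain [3 |P|]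
    later pays for the vertices of [P]. *)
Lemma sum_Q3 : (\sum_(x in Q3) c x + 3 * #|P| <= 6 * #|A|)%N.
Proof.
pose Q := Q3 :|: P.
have dis x : x \in Q -> x \notin A by rewrite !inE => /orP[/andP[/JA]|/PA].
have split_sum (F : G -> nat) : (\sum_(x in Q) F x = \sum_(x in Q3) F x + \sum_(x in P) F x)%N.
  rewrite (bigID (mem Q3)) /=; congr (_ + _)%N; apply: eq_bigl => x; rewrite [x \in Q]finset.in_setU.
    by case: (x \in Q3); rewrite ?andbF.
  case: (boolP (x \in Q3)) => [/setIdP[xJ _]|_]; rewrite ?andbF ?andbT //=.
  by rewrite (negPf (JP xJ)).
have := sum_between dis; have := card_between4 dis D.
rewrite split_sum; have -> : #|Q| = (#|Q3| + #|P|)%N.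
  by rewrite -!sum1_card split_sum.
have : (3 * #|Q3| <= \sum_(x in Q3) c x)%N.
  by rewrite mulnC -sum_nat_const; apply: leq_sum => x; rewrite inE => /andP[].
have : (3 * #|P| <= \sum_(x in P) #|nbhd x :&: A|)%N.
  by rewrite mulnC -sum_nat_const; apply: leq_sum => x; exact: P_A.
rewrite /c; lia.
Qed.

Lemma sum_J_A : (\sum_(x in J) c x <= \sum_(x in Q3) c x + 2 * #|W| + #|J1| + 2 * #|J2|)%N.
Proof.
rewrite (mulnC 2) (mulnC 2) -!sum_nat_const -[#|J1|]sum1_card.
have mk (B : {set G}) (F : G -> nat) : B \subset J ->
    (\sum_(x in B) F x = \sum_(x in J) if x \in B then F x else 0)%N.
  move=> /fintype.subsetP BJ; rewrite -big_mkcondr /=; apply: eq_bigl => x.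
  by case: (boolP (x \in B)) => [/BJ ->|_]; rewrite ?andbF.
have sJ (p : pred G) : [set x in J | p x]%SET \subset J.
  by apply/fintype.subsetP => x; rewrite inE => /andP[].
rewrite (mk Q3) ?(mk W) ?(mk J1) ?(mk J2) ?sJ // -!big_split /=.
apply: leq_sum => x xJ.
rewrite [x \in Q3]inE [x \in J1]inE [x \in J2]inE xJ /=.
case: (ltnP 2 (c x)) => [_|le2]; first by rewrite -!addnA leq_addr.
by case: (x \in W) => /=; move: (c x) le2 => [|[|[|n]]].
Qed.

(** There are fewer than [3 (|A| + |P| + |L|)] edges inside [N]. The others have an end in [J]:
    those into [A] number at most [6 |A| - 3 |P|] from [Q3], [2 |L|] from [W], [|A|] from [J1] and
    [6 |A|] from [J2], and at most [|L|] go into [L]. The terms in [|P|] cancel. *)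
Lemma count_edges : (0 < #|edges G|)%N -> (#|edges G| < 16 * #|A| + 6 * #|L|)%N.
Proof.
move=> E0.
pose E1 := [set e in edges G | e \subset N]%SET.
pose E2 := [set e in edges G | ~~ (e \subset N)]%SET.
have cN v : v \notin N -> v \in J.
  by have := cover4 v; rewrite !inE => /or4P[] ->; rewrite ?orbT.
have N0 : (0 < #|N|)%N.
  rewrite card_gt0; apply: contraTneq E0 => N0; rewrite -leqNgt leqn0 cards_eq0.
  apply/eqP/setP => e; rewrite inE; apply/negP => /imsetP[[x y]]; rewrite inE /= => xy _.
  by have := @J_indep x y; rewrite xy !cN ?N0 ?inE // => /(_ isT isT).
have h1 : (#|E1| < 3 * #|N|)%N.
  apply: (card_edges3 D) => //; first by apply/fintype.subsetP => e; rewrite inE => /andP[].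
  by move=> e; rewrite inE => /andP[].
have hN : (#|N| <= #|A| + #|P| + #|L|)%N.
  apply: leq_trans (leq_card_setU _ _).1 _; rewrite leq_add2r.
  exact: (leq_card_setU _ _).1.
have h2 : (#|E2| <= \sum_(x in J) #|nbhd x|)%N.
  apply: (@leq_trans (\sum_(x in J) #|incident E2 x|)).
    have -> : (\sum_(x in J) #|incident E2 x| = \sum_(e in E2) #|[set x in J | x \in e]%SET|)%N.
      under eq_bigr do rewrite -sum1_card; under [RHS]eq_bigr do rewrite -sum1_card.
      rewrite (exchange_big_dep (mem E2)) /=; last by move=> x e _ /setIdP[].
      by apply: eq_bigr => e eE2; apply: eq_bigl => x; rewrite [_ \in incident _ _]inE [RHS]inE eE2.
    rewrite -sum1_card; apply: leq_sum => e /setIdP[_ /subsetPn[x xe xN]].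
    by rewrite card_gt0; apply/set0Pn; exists x; rewrite inE xe cN.
  apply: leq_sum => x _.
  apply: leq_trans (leq_imset_card (fun y => [set x; y]%SET) (mem (nbhd x))).
  apply: subset_leq_card; apply/fintype.subsetP => e /setIdP[/setIdP[eG _] xe].
  by have [y xy ->] := edge_other eG xe; apply: imset_f; rewrite inE.
have hE : #|edges G| = (#|E1| + #|E2|)%N.
  rewrite -(cardsID [set e : {set G} | e \subset N]%SET (edges G)); congr (_ + _)%N.
    by apply: eq_card => e; rewrite !inE.
  by apply: eq_card => e; rewrite !inE andbC.
have hsum : (\sum_(x in J) #|nbhd x| <= \sum_(x in J) c x + \sum_(x in J) #|nbhd x :&: L|)%N.
  rewrite -big_split /=; apply: leq_sum => x xJ.
  apply: leq_trans (leq_card_setU _ _).1.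
  apply: subset_leq_card; apply/fintype.subsetP => v; rewrite !inE => xv.
  have := cover4 v => /or4P[vJ|vA|vP|vL]; rewrite xv ?vA ?vL ?orbT //=.
  - by have := J_indep xJ vJ; rewrite xv.
  - by have := P_J vP xJ; rewrite adj_sym xv.
have := sum_J_A; have := sum_Q3; have := card_J2; have := card_J1; have := card_W; have := sum_J_L.
rewrite hE; lia.
Qed.

End Count.

(** * Exchanging leaves with free vertices *)
Lemma sum_degrees (G : sgraph) : (\sum_(x : G) #|nbhd x| <= 2 * #|edges G|)%N.
Proof.
apply: (@leq_trans (\sum_(x : G) #|incident (edges G) x|)).
  apply: leq_sum => x _.
  have inj : {in nbhd x &, injective (fun y => [set x; y]%SET)}.
    by move=> y z _ _; exact: set2_inj.
  rewrite -(card_in_imset inj); apply: subset_leq_card.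
  apply/fintype.subsetP => e /imsetP[y]; rewrite inE => xy ->.
  by rewrite inE adj_edge // !inE eqxx.
have -> : (\sum_(x : G) #|incident (edges G) x| = \sum_(e in edges G) #|[set x | x \in e]%SET|)%N.
  under eq_bigr do rewrite -sum1_card; under [RHS]eq_bigr do rewrite -sum1_card.
  rewrite (exchange_big_dep (mem (edges G))) /=; last by move=> x e _ /setIdP[].
  by apply: eq_bigr => e eE; apply: eq_bigl => x; rewrite [_ \in incident _ _]inE [RHS]inE eE.
rewrite mulnC -sum_nat_const; apply: leq_sum => e /imsetP[[x y] _ ->] /=.
have -> : #|[set z | z \in [set x; y]]|%SET = #|[set x; y]%SET|.
  by apply: eq_card => z; rewrite inE.
by rewrite cards2; case: (_ != _).
Qed.

Section Absorption.
Variables (H G : sgraph) (f0 : H -> G).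
Hypothesis emb0 : core_emb f0.
Hypothesis indep : forall f : H -> G, core_emb f -> forall x y,
  x \notin f @: core H -> y \notin f @: core H -> ~~ adj x y.

Implicit Types (f : H -> G) (l p v : H) (B : {set H}).

Definition leaf (x : H) := #|nbhd x| == 1%N.

Lemma core_adj (x y : H) : adj x y -> (x \in core H) * (y \in core H).
Proof.
move=> xy; split; rewrite inE; apply/existsP; first by exists y.
by exists x; rewrite adj_sym.
Qed.

Lemma leaf_uniq (x p q : H) : leaf x -> adj x p -> adj x q -> p = q.
Proof.
move=> /cards1P[r hr] xp xq; have : (p \in nbhd x) && (q \in nbhd x) by rewrite !inE xp.
by rewrite hr !inE => /andP[/eqP -> /eqP ->].
Qed.

Lemma move_leaf f l p z : core_emb f -> leaf l -> adj l p -> z \notin f @: core H ->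
  adj (f p) z -> core_emb (fun t => if t == l then z else f t).
Proof.
move=> [finj fadj] ll lp nz pz; split.
  move=> s t sc tc; case: (eqVneq s l) => [->|sl]; case: (eqVneq t l) => [->|tl] // e.
  - by move: nz; rewrite e imset_f.
  - by move: nz; rewrite -e imset_f.
  - exact: finj.
have pl : (p == l) = false by apply/eqP => h; rewrite h adj_irr in lp.
move=> x y xy; case: (eqVneq x l) => [xl|xl].
  by rewrite xl in xy; rewrite -(leaf_uniq ll lp xy) pl adj_sym.
case: (eqVneq y l) => [yl|yl]; last exact: fadj.
by rewrite yl adj_sym in xy; rewrite -(leaf_uniq ll lp xy).
Qed.

Definition free (B : {set H}) : {set G} := ~: (f0 @: (core H :\: B)).

(* Two vertices at a time are enough: an edge between them contradicts [indep]. *)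
Definition absorbed (B : {set H}) := [/\ forall l, l \in B -> leaf l,
  forall l p, l \in B -> adj l p -> p \notin B &
  forall x y, x \in free B -> y \in free B -> x != y -> exists f, [/\ core_emb f,
    {in core H :\: B, f =1 f0}, x \notin f @: core H & y \notin f @: core H]].

Lemma free_in B v : v \in core H -> v \notin B -> f0 v \notin free B.
Proof. by move=> vc vB; rewrite inE negbK imset_f // inE vB. Qed.

Lemma absorbed0 : absorbed finset.set0.
Proof.
split=> [l|l p|x y]; rewrite ?inE // => xf yf _.
by exists f0; split => //; move: xf yf; rewrite finset.setD0.
Qed.

(** Moving [l] onto a free neighbour of [f0 p] uncovers [f0 l]. Two such neighbours are required
    because one of them may be the very vertex that is to be uncovered together with [f0 l]. *)
Lemma absorb_step B l p z1 z2 : absorbed B -> leaf l -> l \notin B -> adj l p -> p \notin B ->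
  z1 \in free B -> z2 \in free B -> z1 != z2 -> adj (f0 p) z1 -> adj (f0 p) z2 ->
  absorbed (l |: B).
Proof.
move=> [B1 B2 B3] ll lB lp pB z1J z2J z12 pz1 pz2.
have [lc pc] := core_adj lp.
have pl : p != l by apply/eqP => h; rewrite h adj_irr in lp.
have freeE x : x \in free (l |: B) -> x = f0 l \/ x \in free B.
  rewrite !inE => /negP h; case: (boolP (x \in f0 @: (core H :\: B))) => [/imsetP[t]|]; last by right.
  rewrite !inE => /andP[tB tc] xt; left; rewrite xt; congr f0; apply/eqP; apply: contrapT => /negP tl.
  by apply: h; rewrite xt imset_f // !inE negb_or tl tB.
split.
- by move=> x; rewrite !inE => /orP[/eqP ->|/B1].
- move=> x q; rewrite !inE => /orP[/eqP ->|xB] xq.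
    by rewrite -(leaf_uniq ll lp xq) negb_or pl.
  rewrite negb_or (B2 x q) // andbT; apply/eqP => ql.
  rewrite ql adj_sym in xq; move: pB; by rewrite (leaf_uniq ll lp xq) xB.
have one y : y \in free B -> exists f, [/\ core_emb f,
    {in core H :\: (l |: B), f =1 f0}, f0 l \notin f @: core H & y \notin f @: core H].
  move=> yJ; have [z [zJ pz zy]] : exists z, [/\ z \in free B, adj (f0 p) z & z != y].
    by case: (eqVneq z1 y) => [e|ne]; [exists z2; rewrite -e eq_sym|exists z1].
  have [f [fe ff0 zf yf]] := B3 z y zJ yJ zy.
  have fp : f p = f0 p by apply: ff0; rewrite inE pB.
  have fl : f l = f0 l by apply: ff0; rewrite inE lB.
  have lz : z != f0 l by apply: contraTneq zJ => ->; exact: free_in.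
  have := move_leaf fe ll lp zf; rewrite fp => /(_ pz) fe'.
  exists (fun t => if t == l then z else f t); split => //.
  - move=> t; rewrite !inE negb_or => /andP[/andP[tl tB] tc]; rewrite (negPf tl).
    by apply: ff0; rewrite !inE tB.
  - apply/imsetP => -[t tc]; case: (eqVneq t l) => [_ e|tl e].
      by rewrite e eqxx in lz.
    by move: tl; rewrite -(fe.1 _ _ lc tc) ?eqxx // fl.
  - apply/imsetP => -[t tc]; case: (eqVneq t l) => [_ e|tl e].
      by rewrite e eqxx in zy.
    by move: yf; rewrite e imset_f.
move=> x y /freeE[->|xJ] /freeE[->|yJ] xy; first by rewrite eqxx in xy.
- exact: one.
- by have [f [? ? ? ?]] := one x xJ; exists f; split.
have [f [fe ff0 xf yf]] := B3 x y xJ yJ xy; exists f; split => // t.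
by rewrite !inE negb_or => /andP[/andP[_ tB] tc]; apply: ff0; rewrite !inE tB.
Qed.

Lemma absorbed_max : exists2 B, absorbed B & forall B', absorbed B' -> (#|B'| <= #|B|)%N.
Proof.
have [B /asboolP HB mx] := @arg_maxnP {set H} finset.set0 (fun B => `[< absorbed B >])
  (fun B => #|B|) (asboolT absorbed0).
by exists B => // B' /asboolT/mx.
Qed.

Variable B : {set H}.
Hypotheses (HB : absorbed B) (Bmax : forall B', absorbed B' -> (#|B'| <= #|B|)%N).

Notation J := (free B).

Lemma free_indep x y : x \in J -> y \in J -> ~~ adj x y.
Proof.
move=> xJ yJ; case: (eqVneq x y) => [->|xy]; first by rewrite adj_irr.
by have [_ _ /(_ x y xJ yJ xy)[f [fe _ xf yf]]] := HB; exact: indep fe _ _ xf yf.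
Qed.

Definition free_degree (v : H) := #|nbhd (f0 v) :&: J|.

Lemma leaf_parent l p : leaf l -> l \notin B -> adj l p -> p \notin B -> (free_degree p <= 1)%N.
Proof.
move=> ll lB lp pB; rewrite leqNgt; apply/negP => /card_gt1P[z1 [z2 [h1 h2 z12]]].
move: h1 h2; rewrite !finset.in_setI !inE => /andP[p1 J1] /andP[p2 J2].
have := absorb_step HB ll lB lp pB _ _ z12 p1 p2; rewrite !inE => /(_ J1 J2) /Bmax.
by rewrite cardsU1 lB ltnn.
Qed.

(** Otherwise, moving [l] to [x] would uncover [f0 l], which is joined to [y], and [y] can be kept
    uncovered at the same time. *)
Lemma leaf_exchange l p x y : leaf l -> l \notin B -> adj l p -> p \notin B ->
  x \in J -> y \in J -> adj (f0 p) x -> adj (f0 l) y -> x = y.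
Proof.
move=> ll lB lp pB xJ yJ px ly; apply/eqP; apply: contrapT => /negP xy.
have [lc pc] := core_adj lp.
have [_ _ /(_ x y xJ yJ xy)[f [fe ff0 xf yf]]] := HB.
have fp : f p = f0 p by apply: ff0; rewrite inE pB.
have fl : f l = f0 l by apply: ff0; rewrite inE lB.
have := move_leaf fe ll lp xf; rewrite fp => /(_ px) fe'.
suff : ~~ adj (f0 l) y by rewrite ly.
apply: (indep fe').
  apply/imsetP => -[t tc]; case: (eqVneq t l) => [_ e|tl e].
    by have := free_in lc lB; rewrite e xJ.
  by move: tl; rewrite -(fe.1 _ _ lc tc) ?eqxx // fl.
apply/imsetP => -[t tc]; case: (eqVneq t l) => [_ e|tl e].
  by move: xy; rewrite e eqxx.
by move: yf; rewrite e imset_f.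
Qed.

(** The path [l1 p l2] is placed anew, with [p] on [f0 l1], [l1] on [f0 p] and [l2] on [x]. This
    uncovers [f0 l2], which is joined to the uncovered [y]. *)
Lemma cherry_exchange p l1 l2 x y : nbhd p = [set l1; l2]%SET -> l1 != l2 ->
  leaf l1 -> leaf l2 -> p \notin B -> l1 \notin B -> l2 \notin B ->
  x \in J -> y \in J -> x != y -> adj (f0 l1) x -> adj (f0 l2) y -> False.
Proof.
move=> np l12 ll1 ll2 pB l1B l2B xJ yJ xy l1x l2y.
have [pl1 pl2] : adj p l1 /\ adj p l2.
  suff : (l1 \in nbhd p) && (l2 \in nbhd p) by rewrite !inE => /andP[].
  by rewrite np !inE !eqxx orbT.
have [pc l1c] := core_adj pl1; have [_ l2c] := core_adj pl2.
have [l1p l2p] : adj l1 p /\ adj l2 p by rewrite ![adj _ p]adj_sym.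
have pnl1 : p != l1 by apply/eqP => h; rewrite h adj_irr in pl1.
have pnl2 : p != l2 by apply/eqP => h; rewrite h adj_irr in pl2.
have [_ _ /(_ x y xJ yJ xy)[f [[finj fadj] ff0 xf yf]]] := HB.
have fE v : v \in core H -> v \notin B -> f v = f0 v by move=> vc vB; apply: ff0; rewrite inE vB.
pose s t := if t == p then l1 else if t == l1 then p else t.
have sK t : s (s t) = t.
  rewrite /s; case: (eqVneq t p) => [->|tp]; first by rewrite eq_sym (negPf pnl1) eqxx.
  by case: (eqVneq t l1) => [->|tl]; rewrite ?eqxx // (negPf tp) (negPf tl).
have sc t : t \in core H -> s t \in core H by rewrite /s; case: eqP => // _; case: eqP.
pose f' t := if t == l2 then x else f (s t).
have nf' z : z \notin f @: core H -> z != x -> z \notin f' @: core H.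
  move=> zf zx; apply/imsetP => -[t tc]; rewrite /f'; case: eqP => _ e.
    by rewrite e eqxx in zx.
  by move: zf; rewrite e imset_f // sc.
have fe' : core_emb f'.
  split.
    move=> t u tc uc; rewrite /f'; case: (eqVneq t l2) => [->|tl]; case: (eqVneq u l2) => [->|ul] // e.
    - by move: xf; rewrite e imset_f // sc.
    - by move: xf; rewrite -e imset_f // sc.
    - by have /(congr1 s) := finj _ _ (sc t tc) (sc u uc) e; rewrite !sK.
  have sp : s p = l1 by rewrite /s eqxx.
  have sl1 : s l1 = p by rewrite /s eq_sym (negPf pnl1) eqxx.
  have half t u : adj t u -> t = p \/ t = l1 \/ t = l2 -> adj (f' t) (f' u).
    move=> tu [tp|[tl|tl]]; rewrite tp || rewrite tl.
    - rewrite tp in tu; have : u \in nbhd p by rewrite inE.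
      rewrite np !inE => /orP[]/eqP ->; rewrite /f' (negPf pnl2) sp.
        by rewrite (negPf l12) sl1; exact: fadj.
      by rewrite eqxx fE.
    - rewrite tl in tu; rewrite -(leaf_uniq ll1 l1p tu) /f' (negPf l12) (negPf pnl2) sl1 sp.
      exact: fadj.
    - rewrite tl in tu; rewrite -(leaf_uniq ll2 l2p tu) /f' eqxx (negPf pnl2) sp adj_sym.
      by rewrite fE.
  move=> t u tu.
  case: (pselect (t = p \/ t = l1 \/ t = l2)) => [/(half _ _ tu)//|nt].
  case: (pselect (u = p \/ u = l1 \/ u = l2)) => [hu|nu].
    by rewrite adj_sym; apply: half => //; rewrite adj_sym.
  have simple v : ~ (v = p \/ v = l1 \/ v = l2) -> f' v = f v.
    move=> nv; rewrite /f' /s.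
    case: eqP => [h|_]; first by exfalso; apply: nv; right; right.
    case: eqP => [h|_]; first by exfalso; apply: nv; left.
    by case: eqP => [h|_] //; exfalso; apply: nv; right; left.
  by rewrite !simple //; exact: fadj.
suff : ~~ adj (f0 l2) y by rewrite l2y.
apply: (indep fe'); last by apply: nf' => //; rewrite eq_sym.
apply/imsetP => -[t tc]; rewrite /f'; case: (eqVneq t l2) => [_ e|tl e].
  by have := free_in l2c l2B; rewrite e xJ.
rewrite -fE // in e; have := finj _ _ l2c (sc t tc) e => /(congr1 s); rewrite sK.
by rewrite /s eq_sym (negPf pnl2) eq_sym (negPf l12) => h; rewrite h eqxx in tl.
Qed.

(** With [J = free B], the images under [f0] of [rich], [hubs] and [poor] below become the sets [A],
    [P] and [L] of [count_edges]. *)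
Definition kept : {set H} := core H :\: B.
Definition rich : {set H} := [set v in kept | (1 < free_degree v)%N]%SET.
Definition hubs : {set H} := [set v in kept | (free_degree v == 0)%N && (3 <= #|nbhd (f0 v) :&: f0 @: rich|)%N]%SET.
Definition poor : {set H} := kept :\: (rich :|: hubs).
Definition rich_leaves : {set H} := [set l in rich | leaf l]%SET.
Definition kids (v : H) : {set H} := [set l in rich_leaves | adj l v]%SET.

Lemma keptP v : v \in kept -> v \in core H /\ v \notin B.
Proof. by rewrite inE => /andP[]. Qed.

Lemma kidP l v : l \in kids v -> [/\ adj l v, leaf l, l \in kept & (1 < free_degree l)%N].
Proof. by move=> /setIdP[/setIdP[/setIdP[? ?] ?] ?]. Qed.

Lemma kids_low v l : l \in kids v -> v \notin B -> (free_degree v <= 1)%N.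
Proof. by move=> /kidP[lv ll /keptP[_ lB] _] vB; exact: (leaf_parent ll lB lv). Qed.

(** If [f0 v] had a free neighbour, [leaf_exchange] would make it the only free neighbour of [f0 l],
    whereas a kid has at least two. *)
Lemma kids_zero v l : l \in kids v -> v \notin B -> free_degree v = 0.
Proof.
move=> /kidP[lv ll /keptP[_ lB] dl] vB; apply/eqP; rewrite cards_eq0; apply/eqP/setP => x.
rewrite finset.in_setI finset.in_set0; apply/negP => /andP[vx xJ]; rewrite inE in vx.
move: dl; rewrite ltnNge => /negP; apply; apply/card_le1_eqP => y z.
rewrite !finset.in_setI => /andP[ly yJ] /andP[lz zJ]; rewrite inE in ly; rewrite inE in lz.
by rewrite -(leaf_exchange ll lB lv vB xJ yJ vx ly) -(leaf_exchange ll lB lv vB xJ zJ vx lz).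
Qed.

Lemma kids_rich v : v \in rich -> kids v = finset.set0.
Proof.
move=> /setIdP[/keptP[_ vB] dv]; apply/setP => l; rewrite finset.in_set0; apply/negP => lk.
by have := kids_low lk vB; rewrite leqNgt dv.
Qed.

Lemma kids_nbhd v : kids v \subset nbhd v.
Proof. by apply/fintype.subsetP => l /kidP[lv _ _ _]; rewrite inE adj_sym. Qed.

Lemma f0_card (X : {set H}) : X \subset core H -> #|f0 @: X| = #|X|.
Proof.
move=> /fintype.subsetP Xc; apply: card_in_imset => x y /Xc xc /Xc yc; exact: emb0.1.
Qed.

(** Suppose that all neighbours are kids. With one neighbour, [v] is a leaf too and [leaf_parent]
    contradicts the richness of its kid; with two, [cherry_exchange] applies; with three or more,
    [v] is a hub by [kids_zero]. *)
Lemma kids_not_all v : v \in poor -> (#|kids v| < #|nbhd v|)%N.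
Proof.
rewrite inE => /andP[+ vNB]; rewrite inE negb_or => /andP[vA vP].
have [vc vB] := keptP vNB.
rewrite ltn_neqAle subset_leq_card ?kids_nbhd // andbT; apply/negP => /eqP ck.
have kN : kids v = nbhd v by apply/eqP; rewrite eqEcard kids_nbhd ck leqnn.
have [l0 l0v] : exists l, l \in kids v.
  move: vc; rewrite inE => /existsP[l vl]; exists l; by rewrite kN inE.
have dv := kids_zero l0v vB.
case: (ltngtP #|nbhd v| 2) => hc.
- have lv : leaf v.
    rewrite /leaf eqn_leq -ltnS hc card_gt0; apply/set0Pn; exists l0; by rewrite -kN.
  have [vl _ /keptP[_ lB] dl] := kidP l0v; rewrite adj_sym in vl.
  by have := leaf_parent lv vB vl lB; rewrite leqNgt dl.
- move: vP; rewrite inE vNB dv eqxx /= => /negP; apply.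
  have kA : kids v \subset rich by apply/fintype.subsetP => l /setIdP[/setIdP[]].
  have kc : kids v \subset core H.
    by apply/fintype.subsetP => l /kidP[_ _ /keptP[]].
  apply: leq_trans hc _; rewrite -kN -(f0_card kc); apply: subset_leq_card.
  apply/fintype.subsetP => w /imsetP[l lk ->]; rewrite finset.in_setI imset_f ?(fintype.subsetP kA) // andbT.
  by have [lv _ _ _] := kidP lk; rewrite inE; apply: emb0.2; rewrite adj_sym.
move/eqP: hc => /cards2P[l1 [l2 [l12 nv]]].
have k1 : l1 \in kids v by rewrite kN nv !inE eqxx.
have k2 : l2 \in kids v by rewrite kN nv !inE eqxx orbT.
have [_ ll1 /keptP[_ l1B] d1] := kidP k1; have [_ ll2 /keptP[_ l2B] d2] := kidP k2.
have [x] : exists x, x \in nbhd (f0 l1) :&: J by apply/set0Pn; rewrite -card_gt0 ltnW.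
rewrite finset.in_setI inE => /andP[l1x xJ].
have [y ] : exists y, y \in (nbhd (f0 l2) :&: J) :\ x.
  apply/set0Pn; rewrite -card_gt0; move: d2; rewrite /free_degree (cardsD1 x).
  by case: (x \in _); [rewrite add1n ltnS|rewrite add0n => /ltnW].
rewrite finset.in_setD1 finset.in_setI inE => /and3P[yx l2y yJ].
by apply: (cherry_exchange nv l12 ll1 ll2 vB l1B l2B xJ yJ _ l1x l2y); rewrite eq_sym.
Qed.

(* Discharging: every leaf of [H] in [rich] takes 4 from its neighbour. *)
Lemma discharge : (8 * #|rich| + 3 * #|poor| <= 8 * #|edges H|)%N.
Proof.
pose weight v := ((v \in rich) * 8 + (v \in poor) * 3)%N.
(* Each vertex starts with 4 per incident edge. A rich leaf ends with [4 + 4]; a rich vertex that is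
   no leaf starts with at least 8 and has no kids; a poor vertex has a neighbour that is not a kid
   and keeps at least 4; any other vertex may end with 0. *)
have local v : (weight v + 4 * #|kids v| <= 4 * #|nbhd v| + 4 * (v \in rich_leaves))%N.
  rewrite /weight; case: (boolP (v \in rich)) => vA.
    have -> : (v \in poor) = false by rewrite inE inE vA.
    rewrite kids_rich // cards0.
    have [/setIdP[/keptP[vc _] _]] := vA.
    have : (0 < #|nbhd v|)%N.
      by move: vc; rewrite inE => /existsP[w vw]; rewrite card_gt0; apply/set0Pn; exists w; rewrite inE.
    rewrite [v \in rich_leaves]inE vA /leaf; case: #|nbhd v| => [|[|n]] //=; lia.
  case: (boolP (v \in poor)) => [/kids_not_all|_].
    by case: (v \in rich_leaves); lia.
  have := subset_leq_card (kids_nbhd v); lia.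
have s1 : (\sum_(v : H) weight v = 8 * #|rich| + 3 * #|poor|)%N.
  rewrite big_split /= -!big_distrl /= -!sum1_card !(mulnC 8) !(mulnC 3).
  by congr (_ * _ + _ * _)%N; rewrite [RHS]big_mkcond; apply: eq_bigr => v _; case: (_ \in _).
have s2 : (\sum_(v : H) #|kids v| = #|rich_leaves|)%N.
  under eq_bigr do rewrite -sum1_card.
  rewrite (exchange_big_dep (mem rich_leaves)) /=; last by move=> v l _ /setIdP[].
  rewrite -[RHS]sum1_card; apply: eq_bigr => l lA.
  rewrite sum1dep_card; have /setIdP[_ /eqP <-] := lA.
  by apply: eq_card => v; rewrite [LHS]inE [l \in kids v]inE lA [RHS]inE.
have s3 : (\sum_(v : H) (v \in rich_leaves) = #|rich_leaves|)%N.
  by rewrite -sum1_card [RHS]big_mkcond; apply: eq_bigr => v _; case: (_ \in _).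
have : (\sum_(v : H) (weight v + 4 * #|kids v|) <= \sum_(v : H) (4 * #|nbhd v| + 4 * (v \in rich_leaves)))%N.
  by apply: leq_sum => v _; exact: local.
have dist (F : H -> nat) : (\sum_(v : H) 4 * F v = 4 * \sum_(v : H) F v)%N by rewrite big_distrr.
have split2 (F F' : H -> nat) : (\sum_(v : H) (F v + F' v) = \sum_(v : H) F v + \sum_(v : H) F' v)%N.
  by rewrite big_split.
rewrite (split2 weight (fun v => 4 * #|kids v|)%N) (split2 (fun v => 4 * #|nbhd v|)%N) !dist s1 s2 s3.
have := sum_degrees H; lia.
Qed.

Lemma f0_inj_in (X : {set H}) v : X \subset core H -> v \in core H ->
  (f0 v \in f0 @: X) = (v \in X).
Proof.
move=> /fintype.subsetP Xc vc; apply/imsetP/idP => [[w wX /emb0.1 ->//]|vX]; last by exists v.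
exact: Xc.
Qed.

Lemma edge_bound (R : realType) (D : embedding R G) : twin_free G ->
  (0 < #|edges G|)%N -> (#|edges G| < 16 * #|edges H|)%N.
Proof.
move=> tf E0.
have keptc : kept \subset core H by apply/fintype.subsetP => v /keptP[].
have richK : rich \subset kept by apply/fintype.subsetP => v /setIdP[].
have hubsK : hubs \subset kept by apply/fintype.subsetP => v /setIdP[].
have poorK : poor \subset kept by apply/fintype.subsetP => v; rewrite inE => /andP[].
have sc (X : {set H}) : X \subset kept -> X \subset core H by move=> h; exact: (fintype.subset_trans h keptc).
have JN (v : G) : (v \in J) = (v \notin f0 @: kept) by rewrite inE.
have inK (X : {set H}) (v : G) : X \subset kept -> v \in f0 @: X -> v \in f0 @: kept.
  by move=> h; apply: (fintype.subsetP (imsetS f0 h)).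
have notX (X : {set H}) (v : G) : X \subset kept -> v \in J -> v \notin f0 @: X.
  by move=> h; rewrite JN; apply: contra; exact: inK.
have := @count_edges R G D J (f0 @: rich) (f0 @: hubs) (f0 @: poor).
rewrite !f0_card ?sc // => cnt.
suff : (#|edges G| < 16 * #|rich| + 6 * #|poor|)%N by have := discharge; lia.
apply: cnt => //.
- move=> v; rewrite JN; case: (boolP (v \in f0 @: kept)) => //= /imsetP[w wN ->].
  have wc := fintype.subsetP keptc w wN.
  rewrite !f0_inj_in ?sc // [w \in poor]inE wN andbT finset.in_setU.
  by case: (w \in rich); case: (w \in hubs).
- by move=> v; exact: notX.
- move=> v /imsetP[w wP ->]; have wN := fintype.subsetP hubsK w wP.
  rewrite f0_inj_in ?sc ?(fintype.subsetP keptc) // inE wN /=.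
  by move: wP => /setIdP[_ /andP[/eqP -> _]].
- by move=> v; exact: notX.
- by move=> x y; exact: free_indep.
- move=> v x /imsetP[w /setIdP[_ /andP[/eqP d0 _]] ->] xJ; apply/negP => wx.
  have : (0 < free_degree w)%N by rewrite card_gt0; apply/set0Pn; exists x; rewrite finset.in_setI xJ inE wx.
  by rewrite d0.
- by move=> v /imsetP[w /setIdP[_ /andP[_ ?]] ->].
- move=> v /imsetP[w + ->]; rewrite inE => /andP[+ wN]; rewrite inE negb_or => /andP[wA _].
  by move: wA; rewrite inE wN /= -leqNgt.
Qed.

End Absorption.

(** * From edge counts to the saturation ratio *)

Lemma subgraph_card_edges (H G : sgraph) : is_subgraph H G -> (#|edges H| <= #|edges G|)%N.
Proof.
move=> [f finj fadj]; rewrite -(card_imset (mem (edges H)) (imset_inj finj)).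
apply: subset_leq_card; apply/fintype.subsetP => e /imsetP[e0 /imsetP[[x y]]].
rewrite inE /= => xy -> ->; rewrite imsetU1 imset_set1.
by apply: adj_edge; exact: fadj.
Qed.

(** A drawing of all of [G] has too many edges to be extended; it shows that the set of ratios is
    nonempty, as a lower bound on [inf] requires. *)
Lemma embedding_saturated (R : realType) (G : sgraph) (D : embedding R G) :
  plane_saturated (PlaneGraph D) G.
Proof.
split; first by exists id.
move=> H' [j [u [v [jinj _ /andP[_ nuv] eH' _]]]] /subgraph_card_edges.
by rewrite eH' cardsU1 nuv (card_imset _ (imset_inj jinj)) /= add1n ltnn.
Qed.

Lemma saturated_edges (R : realType) (H : plane_graph R) (G : sgraph) (D : embedding R G) :
  (0 < #|edges G|)%N -> twin_free G -> plane_saturated H G ->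
  (#|edges G| < 16 * #|edges H|)%N.
Proof.
move=> E0 tf sat; case: (leqP (3 * #|edges H| + 2) #|G|) => [big|small].
  have [[f finj fadj] _] := sat.
  have emb : core_emb f by split=> // x y _ _; exact: finj.
  have indep := saturated_independent sat big.
  have [B HB Bmax] := absorbed_max emb.
  exact: (edge_bound emb indep HB Bmax D tf E0).
(* Here [#|G| <= 3 m + 1] with [m = #|edges H|], so [G] has fewer than [9 m + 3] edges; two vertices
   force [m > 0], and then [9 m + 3 <= 16 m]. *)
have V2 : (2 <= #|G|)%N.
  have /set0Pn[e /imsetP[[x y]]] : edges G != finset.set0 by rewrite -card_gt0.
  rewrite inE /= => xy _; have xy' : x != y by apply: contraTneq xy => ->; rewrite adj_irr.
  by apply: (leq_trans _ (max_card [set x; y]%SET)); rewrite cards2 xy'.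
have : (#|edges G| < 3 * #|[set: G]%SET|)%N.
  by apply: (card_edges3 D) => //; rewrite cardsT; lia.
rewrite cardsT; lia.
Qed.

Theorem corollary1p4 (R : realType) (G : sgraph) (planarG : planar R G)
    (edgeG : (0 < #|edges G|)%N) (twin_freeG : twin_free G) :
  1 / 16%:R < psr R G.
Proof.
have [D] := planarG.
have m0 : (0 : R) < #|edges G|%:R by rewrite ltr0n.
have m16 : (0 : R) < 16%:R * #|edges G|%:R by rewrite mulr_gt0 // ltr0n.
(* Strict inequality for each ratio would not survive the infimum. Over the integers it reads
   [e(G) + 1 <= 16 e(H)], which gives one lower bound for all ratios, strictly above [1 / 16]. *)
apply: (@lt_le_trans _ _ (#|edges G|.+1%:R / (16%:R * #|edges G|%:R))).
  by rewrite ltr_pdivlMr // mulrA mul1r mulVf ?mul1r ?pnatr_eq0 // ltr_nat.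
apply: lb_le_inf.
  exists (#|edges G|%:R / #|edges G|%:R), (PlaneGraph D) => //; exact: embedding_saturated.
move=> _ [H satH ->]; have lt := saturated_edges D edgeG twin_freeG satH.
rewrite ler_pdivrMr // mulrCA -mulrA mulVf ?gt_eqF // mulr1 -natrM ler_nat.
exact: lt.
Qed.
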